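(* Consider the two-time-scale stochastic approximation iteration $$x_{t+1}=x_t-\alpha_t\,(F(x_t,y_t)+\xi_t),\qquad y_{t+1}=y_t-\beta_t\,(G(x_t,y_t)+\psi_t),\qquad t\ge 0,$$ under hypotheses (A1)--(A6) of the context (with $\delta_H\in[0.5,1]$ and $\delta_F,\delta_G\in(0,1]$). Let $a,b\in(0,1]$ satisfy $$1\le\frac ba\le 1+\Big(\frac{\delta_F}{2}\wedge\delta_G\Big).$$ Then, for properly chosen $\alpha_0,\beta_0,T_0>0$ (i.e. there exist such values, depending only on $a,b$, the dimensions and the constants in (A1)--(A6)), the polynomially diminishing step sizes $$\alpha_t=\frac{\alpha_0}{(t+T_0)^a},\qquad \beta_t=\frac{\beta_0}{(t+T_0)^b}$$ satisfy the step-size conditions (A7) of the context, and the iterates generated with these step sizes satisfy, with $\hat x_t=x_t-H(y_t)$ and $\hat y_t=y_t-y^\star$, $$\mathbb E\|\hat x_t\|^2=O(\alpha_t),\qquad \|\mathbb E\,\hat x_t\hat y_t^\top\|=O(\beta_t),\qquad \mathbb E\|\hat y_t\|^2=O(\beta_t).$$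
   Context: Notation: $\|\cdot\|$ is the Euclidean norm of vectors and the spectral norm of matrices; $a\wedge b=\min\{a,b\}$, $a\vee b=\max\{a,b\}$; $O(\cdot)$ hides a constant independent of $t$. In the displayed step sizes, $\alpha_0,\beta_0$ denote multiplicative constants (not the values of the sequences at $t=0$). $F:\mathbb R^{d_x}\times\mathbb R^{d_y}\to\mathbb R^{d_x}$ and $G:\mathbb R^{d_x}\times\mathbb R^{d_y}\to\mathbb R^{d_y}$ are (Borel measurable) maps; $x_0\in\mathbb R^{d_x}$, $y_0\in\mathbb R^{d_y}$ are arbitrary initial points; $\alpha_t,\beta_t>0$ are step sizes; $\xi_t\in\mathbb R^{d_x},\psi_t\in\mathbb R^{d_y}$ are random noise vectors; $\mathcal F_t=\sigma\{x_0,y_0,\xi_0,\psi_0,\dots,\xi_{t-1},\psi_{t-1}\}$. (A1) For every $y$ the equation $F(x,y)=0$ has a unique solution $x=H(y)$, defining $H:\mathbb R^{d_y}\to\mathbb R^{d_x}$, and there are constants $L_H,L_F>0$ with $\|H(y_1)-H(y_2)\|\le L_H\|y_1-y_2\|$ and $\|F(x,y_1)-F(H(y_1),y_1)\|\le L_F\|x-H(y_1)\|$ for all $x,y_1,y_2$. (A2) The equation $G(H(y),y)=0$ has a unique solution $y^\star$ (and $x^\star:=H(y^\star)$), and there are constants $L_{G,x},L_{G,y}>0$ with $\|G(x,y)-G(H(y),y)\|\le L_{G,x}\|x-H(y)\|$ and $\|G(H(y),y)-G(H(y^\star),y^\star)\|\le L_{G,y}\|y-y^\star\|$ for all $x,y$.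 (A3) There are constants $\mu_F,\mu_G>0$ with $\langle x-H(y),F(x,y)-F(H(y),y)\rangle\ge\mu_F\|x-H(y)\|^2$ and $\langle y-y^\star,G(H(y),y)-G(H(y^\star),y^\star)\rangle\ge\mu_G\|y-y^\star\|^2$ for all $x,y$. (A4) $H$ is differentiable and there are $S_H\ge0$, $\delta_H\in[0.5,1]$ with $\|H(y_1)-H(y_2)-\nabla H(y_2)(y_1-y_2)\|\le S_H\|y_1-y_2\|^{1+\delta_H}$ for all $y_1,y_2$. (A5) There are matrices $B_1,B_2,B_3$ of compatible dimensions, constants $S_{B,F},S_{B,G}\ge0$ and $\delta_F,\delta_G\in(0,1]$ such that for all $x,y$: $\|F(x,y)-B_1(x-H(y))\|\le S_{B,F}(\|x-H(y)\|^{1+\delta_F}+\|y-y^\star\|^{1+\delta_F})$ and $\|G(x,y)-B_2(x-H(y))-B_3(y-y^\star)\|\le S_{B,G}(\|x-H(y)\|^{1+\delta_G}+\|y-y^\star\|^{1+\delta_G})$. (A6) For all $t\ge0$: $\mathbb E[\xi_t|\mathcal F_t]=0$, $\mathbb E[\psi_t|\mathcal F_t]=0$, $\mathbb E[\|\xi_t\|^4|\mathcal F_t]\le\Gamma_{11}^2$, $\mathbb E[\|\psi_t\|^4|\mathcal F_t]\le\Gamma_{22}^2$, $\|\mathbb E[\xi_t\xi_t^\top|\mathcal F_t]\|\le\Sigma_{11}$, $\|\mathbb E[\psi_t\psi_t^\top|\mathcal F_t]\|\le\Sigma_{22}$, $\|\mathbb E[\xi_t\psi_t^\top|\mathcal F_t]\|\le\Sigma_{12}$.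 (A7) (i) For all $t$, $\alpha_t\le\iota_1$, $\beta_t\le\iota_2$, $\beta_t/\alpha_t\le\kappa$, $\beta_t^2/\alpha_t\le\rho$, where $\iota_1=\frac{\mu_F}{4L_F^2}\wedge\frac1{12\mu_F}$, $\iota_2=\frac{\mu_G}{L_{G,y}^2}\wedge\frac1{14\mu_G}$, $\kappa=\frac{\mu_F\mu_G}{(28d_x\vee200L_{G,y})L_HL_{G,x}}\wedge\frac{\mu_F}{5\mu_G}$, $\rho=\frac{\mu_F}{(16d_x\vee200)L_H^2L_{G,x}^2}$. (ii) For all $t\ge1$, $1\le\frac{\alpha_{t-1}}{\alpha_t}\le1+\big(\frac{\delta_F\mu_F}{16}\alpha_t\big)\wedge\big(\frac{\delta_F\mu_G}{16}\beta_t\big)\wedge\big(\frac{\delta_G\mu_G}{8}\beta_t\big)$ and $1\le\frac{\beta_{t-1}}{\beta_t}\le1+\frac{\mu_G}{64}\beta_t$. (iii) $\beta_t/\alpha_t$ is non-increasing in $t$ and $\prod_{\tau=0}^t(1-\frac{\mu_G\beta_\tau}4)=O(\alpha_t^2)$. *)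

(* Defs.v *)
From HB Require Import structures.
From mathcomp Require Export all_boot all_order all_algebra.
From mathcomp Require Export all_classical all_reals all_analysis.

Set Implicit Arguments.
Unset Strict Implicit.
Unset Printing Implicit Defensive.

Export Order.TTheory GRing.Theory Num.Theory.
Export numFieldNormedType.Exports.

Local Open Scope classical_set_scope.
Local Open Scope ring_scope.

Section Vectors.
Context {R : realType}.

Definition dotv n (u v : 'cV[R]_n) : R := \sum_i u i 0 * v i 0.

(* The library norm `|v| on 'cV[R]_n is the sup norm, hence this definition. *)
Definition enorm n (v : 'cV[R]_n) : R := Num.sqrt (dotv v v).

Definition specnorm m n (M : 'M[R]_(m, n)) : R :=
  sup [set enorm (M *m v) | v in [set v : 'cV[R]_n | enorm v <= 1]].

End Vectors.

(* [open] refers to the product topology of the coordinates on 'cV[R]_n, and to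
   the product of these topologies on a product of vector spaces. *)
Definition borel (T : topologicalType) : set (set T) := <<s @open T >>.

Definition borel_fun (T U : topologicalType) (f : T -> U) : Prop :=
  forall B, borel B -> borel (f @^-1` B).

Section Probability.
Context {R : realType} {d : measure_display} {Omega : measurableType d}.
Variable P : probability Omega R.

Definition random_element (U : topologicalType) (X : Omega -> U) : Prop :=
  forall B, borel B -> measurable (X @^-1` B).

Definition sigma_of (U : topologicalType) (X : Omega -> U) : set (set Omega) :=
  preimage_set_system [set: Omega] X (@borel U).

(* [Y] is a version of the conditional expectation of [Z] given the
   sigma-algebra [S]. *)
Record is_condexp (S : set (set Omega)) (Z Y : Omega -> R) : Prop := {
  condexp_integrable_arg : P.-integrable [set: Omega] (EFin \o Z);
  condexp_integrable : P.-integrable [set: Omega] (EFin \o Y);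
  condexp_measurable : forall B : set R, measurable B -> S (Y @^-1` B);
  condexp_integral : forall A, S A ->
    (\int[P]_(w in A) (Y w)%:E = \int[P]_(w in A) (Z w)%:E)%E }.

Definition is_condexp_mx (S : set (set Omega)) m n
    (Z Y : Omega -> 'M[R]_(m, n)) : Prop :=
  forall i j, is_condexp S (fun w => Z w i j) (fun w => Y w i j).

(* [fine] sends infinite values to 0; the value is the expected one as soon as
   the entries of [Z] are integrable, e.g. when they are products of
   square-integrable variables. *)
Definition expectation_mx m n (Z : Omega -> 'M[R]_(m, n)) : 'M[R]_(m, n) :=
  \matrix_(i, j) fine ('E_P[fun w => Z w i j])%E.

End Probability.

Definition seq_bigO {R : realType} (u : nat -> \bar R) (v : nat -> R) : Prop :=
  exists C : R, forall t, (`|u t| <= (C * v t)%:E)%E.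

Section StepSizes.
Context {R : realType}.
Variable dx : nat.

Definition iota1 (muF LF : R) : R :=
  Num.min (muF / (4 * LF ^+ 2)) (1 / (12 * muF)).

Definition iota2 (muG LGy : R) : R :=
  Num.min (muG / LGy ^+ 2) (1 / (14 * muG)).

Definition kappa (muF muG LH LGx LGy : R) : R :=
  Num.min (muF * muG / (Num.max (28 * dx%:R) (200 * LGy) * LH * LGx))
          (muF / (5 * muG)).

Definition rho (muF LH LGx : R) : R :=
  muF / (Num.max (16 * dx%:R) 200 * LH ^+ 2 * LGx ^+ 2).

Record assumption_A7 (LH LF LGx LGy muF muG deltaF deltaG : R)
    (alpha beta : nat -> R) : Prop := {
  A7_alpha_le : forall t, alpha t <= iota1 muF LF;
  A7_beta_le : forall t, beta t <= iota2 muG LGy;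
  A7_ratio_le : forall t, beta t / alpha t <= kappa muF muG LH LGx LGy;
  A7_sqratio_le : forall t, beta t ^+ 2 / alpha t <= rho muF LH LGx;
  A7_alpha_growth : forall t, (1 <= t)%N ->
    1 <= alpha t.-1 / alpha t
      <= 1 + Num.min (Num.min (deltaF * muF / 16 * alpha t)
                              (deltaF * muG / 16 * beta t))
                     (deltaG * muG / 8 * beta t);
  A7_beta_growth : forall t, (1 <= t)%N ->
    1 <= beta t.-1 / beta t <= 1 + muG / 64 * beta t;
  A7_ratio_nonincreasing : nonincreasing_seq (fun t => beta t / alpha t);
  A7_prod : seq_bigO
    (fun t => (\prod_(0 <= tau < t.+1) (1 - muG * beta tau / 4))%:E)
    (fun t => alpha t ^+ 2) }.

End StepSizes.

Section TwoTimeScale.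
Context {R : realType} {dx dy : nat}.
Implicit Types (F : 'cV[R]_dx -> 'cV[R]_dy -> 'cV[R]_dx)
               (G : 'cV[R]_dx -> 'cV[R]_dy -> 'cV[R]_dy)
               (H : 'cV[R]_dy -> 'cV[R]_dx) (ystar : 'cV[R]_dy).

Definition assumption_A1 (LH LF : R) F H : Prop :=
  [/\ forall y, F (H y) y = 0 /\ (forall x, F x y = 0 -> x = H y),
      forall y1 y2, enorm (H y1 - H y2) <= LH * enorm (y1 - y2) &
      forall x y1, enorm (F x y1 - F (H y1) y1) <= LF * enorm (x - H y1)].

Definition assumption_A2 (LGx LGy : R) G H ystar : Prop :=
  [/\ G (H ystar) ystar = 0 /\ (forall y, G (H y) y = 0 -> y = ystar),
      forall x y, enorm (G x y - G (H y) y) <= LGx * enorm (x - H y) &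
      forall y, enorm (G (H y) y - G (H ystar) ystar)
                  <= LGy * enorm (y - ystar)].

Definition assumption_A3 (muF muG : R) F G H ystar : Prop :=
  (forall x y, dotv (x - H y) (F x y - F (H y) y)
                 >= muF * enorm (x - H y) ^+ 2) /\
  (forall y, dotv (y - ystar) (G (H y) y - G (H ystar) ystar)
               >= muG * enorm (y - ystar) ^+ 2).

(* ['d H y2 v] is the product of the Jacobian matrix of H at y2 with v. *)
Definition assumption_A4 (SH deltaH : R) H : Prop :=
  (forall y, differentiable H y) /\
  (forall y1 y2 : 'cV[R]_dy,
     enorm (H y1 - H y2 - 'd H y2 (y1 - y2))
       <= SH * enorm (y1 - y2) `^ (1 + deltaH)).

Definition assumption_A5 (SBF SBG deltaF deltaG : R) F G H ystar : Prop :=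
  exists (B1 : 'M[R]_(dx, dx)) (B2 : 'M[R]_(dy, dx)) (B3 : 'M[R]_(dy, dy)),
  (forall x y,
     enorm (F x y - B1 *m (x - H y))
       <= SBF * (enorm (x - H y) `^ (1 + deltaF)
                 + enorm (y - ystar) `^ (1 + deltaF))) /\
  (forall x y,
     enorm (G x y - B2 *m (x - H y) - B3 *m (y - ystar))
       <= SBG * (enorm (x - H y) `^ (1 + deltaG)
                 + enorm (y - ystar) `^ (1 + deltaG))).

Section Process.
Context {d : measure_display} {Omega : measurableType d}.
Variable P : probability Omega R.
Implicit Types (x xi : nat -> Omega -> 'cV[R]_dx)
               (y psi : nat -> Omega -> 'cV[R]_dy).

Definition tts_iterates F G (alpha beta : nat -> R)
    (x0 : 'cV[R]_dx) (y0 : 'cV[R]_dy) xi psi x y : Prop :=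
  [/\ forall w, x 0%N w = x0, forall w, y 0%N w = y0,
      forall t w, x t.+1 w = x t w - alpha t *: (F (x t w) (y t w) + xi t w) &
      forall t w, y t.+1 w = y t w - beta t *: (G (x t w) (y t w) + psi t w)].

Definition history x y xi psi (t : nat) : set (set Omega) :=
  <<s sigma_of (x 0%N) `|` sigma_of (y 0%N) `|`
      \bigcup_(s in [set s | (s < t)%N])
        (sigma_of (xi s) `|` sigma_of (psi s)) >>.

(* Conditional moments are only defined almost surely; each bound is stated for
   some version, equivalently for all of them. *)
Record assumption_A6 (Gamma11 Gamma22 Sigma11 Sigma22 Sigma12 : R)
    (Fil : nat -> set (set Omega)) xi psi : Prop := {
  A6_mean_xi : forall t, is_condexp_mx P (Fil t) (xi t) (fun=> 0);
  A6_mean_psi : forall t, is_condexp_mx P (Fil t) (psi t) (fun=> 0);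
  A6_fourth_xi : forall t, exists2 m : Omega -> R,
    is_condexp P (Fil t) (fun w => enorm (xi t w) ^+ 4) m &
    {ae P, forall w, m w <= Gamma11 ^+ 2};
  A6_fourth_psi : forall t, exists2 m : Omega -> R,
    is_condexp P (Fil t) (fun w => enorm (psi t w) ^+ 4) m &
    {ae P, forall w, m w <= Gamma22 ^+ 2};
  A6_cov_xi : forall t, exists2 M : Omega -> 'M[R]_(dx, dx),
    is_condexp_mx P (Fil t) (fun w => xi t w *m (xi t w)^T) M &
    {ae P, forall w, specnorm (M w) <= Sigma11};
  A6_cov_psi : forall t, exists2 M : Omega -> 'M[R]_(dy, dy),
    is_condexp_mx P (Fil t) (fun w => psi t w *m (psi t w)^T) M &
    {ae P, forall w, specnorm (M w) <= Sigma22};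
  A6_cov_xi_psi : forall t, exists2 M : Omega -> 'M[R]_(dx, dy),
    is_condexp_mx P (Fil t) (fun w => xi t w *m (psi t w)^T) M &
    {ae P, forall w, specnorm (M w) <= Sigma12} }.

End Process.
End TwoTimeScale.

Definition poly_step {R : realType} (c T0 a : R) (t : nat) : R :=
  c / (t%:R + T0) `^ a.

(* Main.v *)
(* Write x' = x_t - H(y_t), y' = y_t - y*, p = |x'|, q = |y'|. For small, slowly
   varying steps with beta/alpha small, the fourth moments come first: the drift
   contracts p by 1 - c alpha and q by 1 - c beta, and the coupling has small loop
   gain, so E p^4 + E q^4 = O(alpha^2). The lag H(y_t) - H(y_(t+1)) does not spoil
   this, because its part linear in psi_t has zero conditional mean and its
   remainder is of order beta^(1 + deltaH) with deltaH >= 1/2.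
   Linearizing F around (H(y), y) then gives
     E x' y'^T  |->  (I - alpha B1) E x' y'^T + O(alpha beta),
   the error alpha E q (p^(1 + deltaF) + q^(1 + deltaF)) being
   O(alpha^(2 + deltaF/2)) = O(alpha beta); since I - alpha B1 is a contraction,
   E x' y'^T = O(beta). Finally the x-dependence of G enters the recursion for
   E q^2 only through the trace of B2 E x' y'^T and through E p^(2 + 2 deltaG),
   which is O(alpha^(1 + deltaG)) = O(beta). *)
From mathcomp Require Import ring lra measurable_realfun.
Require Import Defs.

Set Implicit Arguments.
Unset Strict Implicit.
Unset Printing Implicit Defensive.

Local Open Scope classical_set_scope.
Local Open Scope ring_scope.

(** * Euclidean norm *)

Section Euclidean.
Context {R : realType}.

(** Conditioning is never an operation. The past at time t is a measurable space [T] with a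
    measurable map [phi] from [Omega]; what is known at time t is a function on [T], and the
    assumptions on the noise become statements on integrals of [U (phi w)] times the noise. Such
    integrals make sense only under integrability, so each fourth-moment step returns integrability
    together with its bound. To separate drift from noise exactly, H is expanded around y_t - beta_t
    G(x_t, y_t), which is known at time t; the Jacobian there multiplies centred noise. The fourth
    moments are exploited pointwise, through a random variable Q >= 1 of bounded mean with p^4 + q^4
    <= alpha^2 Q; this replaces Hoelder's inequality. The cross moment is followed column by column,
    as the vectors E x' y'_j, so that only the Euclidean contraction of I - alpha B1 is needed. A
    single number eps bounds alpha, beta/alpha and the relative decrease of both steps per unit of
    beta, and every smallness condition becomes an upper bound on eps. *)

Lemma dotvC n (u v : 'cV[R]_n) : dotv u v = dotv v u.
Proof. by apply: eq_bigr => i _; rewrite mulrC. Qed.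

Lemma dotvDl n (u v w : 'cV[R]_n) : dotv (u + v) w = dotv u w + dotv v w.
Proof. by rewrite /dotv -big_split; apply: eq_bigr => i _; rewrite mxE mulrDl. Qed.

Lemma dotvZl n (a : R) (u w : 'cV[R]_n) : dotv (a *: u) w = a * dotv u w.
Proof. by rewrite /dotv mulr_sumr; apply: eq_bigr => i _; rewrite mxE mulrA. Qed.

Lemma dotvDr n (u v w : 'cV[R]_n) : dotv w (u + v) = dotv w u + dotv w v.
Proof. by rewrite dotvC dotvDl !(dotvC w). Qed.

Lemma dotvZr n (a : R) (u w : 'cV[R]_n) : dotv w (a *: u) = a * dotv w u.
Proof. by rewrite dotvC dotvZl (dotvC w). Qed.

Lemma dotvNl n (u w : 'cV[R]_n) : dotv (- u) w = - dotv u w.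
Proof. by rewrite -scaleN1r dotvZl mulN1r. Qed.

Lemma dotvNr n (u w : 'cV[R]_n) : dotv w (- u) = - dotv w u.
Proof. by rewrite dotvC dotvNl dotvC. Qed.

Lemma dotv0l n (u : 'cV[R]_n) : dotv 0 u = 0.
Proof. by rewrite /dotv big1// => i _; rewrite mxE mul0r. Qed.

Lemma dotv0r n (u : 'cV[R]_n) : dotv u 0 = 0.
Proof. by rewrite dotvC dotv0l. Qed.

Lemma dotvv_ge0 n (u : 'cV[R]_n) : 0 <= dotv u u.
Proof. by apply: sumr_ge0 => i _; rewrite -expr2 sqr_ge0. Qed.

Lemma enorm_ge0 n (u : 'cV[R]_n) : 0 <= enorm u.
Proof. exact: sqrtr_ge0. Qed.
Hint Resolve enorm_ge0 : core.

Lemma enorm_sqr n (u : 'cV[R]_n) : enorm u ^+ 2 = dotv u u.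
Proof. by rewrite sqr_sqrtr ?dotvv_ge0. Qed.

Lemma enorm0 n : enorm (0 : 'cV[R]_n) = 0.
Proof. by rewrite /enorm dotv0l sqrtr0. Qed.

Lemma enormZ n (a : R) (u : 'cV[R]_n) : enorm (a *: u) = `|a| * enorm u.
Proof.
by rewrite /enorm dotvZl dotvZr mulrA -expr2 sqrtrM ?sqr_ge0// sqrtr_sqr.
Qed.

Lemma enormN n (u : 'cV[R]_n) : enorm (- u) = enorm u.
Proof. by rewrite -scaleN1r enormZ normrN1 mul1r. Qed.

Lemma coord_le_enorm n (u : 'cV[R]_n) i : `|u i 0| <= enorm u.
Proof.
rewrite -sqrtr_sqr ler_wsqrtr// /dotv (bigD1 i)//= -expr2 lerDl.
by apply: sumr_ge0 => j _; rewrite -expr2 sqr_ge0.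
Qed.

Lemma enorm_eq0 n (u : 'cV[R]_n) : enorm u = 0 -> u = 0.
Proof.
move=> u0; apply/matrixP => i j; rewrite ord1 mxE.
by apply/eqP; rewrite -normr_le0 -u0 coord_le_enorm.
Qed.

(** Cauchy-Schwarz: the squared norm of |v| u - |u| v is 2 |u| |v| (|u| |v| - <u, v>), and the
    factor |u| |v| cancels unless one vector vanishes. *)
Lemma dotv_le n (u v : 'cV[R]_n) : dotv u v <= enorm u * enorm v.
Proof.
have := dotvv_ge0 (enorm v *: u - enorm u *: v).
rewrite dotvDl !dotvDr !(dotvNl, dotvNr, dotvZl, dotvZr) -!enorm_sqr (dotvC v u).
have := enorm_ge0 u; have := enorm_ge0 v.
rewrite le0r => /predU1P[/enorm_eq0 -> _|q0].
  by rewrite dotv0r enorm0 mulr0.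
rewrite le0r => /predU1P[/enorm_eq0 -> _|p0].
  by rewrite dotv0l enorm0 mul0r.
move: p0 q0; set p := enorm u; set q := enorm v; set s := dotv u v => p0 q0 h.
have {}h : 0 <= (p * q) * (p * q - s) by lra.
by rewrite pmulr_rge0 ?mulr_gt0// subr_ge0 in h.
Qed.

Lemma normr_dotv_le n (u v : 'cV[R]_n) : `|dotv u v| <= enorm u * enorm v.
Proof.
rewrite ler_norml dotv_le andbT lerNl -dotvNl; apply: le_trans (dotv_le _ _) _.
by rewrite enormN.
Qed.

Lemma enormD_sqr n (u v : 'cV[R]_n) :
  enorm (u + v) ^+ 2 = enorm u ^+ 2 + 2 * dotv u v + enorm v ^+ 2.
Proof. rewrite !enorm_sqr dotvDl !dotvDr (dotvC v u); ring. Qed.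

Lemma enormD n (u v : 'cV[R]_n) : enorm (u + v) <= enorm u + enorm v.
Proof.
rewrite -(@ler_pXn2r _ 2) ?nnegrE// ?addr_ge0// enormD_sqr.
by have := dotv_le u v; lra.
Qed.

Lemma enormB_le n (u v : 'cV[R]_n) : enorm (u - v) <= enorm u + enorm v.
Proof. by rewrite -(enormN v) enormD. Qed.

Lemma enorm_le_sum n (u : 'cV[R]_n) : enorm u <= \sum_i `|u i 0|.
Proof.
rewrite -(@ler_pXn2r _ 2) ?nnegrE ?sumr_ge0// enorm_sqr /dotv expr2 mulr_suml.
apply: ler_sum => i _; rewrite -expr2 -real_normK ?num_real// expr2.
by rewrite ler_wpM2l// (bigD1 i)//= lerDl sumr_ge0.
Qed.

Lemma enorm_mulmx_le m n (M : 'M[R]_(m, n)) :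
  exists2 C, 0 <= C & forall v, enorm (M *m v) <= C * enorm v.
Proof.
exists (\sum_i \sum_j `|M i j|); first by do 2!apply: sumr_ge0 => ? _.
move=> v; apply: le_trans (enorm_le_sum _) _; rewrite mulr_suml.
apply: ler_sum => i _; rewrite mxE mulr_suml; apply: le_trans (ler_norm_sum _ _ _) _.
by apply: ler_sum => j _; rewrite normrM ler_wpM2l// coord_le_enorm.
Qed.

(** [specnorm] is a [sup], so its set has to be shown bounded and nonempty; it contains 0. The
    entrywise bound loses a factor depending on the dimensions, which the O-constant absorbs. *)
Lemma specnorm_le m n (M : 'M[R]_(m, n)) (C : R) : 0 <= C ->
  (forall i j, `|M i j| <= C) -> `|specnorm M| <= C * (m * n)%:R.
Proof.
move=> C0 MC.
have ub : ubound [set enorm (M *m v) | v in [set v : 'cV[R]_n | enorm v <= 1]]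
   (C * (m * n)%:R).
  move=> _ [v /= v1 <-]; apply: le_trans (enorm_le_sum _) _.
  have -> : C * (m * n)%:R = \sum_(i < m) \sum_(j < n) C.
    by rewrite !sumr_const !card_ord -mulrnA mulnC mulr_natr.
  apply: ler_sum => i _; rewrite mxE; apply: le_trans (ler_norm_sum _ _ _) _.
  apply: ler_sum => j _; rewrite normrM -[leRHS]mulr1 ler_pM//.
  exact: le_trans (coord_le_enorm _ _) v1.
have in0 : [set enorm (M *m v) | v in [set v : 'cV[R]_n | enorm v <= 1]] 0.
  by exists 0 => /=; rewrite ?mulmx0 enorm0.
rewrite ger0_norm; first by apply: ge_sup => //; exists 0.
by apply: ub_le_sup => //; exists (C * (m * n)%:R).
Qed.

(* The only term of first order in w is [4 |u|^2 <u, w>], which averages out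
   when w is a noise. *)
Lemma enormD_pow4 n (u w : 'cV[R]_n) : enorm (u + w) ^+ 4 <=
  enorm u ^+ 4 + 4 * (enorm u ^+ 2 * dotv u w)
  + 8 * (enorm u ^+ 2 * enorm w ^+ 2) + 3 * enorm w ^+ 4.
Proof.
have -> : enorm (u + w) ^+ 4 = (enorm (u + w) ^+ 2) ^+ 2 by rewrite -exprM.
rewrite enormD_sqr.
have := normr_dotv_le u w; rewrite ler_norml.
have := enorm_ge0 u; have := enorm_ge0 w.
set p := enorm u; set q := enorm w; set s := dotv u w => q0 p0 /andP[h1 h2].
rewrite -subr_ge0.
(* The difference to be shown nonnegative is 4 [h3] + 4 [h4] + 2 [h5], each name standing for its
   right-hand side. *)
have h3 : 0 <= (p * q - s) * (p * q + s) by apply: mulr_ge0; lra.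
have h4 : 0 <= q ^+ 2 * (p * q - s) by apply: mulr_ge0; rewrite ?sqr_ge0//; lra.
have h5 : 0 <= q ^+ 2 * (p - q) ^+ 2 by apply: mulr_ge0; apply: sqr_ge0.
lra.
Qed.

End Euclidean.
#[global] Hint Extern 0 (is_true (0 <= enorm _)) => exact: enorm_ge0 : core.

(** * Scalar inequalities *)

Ltac nonneg := repeat first [ done | by apply: ltW | exact: sqr_ge0
  | apply: exprn_ge0 | apply: addr_ge0 | apply: mulr_ge0 | rewrite invr_ge0 ].

Section Scalar.
Context {R : realType}.
Implicit Types p q s t h : R.

Lemma convex_sqr s p t : 0 <= s <= 1 ->
  ((1 - s) * p + s * t) ^+ 2 <= (1 - s) * p ^+ 2 + s * t ^+ 2.
Proof.
move=> /andP[s0 s1]; rewrite -subr_ge0.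
have -> : (1 - s) * p ^+ 2 + s * t ^+ 2 - ((1 - s) * p + s * t) ^+ 2 =
  s * (1 - s) * (p - t) ^+ 2 by ring.
by rewrite mulr_ge0 ?sqr_ge0// mulr_ge0// subr_ge0.
Qed.

Lemma convex_pow4 s p t : 0 <= s <= 1 ->
  ((1 - s) * p + s * t) ^+ 4 <= (1 - s) * p ^+ 4 + s * t ^+ 4.
Proof.
move=> s01; have /andP[s0 s1] := s01.
have E x : x ^+ 4 = (x ^+ 2) ^+ 2 :> R by rewrite -exprM.
rewrite !E; apply: le_trans (convex_sqr _ _ s01).
rewrite ler_pXn2r ?nnegrE ?sqr_ge0// ?convex_sqr//.
by rewrite addr_ge0// mulr_ge0 ?sqr_ge0// subr_ge0.
Qed.

(* Convexity of the fourth power, applied to (1 - s) p + s (c q / s). *)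
Lemma pow4_contract s p c q : 0 < s <= 1 -> 0 <= p -> 0 <= c -> 0 <= q ->
  forall x, 0 <= x -> x <= (1 - s) * p + c * q ->
  x ^+ 4 <= (1 - s) * p ^+ 4 + c ^+ 4 / s ^+ 3 * q ^+ 4.
Proof.
move=> /andP[s0 s1] p0 c0 q0 x x0 xle.
apply: le_trans (_ : ((1 - s) * p + s * (c * q / s)) ^+ 4 <= _).
  have -> : s * (c * q / s) = c * q by rewrite [LHS]mulrC divfK ?gt_eqF.
  by rewrite lerXn2r ?nnegrE// (le_trans x0).
apply: le_trans (convex_pow4 _ _ _) _; first by rewrite ltW.
rewrite lerD2l le_eqVlt; apply/orP; left; apply/eqP; field; exact: lt0r_neq0.
Qed.

(** Either h <= e p and the first term dominates, or p < h / e and the second one does; sharp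
    constants are of no use here. *)
Lemma young31 p h (e : R) : 0 < e -> 0 <= p -> 0 <= h ->
  p ^+ 3 * h <= e * p ^+ 4 + h ^+ 4 / e ^+ 3.
Proof.
move=> e0 p0 h0; have [hp|ph] := lerP h (e * p).
  apply: ler_wpDr; first by rewrite divr_ge0 ?exprn_ge0// ltW.
  have -> : e * p ^+ 4 = p ^+ 3 * (e * p) by ring.
  by rewrite ler_wpM2l ?exprn_ge0.
apply: ler_wpDl; first by rewrite mulr_ge0 ?exprn_ge0// ltW.
have -> : h ^+ 4 / e ^+ 3 = (h / e) ^+ 3 * h by field; exact: lt0r_neq0.
rewrite ler_wpM2r// ler_pXn2r ?nnegrE ?divr_ge0// ?(ltW e0)//.
by rewrite ler_pdivlMr// mulrC ltW.
Qed.

Lemma young22 p h (e : R) : 0 < e -> p ^+ 2 * h <= e * p ^+ 4 + h ^+ 2 / e.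
Proof.
move=> e0; rewrite -subr_ge0.
have -> : e * p ^+ 4 + h ^+ 2 / e - p ^+ 2 * h =
  e * ((p ^+ 2 - h / (2 * e)) ^+ 2 + 3 / 4 * (h / e) ^+ 2).
  by field; apply: lt0r_neq0.
by rewrite mulr_ge0 ?(ltW e0)// addr_ge0 ?sqr_ge0// mulr_ge0 ?sqr_ge0// divr_ge0.
Qed.

Lemma young11 p q (e : R) : 0 < e -> p * q <= e * p ^+ 2 + q ^+ 2 / e.
Proof.
move=> e0; rewrite -subr_ge0.
have -> : e * p ^+ 2 + q ^+ 2 / e - p * q =
  e * ((p - q / (2 * e)) ^+ 2 + 3 / 4 * (q / e) ^+ 2).
  by field; apply: lt0r_neq0.
by rewrite mulr_ge0 ?(ltW e0)// addr_ge0 ?sqr_ge0// mulr_ge0 ?sqr_ge0// divr_ge0.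
Qed.

(* Passes inequalities for a nonlinear map to its linearization: the superlinear
   error vanishes as the scale s tends to 0. *)
Lemma le_of_small_scale (x y C d : R) : 0 < d ->
  (forall s, 0 < s -> s <= 1 -> x <= y + C * s `^ d) -> x <= y.
Proof.
move=> d0 H; apply/ler_addgt0Pr => e e0.
have [C0|C0] := lerP C 0.
  have := H 1 ltr01 (lexx _); rewrite powR1; lra.
have m0 : 0 < Num.min 1 (e / C) by rewrite lt_min ltr01 divr_gt0.
pose s := (Num.min 1 (e / C)) `^ d^-1.
have s0 : 0 < s by rewrite powR_gt0.
have sd : s `^ d = Num.min 1 (e / C).
  by rewrite /s -powRrM mulVf ?gt_eqF// powRr1 ?ltW.
have s1 : s <= 1.
  have -> : 1 = 1 `^ d^-1 :> R by rewrite powR1.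
  rewrite /s ge0_ler_powR ?nnegrE ?invr_ge0 ?(ltW d0) ?(ltW m0)//.
  by rewrite ge_min lexx.
apply: le_trans (H s s0 s1) _; rewrite lerD2l sd mulrC -ler_pdivlMr//.
by rewrite ge_min lexx orbT.
Qed.

End Scalar.

(** * Step sizes *)

Section Steps.
Context {R : realType}.
Implicit Types (alpha beta : nat -> R).

(** All that the recursions retain of the step sizes. The decrease of both sequences is measured
    against beta, the slower of the two contraction rates. *)
Record slow_steps (eps : R) alpha beta : Prop := {
  alpha_gt0 : forall t, 0 < alpha t;
  beta_gt0 : forall t, 0 < beta t;
  alpha_le : forall t, alpha t <= eps;
  beta_le : forall t, beta t <= eps * alpha t;
  alpha_noninc : forall t, alpha t.+1 <= alpha t;
  beta_noninc : forall t, beta t.+1 <= beta t;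
  alpha_slow : forall t, alpha t <= alpha t.+1 * (1 + eps * beta t.+1);
  beta_slow : forall t, beta t <= beta t.+1 * (1 + eps * beta t.+1);
  ratio_noninc : forall t, beta t.+1 / alpha t.+1 <= beta t / alpha t }.

Lemma poly_step_gt0 (c T0 p : R) t : 0 < c -> 0 < T0 -> 0 < poly_step c T0 p t.
Proof.
by move=> c0 T00; rewrite divr_gt0// powR_gt0// ltr_wpDl.
Qed.

Lemma poly_step_noninc (c T0 p : R) t : 0 < c -> 0 < T0 -> 0 <= p ->
  poly_step c T0 p t.+1 <= poly_step c T0 p t.
Proof.
move=> c0 T00 p0; rewrite /poly_step ler_pM2l// lef_pV2 ?posrE ?powR_gt0 ?ltr_wpDl//.
by rewrite ge0_ler_powR// ?nnegrE ?addr_ge0 ?(ltW T00)// lerD2r ler_nat.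
Qed.

(** With n = t + T0 >= 1, the ratio ((n+1)/n)^p is at most 1 + 1/n <= 1 + 2/(n+1), and p' <= 1 gives
    2/(n+1) <= eps c'/(n+1)^p'. It is applied with c', p' the parameters of beta, for both
    sequences. *)
Lemma poly_step_slow (c T0 p c' p' eps : R) t : 0 < c -> 1 <= T0 ->
  0 <= p <= 1 -> p' <= 1 -> 2 <= eps * c' -> poly_step c T0 p t <=
    poly_step c T0 p t.+1 * (1 + eps * poly_step c' T0 p' t.+1).
Proof.
move=> c0 T01 /andP[p0 p1] p'1 epsc.
set n := t%:R + T0.
have n1 : 1 <= n by rewrite ler_wpDl.
have -> : poly_step c T0 p t = c / n `^ p by [].
have nS q : poly_step q T0 p t.+1 = q / (n + 1) `^ p by rewrite /n addrAC natr1.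
have nS' q : poly_step q T0 p' t.+1 = q / (n + 1) `^ p' by rewrite /n addrAC natr1.
have n0 : 0 < n by lra.
have nS0 : 0 < n + 1 by lra.
rewrite nS nS' -mulrA ler_pM2l// mulrC ler_pdivlMr ?powR_gt0//.
rewrite mulrC ler_pdivrMr ?powR_gt0//.
have -> : (n + 1) `^ p = ((n + 1) / n) `^ p * n `^ p.
  by rewrite -powRM ?divr_ge0 ?(ltW n0) ?(ltW nS0)// divfK ?gt_eqF.
rewrite ler_pM2r ?powR_gt0//.
apply: le_trans (_ : (n + 1) / n <= _).
  by apply: ler1_powR => //; rewrite ler_pdivlMr// mul1r lerDl.
apply: le_trans (_ : 1 + 2 / (n + 1) <= _).
  rewrite mulrDl divff ?gt_eqF// lerD2l ler_pdivlMr// mulrC mulrA mulr1.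
  by rewrite ler_pdivrMr//; lra.
rewrite lerD2l mulrA ler_pM//.
- by rewrite invr_ge0 ltW.
- rewrite lef_pV2 ?posrE ?powR_gt0//.
  by apply: ler1_powR => //; lra.
Qed.

Lemma poly_step_le (c T0 p eps : R) t : 0 < c -> 0 < p -> 0 < eps -> 0 < T0 ->
  (c / eps) `^ p^-1 <= T0 -> poly_step c T0 p t <= eps.
Proof.
move=> c0 p0 eps0 T00 cT; have ceps : 0 < c / eps by exact: divr_gt0.
have n0 : 0 < t%:R + T0 by rewrite ltr_wpDl.
rewrite /poly_step ler_pdivrMr ?powR_gt0// -ler_pdivrMl// mulrC.
have -> : c / eps = ((c / eps) `^ p^-1) `^ p.
  by rewrite -powRrM mulVf ?gt_eqF// powRr1// ltW.
rewrite ge0_ler_powR ?nnegrE ?powR_ge0 ?(ltW p0) ?(ltW n0)//.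
by rewrite (le_trans cT)// lerDr.
Qed.

Lemma poly_step_ratio (c c' T0 p q : R) t : 0 < c -> 0 < c' -> 0 < T0 ->
  poly_step c' T0 q t / poly_step c T0 p t = poly_step (c' / c) T0 (q - p) t.
Proof.
move=> c0 c'0 T00; have n0 : 0 < t%:R + T0 by rewrite ltr_wpDl.
rewrite /poly_step powRD ?(gt_eqF n0) ?implybT// powRN.
field; rewrite !gt_eqF ?powR_gt0//.
Qed.

Lemma poly_slow_steps (a b eps : R) : 0 < a <= 1 -> 0 < b <= 1 -> a <= b ->
  0 < eps <= 1 -> exists alpha0 beta0 T0 : R,
  [/\ 0 < alpha0, 0 < beta0, 1 <= T0 &
     slow_steps eps (poly_step alpha0 T0 a) (poly_step beta0 T0 b)].
Proof.
move=> /andP[a0 a1] /andP[b0 b1] ab /andP[eps0 eps1].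
(* [beta0] secures slow variation (eps beta0 = 2), [alpha0] the ratio beta0 / alpha0 = eps; [T0] is
   chosen last, to bring alpha below eps without disturbing either. *)
pose beta0 := 2 / eps; pose alpha0 := beta0 / eps.
have bet0 : 0 < beta0 by rewrite divr_gt0.
have al0 : 0 < alpha0 by rewrite divr_gt0.
pose T0 := Num.max 1 ((alpha0 / eps) `^ a^-1).
have T01 : 1 <= T0 by rewrite le_max lexx.
have T00 : 0 < T0 by lra.
have eb : 2 <= eps * beta0 by rewrite mulrC divfK ?gt_eqF.
have ratio t : poly_step beta0 T0 b t / poly_step alpha0 T0 a t
    = poly_step eps T0 (b - a) t.
  rewrite poly_step_ratio//; congr poly_step.
  by rewrite /alpha0; field; rewrite !gt_eqF.
exists alpha0, beta0, T0; split => //; split=> [t|t|t|t|t|t|t|t|t].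
- exact: poly_step_gt0.
- exact: poly_step_gt0.
- by apply: poly_step_le => //; rewrite le_max lexx orbT.
- rewrite -ler_pdivrMr ?poly_step_gt0// ratio.
  rewrite /poly_step ler_pdivrMr ?powR_gt0 ?ltr_wpDl// ler_peMr ?(ltW eps0)//.
  rewrite -[leLHS](powRr0 (t%:R + T0)) ler_powR// ?subr_ge0//.
  by rewrite ler_wpDl.
- by apply: poly_step_noninc => //; exact: ltW.
- by apply: poly_step_noninc => //; exact: ltW.
- by apply: poly_step_slow => //; rewrite (ltW a0).
- by apply: poly_step_slow => //; rewrite (ltW b0).
- by rewrite !ratio; apply: poly_step_noninc => //; rewrite subr_ge0.
Qed.

(** Here the upper bound on b/a enters: it is used with p = 1 + deltaF/2 and p = 1 + deltaG, to turn
    powers of alpha into multiples of beta. *)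
Lemma poly_step_powR_le (a b p alpha0 beta0 T0 : R) : 0 < alpha0 -> 0 < beta0 ->
  1 <= T0 -> b <= a * p ->
  exists2 C, 0 <= C & forall t,
    poly_step alpha0 T0 a t `^ p <= C * poly_step beta0 T0 b t.
Proof.
move=> al0 bet0 T01 bap; exists (alpha0 `^ p / beta0).
  by rewrite divr_ge0 ?powR_ge0// ltW.
move=> t; have n1 : 1 <= t%:R + T0 by rewrite ler_wpDl.
have n0 : 0 < t%:R + T0 by lra.
rewrite /poly_step powRM ?(ltW al0) ?invr_ge0 ?powR_ge0//.
rewrite mulrA divfK ?gt_eqF// ler_pM2l ?powR_gt0//.
rewrite -powRN -powRrM -powRN ler_powR//; lra.
Qed.

Lemma slow_steps_A7 (dx : nat) (LH LF LGx LGy muF muG deltaF deltaG eps : R)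
    alpha beta :
  0 < muG -> slow_steps eps alpha beta -> 0 < eps <= 1 ->
  eps <= iota1 muF LF -> eps <= iota2 muG LGy ->
  eps <= kappa dx muF muG LH LGx LGy -> eps <= rho dx muF LH LGx ->
  eps <= deltaF * muF / 16 -> eps <= deltaF * muG / 16 ->
  eps <= deltaG * muG / 8 -> eps <= muG / 64 ->
  assumption_A7 dx LH LF LGx LGy muF muG deltaF deltaG alpha beta.
Proof.
move=> muG0 S /andP[eps0 eps1] e1 e2 e3 e4 e5 e6 e7 e8.
have al0 := alpha_gt0 S; have be0 := beta_gt0 S.
have ba t : beta t <= alpha t.
  by apply: le_trans (beta_le S t) _; rewrite ler_piMl// ltW.
have be t : beta t <= eps by apply: le_trans (ba t) (alpha_le S t).
have br t : beta t / alpha t <= eps by rewrite ler_pdivrMr// beta_le.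
have br0 t : 0 < beta t / alpha t by exact: divr_gt0.
split.
- by move=> t; apply: le_trans e1; exact: alpha_le S t.
- by move=> t; apply: le_trans e2.
- by move=> t; apply: le_trans e3.
- move=> t; apply: le_trans e4; rewrite expr2 -mulrA -[leRHS]mulr1.
  by apply: ler_pM => //; rewrite ?(ltW (be0 t)) ?(ltW (br0 t)) ?(le_trans (br t)).
- move=> [//|t] _; rewrite /= ler_pdivlMr// mul1r (alpha_noninc S)/=.
  rewrite ler_pdivrMr// [leRHS]mulrC; apply: le_trans (alpha_slow S t) _.
  rewrite ler_pM2l// lerD2l !le_min; apply/andP; split; first apply/andP; first split.
  + by apply: ler_pM; rewrite ?(ltW eps0) ?(ltW (be0 _)).
  + by rewrite ler_pM2r.
  + by rewrite ler_pM2r.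
- move=> [//|t] _; rewrite /= ler_pdivlMr// mul1r (beta_noninc S)/=.
  rewrite ler_pdivrMr// [leRHS]mulrC; apply: le_trans (beta_slow S t) _.
  by rewrite ler_pM2l// lerD2l ler_pM2r.
- by apply/nonincreasing_seqP => t; exact: ratio_noninc S t.
- have mb t : muG * beta t / 4 <= 1 / 2.
    have : eps <= 1 / (14 * muG) by apply: le_trans e2 _; rewrite ge_min lexx orbT.
    rewrite ler_pdivlMr ?mulr_gt0// => h.
    have : muG * beta t <= muG * eps by rewrite ler_pM2l.
    lra.
  have mb0 t : 0 < muG * beta t / 4 by rewrite divr_gt0// mulr_gt0.
  (* Induction on t: one step multiplies the product by 1 - y and alpha^2 by at least (1 + x)^(-2),
     where x = eps beta <= y / 16, so (1 + x)^2 (1 - y) <= 1. [C] makes the bound hold at t = 0. *)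
  pose C := alpha 0%N ^- 2.
  exists C => t; rewrite [X in (X <= _)%E]/= lee_fin ger0_norm; last first.
    by apply: prodr_ge0 => i _; have := mb i; lra.
  elim: t => [|t IH].
    rewrite big_nat1 /C mulVf ?expf_neq0 ?gt_eqF//.
    by have := mb0 0%N; lra.
  rewrite big_nat_recr//=; apply: le_trans (ler_wpM2r _ IH) _.
    by have := mb t.+1; lra.
  have C0 : 0 < C by rewrite invr_gt0 exprn_gt0.
  rewrite -[leLHS]mulrA ler_pM2l//.
  have h1 : 0 <= alpha t <= alpha t.+1 * (1 + eps * beta t.+1).
    by rewrite (ltW (al0 _)) alpha_slow.
  have h2 : alpha t ^+ 2 <= (alpha t.+1 * (1 + eps * beta t.+1)) ^+ 2.
    by have /andP[h h'] := h1; rewrite ler_pXn2r ?nnegrE// (le_trans h).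
  apply: le_trans (ler_wpM2r _ h2) _.
    by have := mb t.+1; lra.
  rewrite exprMn -[leLHS]mulrA ler_piMr ?sqr_ge0//.
  have h3 : eps * beta t.+1 <= muG * beta t.+1 / 4 / 16.
    have : eps * beta t.+1 <= muG / 64 * beta t.+1 by rewrite ler_pM2r.
    lra.
  have h4 : 0 < eps * beta t.+1 by rewrite mulr_gt0.
  have := mb t.+1; have := mb0 t.+1.
  move: h3 h4; set x := eps * _; set y := _ / 4 => h3 h4 h5 h6.
  have h7 : 0 <= x * (1 - x) by apply: mulr_ge0; lra.
  have h8 : 0 <= (1 + 3 * x - (1 + x) ^+ 2) * (1 - y) by apply: mulr_ge0; lra.
  have h9 : 0 <= x * y by apply: mulr_ge0; lra.
  nra.
Qed.

End Steps.

(** * Integration against conditioned variables *)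

Section Conditioning.
Context {R : realType} {d d' : measure_display}.
Context {Omega : measurableType d} {T : measurableType d'}.
Variable P : probability Omega R.
Variable phi : Omega -> T.
Hypothesis mphi : measurable_fun setT phi.

Import HBNNSimple.

Lemma integral_nnsfun_comp (g : {nnsfun T >-> R}) (Z : Omega -> R) :
  measurable_fun setT Z -> (forall w, 0 <= Z w) ->
  (\int[P]_w ((g (phi w))%:E * (Z w)%:E) = \sum_(r \in range g)
     r%:E * \int[P]_(w in phi @^-1` (g @^-1` [set r])) (Z w)%:E)%E.
Proof.
move=> mZ Z0.
have mA r : measurable (phi @^-1` (g @^-1` [set r])).
  by rewrite -[X in measurable X]setTI; exact: mphi.
transitivity (\int[P]_w (\sum_(r \in range g)
    (r * \1_(g @^-1` [set r]) (phi w))%:E * (Z w)%:E))%E.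
  apply: eq_integral => w _; rewrite -ge0_mule_fsuml => [|r].
    by rewrite fsumEFin // -(fimfunE _ (phi w)).
  exact: nnfun_muleindic_ge0.
rewrite ge0_integral_fsum//; last 2 first.
- move=> r; apply: emeasurable_funM; apply/measurable_EFinP => //.
  by apply: measurable_funM => //; apply: measurableT_comp.
- move=> r w _; apply: mule_ge0; last by rewrite lee_fin.
  exact: nnfun_muleindic_ge0.
apply: eq_fsbigr => r /set_mem[t _ <-].
under eq_integral do rewrite EFinM -muleA.
rewrite ge0_integralZl//; first last.
- by rewrite lee_fin.
- by move=> w _; rewrite mule_ge0 ?lee_fin.
- apply: emeasurable_funM; apply/measurable_EFinP => //.
  exact: measurableT_comp.
congr (_ * _)%E; rewrite [RHS]integral_mkcond; apply: eq_integral => w _.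
by rewrite epatch_indic muleC.
Qed.

(** From indicators of events of the past to simple functions, then to [U] by monotone convergence.
    For nonnegative variables the integrals may be compared in the extended reals, before any
    integrability is known. *)
Lemma ge0_le_integral_cond (Z1 Z2 : Omega -> R) (U : T -> R) :
  measurable_fun setT Z1 -> measurable_fun setT Z2 ->
  (forall w, 0 <= Z1 w) -> (forall w, 0 <= Z2 w) ->
  (forall A, measurable A -> \int[P]_(w in phi @^-1` A) (Z1 w)%:E
                           <= \int[P]_(w in phi @^-1` A) (Z2 w)%:E)%E ->
  measurable_fun setT U -> (forall t, 0 <= U t) ->
  (\int[P]_w ((U (phi w))%:E * (Z1 w)%:E)
    <= \int[P]_w ((U (phi w))%:E * (Z2 w)%:E))%E.
Proof.
move=> mZ1 mZ2 Z10 Z20 le12 mU U0.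
have mEU : measurable_fun setT (EFin \o U) by exact/measurable_EFinP.
pose h := nnsfun_approx measurableT mEU.
have lim_h (Z : Omega -> R) : measurable_fun setT Z -> (forall w, 0 <= Z w) ->
    (\int[P]_w ((U (phi w))%:E * (Z w)%:E) =
    lim (\int[P]_w ((h n (phi w))%:E * (Z w)%:E) @[n --> \oo]))%E.
  move=> mZ Z0.
  have UZ w : ((U (phi w))%:E * (Z w)%:E =
      lim ((h n (phi w))%:E * (Z w)%:E @[n --> \oo]))%E.
    apply/esym/cvg_lim => //; apply: cvgeZr => //.
    by apply: (cvg_nnsfun_approx measurableT mEU) => // t _; rewrite lee_fin.
  under eq_integral do rewrite UZ.
  apply: monotone_convergence => //.
  - move=> n; apply: emeasurable_funM; apply/measurable_EFinP => //.
    exact: measurableT_comp.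
  - by move=> n w _; rewrite mule_ge0 ?lee_fin.
  - move=> w _ a b ab; rewrite lee_wpmul2r ?lee_fin//.
    exact/lefP/nd_nnsfun_approx.
have cvg_h (Z : Omega -> R) : measurable_fun setT Z -> (forall w, 0 <= Z w) ->
    cvgn (fun n => \int[P]_w ((h n (phi w))%:E * (Z w)%:E))%E.
  move=> mZ Z0; apply: ereal_nondecreasing_is_cvgn => a b ab.
  apply: ge0_le_integral => //.
  - by move=> w _; rewrite mule_ge0 ?lee_fin.
  - apply: emeasurable_funM; apply/measurable_EFinP => //.
    exact: measurableT_comp.
  - apply: emeasurable_funM; apply/measurable_EFinP => //.
    exact: measurableT_comp.
  - move=> w _; rewrite lee_wpmul2r ?lee_fin//.
    exact/lefP/nd_nnsfun_approx.
rewrite !lim_h//; apply: lee_lim; [exact: cvg_h|exact: cvg_h|].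
apply: nearW => n; rewrite !integral_nnsfun_comp//.
apply: lee_fsum => // r -[t _ <-].
by rewrite lee_wpmul2l ?lee_fin// le12.
Qed.

(** Comparison of [Z] with the constant [c]. Integrability of the product is part of the conclusion:
    its integral is at most c times the finite integral of [U \o phi]. *)
Lemma cond_bound (Z : Omega -> R) (c : R) (U : T -> R) :
  0 <= c -> measurable_fun setT Z -> (forall w, 0 <= Z w) ->
  (forall A, measurable A -> \int[P]_(w in phi @^-1` A) (Z w)%:E
                           <= c%:E * P (phi @^-1` A))%E ->
  measurable_fun setT U -> (forall t, 0 <= U t) ->
  P.-integrable setT (EFin \o (U \o phi)) ->
  P.-integrable setT (EFin \o (fun w => U (phi w) * Z w)) /\
  (\int[P]_w (U (phi w) * Z w) <= c * \int[P]_w U (phi w))%R.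
Proof.
move=> c0 mZ Z0 Zc mU U0 iU.
have mUphi : measurable_fun setT (U \o phi) by exact: measurableT_comp.
have le : (\int[P]_w (U (phi w) * Z w)%:E <= c%:E * \int[P]_w (U (phi w))%:E)%E.
  apply: le_trans (_ : \int[P]_w ((U (phi w))%:E * (cst c w)%:E) <= _)%E.
    under eq_integral do rewrite EFinM.
    apply: ge0_le_integral_cond => //.
    move=> A mA; have -> : (\int[P]_(w in phi @^-1` A) (cst c w)%:E =
      c%:E * P (phi @^-1` A))%E; last exact: Zc.
    by rewrite -integral_cst// -[X in measurable X]setTI; exact: mphi.
  under eq_integral do rewrite /= muleC.
  rewrite ge0_integralZl//; first exact/measurable_EFinP.
  by move=> w _; rewrite lee_fin.
have fin : (\int[P]_w (U (phi w))%:E \is a fin_num)%E.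
  exact: integrable_fin_num iU.
have mUZ : measurable_fun setT (fun w => U (phi w) * Z w).
  exact: measurable_funM.
have lty : (\int[P]_w (U (phi w) * Z w)%:E < +oo)%E.
  by apply: le_lt_trans le _; rewrite -(fineK fin) -EFinM ltry.
have fin' : (\int[P]_w (U (phi w) * Z w)%:E \is a fin_num)%E.
  by rewrite ge0_fin_numE// integral_ge0// => w _; rewrite lee_fin mulr_ge0.
split; last by rewrite -lee_fin EFinM /Rintegral !fineK.
apply/integrableP; split; first exact/measurable_EFinP.
apply: le_lt_trans lty; apply: ge0_le_integral => //.
- by apply/measurable_EFinP; apply: measurableT_comp.
- exact/measurable_EFinP.
- by move=> w _ /=; rewrite lee_fin ger0_norm// mulr_ge0.
Qed.

(** The positive and negative parts of [Z] have equal integrals over the events of the past, hence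
    against every nonnegative function of [phi], by comparison in both directions. Apply this to
    both parts of [U]; the four products are dominated by the integrable [U (phi w) * Z w]. *)
Lemma cond_mean0 (Z : Omega -> R) (U : T -> R) :
  P.-integrable setT (EFin \o Z) ->
  (forall A, measurable A -> \int[P]_(w in phi @^-1` A) (Z w)%:E = 0)%E ->
  measurable_fun setT U ->
  P.-integrable setT (EFin \o (fun w => U (phi w) * Z w)) ->
  \int[P]_w (U (phi w) * Z w) = 0.
Proof.
move=> iZ Z0 mU iUZ.
have mZ : measurable_fun setT Z by apply/measurable_EFinP; exact: measurable_int iZ.
have mUphi : measurable_fun setT (U \o phi) by exact: measurableT_comp.
have mZp : measurable_fun setT Z^\+ by exact: measurable_funrpos.
have mZn : measurable_fun setT Z^\- by exact: measurable_funrneg.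
have ieq (V : T -> R) : measurable_fun setT V -> (forall t, 0 <= V t) ->
    \int[P]_w (V (phi w) * Z^\+ w) = \int[P]_w (V (phi w) * Z^\- w).
  have AE A : measurable A -> (\int[P]_(w in phi @^-1` A) (Z^\+ w)%:E
      = \int[P]_(w in phi @^-1` A) (Z^\- w)%:E)%E.
    move=> mA; have mpA : measurable (phi @^-1` A).
      by rewrite -[X in measurable X]setTI; exact: mphi.
    have iZA : P.-integrable (phi @^-1` A) (EFin \o Z).
      by apply: integrableS iZ.
    have ip := integrable_fin_num mpA (integrable_funrpos mpA iZA).
    have ineg := integrable_fin_num mpA (integrable_funrneg mpA iZA).
    have := Z0 _ mA; rewrite integralE funerpos funerneg => /eqP.
    by rewrite sube_eq ?add0e ?fin_num_adde_defl// => /eqP.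
  move=> mV V0; congr fine; under eq_integral do rewrite EFinM.
  under [RHS]eq_integral do rewrite EFinM.
  apply/eqP; rewrite eq_le.
  by apply/andP; split; apply: ge0_le_integral_cond => // A mA; rewrite AE.
have mUp : measurable_fun setT U^\+ by exact: measurable_funrpos.
have mUn : measurable_fun setT U^\- by exact: measurable_funrneg.
have dom (V : T -> R) (Y : Omega -> R) : measurable_fun setT V ->
    measurable_fun setT Y -> (forall t, `|V t| <= `|U t|) ->
    (forall w, `|Y w| <= `|Z w|) ->
    P.-integrable setT (EFin \o (fun w => V (phi w) * Y w)).
  move=> mV mY VU YZ; apply: le_integrable iUZ => //.
    apply/measurable_EFinP; apply: measurable_funM => //.
    exact: measurableT_comp.
  by move=> w _; rewrite /= lee_fin !normrM ler_pM.
have bp (X : Type) (f : X -> R) t : `|f^\+ t| <= `|f t|.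
  by rewrite ger0_norm// /funrpos ge_max ler_norm normr_ge0.
have bn (X : Type) (f : X -> R) t : `|f^\- t| <= `|f t|.
  by rewrite ger0_norm// /funrneg ge_max normr_ge0 -normrN ler_norm.
have split_ (X : Type) (f : X -> R) t : f t = f^\+ t - f^\- t.
  by have := congr1 (@^~ t) (funrposBneg f) => /= <-.
transitivity (\int[P]_w ((U^\+ (phi w) * Z^\+ w - U^\+ (phi w) * Z^\- w)
   - (U^\- (phi w) * Z^\+ w - U^\- (phi w) * Z^\- w))).
  by apply: eq_Rintegral => w _; rewrite (split_ _ U) (split_ _ Z); ring.
have ipp := dom _ _ mUp mZp (bp _ U) (bp _ Z).
have ipn := dom _ _ mUp mZn (bp _ U) (bn _ Z).
have inp := dom _ _ mUn mZp (bn _ U) (bp _ Z).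
have inn := dom _ _ mUn mZn (bn _ U) (bn _ Z).
rewrite RintegralB//.
- by rewrite !RintegralB// !ieq// !subrr.
- exact: integrableB ipp ipn.
- exact: integrableB inp inn.
Qed.


End Conditioning.

(** * Measurability of vector-valued maps *)

Section BorelMaps.
Context {R : realType}.

Lemma continuous_borel_fun (T U : topologicalType) (f : T -> U) :
  continuous f -> borel_fun f.
Proof.
move=> cf B bB; rewrite -[X in borel X]setTI.
have : image_set_system setT f (@borel T) B; last by [].
apply: smallest_sub B bB; first by apply: sigma_algebra_image; exact: smallest_sigma_algebra.
move=> A oA; rewrite /image_set_system/= setTI; apply: sub_gen_smallest.
by move/continuousP : cf; apply.
Qed.

Context {d : measure_display} {T : measurableType d}.

Definition borel_meas (U : topologicalType) (X : T -> U) :=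
  forall B, borel B -> measurable (X @^-1` B).

(** The working notion of measurability: arithmetic is done on real coordinates, and
    [coord_meas_borel] and [borel_meas_coord] lead to and from the Borel sets of the product
    topology. *)
Definition coord_meas n (X : T -> 'cV[R]_n) :=
  forall i, measurable_fun setT (fun t => X t i 0).

Lemma borel_meas_open (U : topologicalType) (X : T -> U) :
  (forall B, open B -> measurable (X @^-1` B)) -> borel_meas X.
Proof.
move=> mX B bB; rewrite -[X in measurable X]setTI.
have : image_set_system setT X measurable B; last by [].
apply: smallest_sub B bB; last first.
  by move=> A oA; rewrite /image_set_system/= setTI; exact: mX.
exact/sigma_algebra_image/sigma_algebra_measurable.
Qed.

Lemma borel_meas_comp (U V : topologicalType) (X : T -> U) (f : U -> V) :
  borel_meas X -> borel_fun f -> borel_meas (f \o X).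
Proof. by move=> mX bf B bB; exact: (mX _ (bf _ bB)). Qed.

Lemma borel_meas_real (X : T -> R) : borel_meas X -> measurable_fun setT X.
Proof.
move=> mX; apply: (measurability _ (RGenOInfty.measurableE R)).
move=> _ [_ [x ->] <-]; rewrite setTI; apply: mX; apply: sub_gen_smallest.
exact: rray_open.
Qed.

Lemma borel_meas_coord n (X : T -> 'cV[R]_n) : borel_meas X -> coord_meas X.
Proof.
move=> mX i; apply: borel_meas_real.
apply: (@borel_meas_comp _ _ X (fun v : 'cV[R]_n => v i 0) mX).
by apply: continuous_borel_fun => v; exact: coord_continuous.
Qed.

Let rball n (q : 'cV[rat]_n) (k : nat) : set 'cV[R]_n :=
  [set v | forall i, `|ratr (q i 0) - v i 0| < k.+1%:R^-1].

Let rball_dense n (v : 'cV[R]_n) (k : nat) : exists q, rball q k v.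
Proof.
have H i : exists q : rat, `|ratr q - v i 0| < k.+1%:R^-1.
  have /rat_in_itvoo[q] : v i 0 - k.+1%:R^-1 < v i 0 + k.+1%:R^-1.
    by rewrite ltrBlDr -addrA ltrDl addr_gt0.
  rewrite in_itv/= => /andP[q1 q2]; exists q.
  by rewrite ltr_distl q1 q2.
have [f Hf] := choice H.
by exists (\col_i f i) => i; rewrite mxE.
Qed.

Let rball_meas n (X : T -> 'cV[R]_n) q k : coord_meas X ->
  measurable (X @^-1` (rball q k)).
Proof.
move=> mX.
have -> : X @^-1` (rball q k) = \bigcap_(i in [set: 'I_n])
    ((fun t => `|ratr (q i 0) - X t i 0|) @^-1` `]-oo, k.+1%:R^-1[).
  by apply/seteqP; split=> t /= H i => [_|]; have := H i; rewrite /= ?in_itv/=; [|exact].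
apply: fin_bigcap_measurable => // i _; rewrite -[X in measurable X]setTI.
have mf : measurable_fun setT (fun t => `|ratr (q i 0) - X t i 0|).
  by apply: measurableT_comp => //; exact: measurable_funB.
by apply: mf => //; exact: measurable_itv.
Qed.

(* Second countability of the product: rational boxes generate its opens. *)
Lemma coord_meas_pair n m (X : T -> 'cV[R]_n) (Y : T -> 'cV[R]_m) :
  coord_meas X -> coord_meas Y -> borel_meas (fun t => (X t, Y t)).
Proof.
move=> mX mY; apply: borel_meas_open => B oB.
pose I := ('cV[rat]_n * 'cV[rat]_m * nat)%type.
pose F (c : I) : set T := if `[< rball c.1.1 c.2 `*` rball c.1.2 c.2 `<=` B >]
  then X @^-1` rball c.1.1 c.2 `&` Y @^-1` rball c.1.2 c.2 else set0.
have -> : (fun t => (X t, Y t)) @^-1` B = \bigcup_c F c.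
  apply/seteqP; split => [t /= Bt|t [c _]]; last first.
    rewrite /F; case: asboolP => // sB [Xt Yt]; exact: sB.
  have /nbhs_ballP[e /= e0 eB] : nbhs (X t, Y t) B by move: oB; rewrite openE; apply.
  have [k k_e] : exists k : nat, 2 * k.+1%:R^-1 < e.
    have [k _ kP] := near_infty_natSinv_lt (PosNum (divr_gt0 e0 (ltr0n _ 2))).
    by exists k; have /= := kP k (leqnn k); rewrite ltr_pdivlMr// mulrC.
  have [q1 q1P] := rball_dense (X t) k; have [q2 q2P] := rball_dense (Y t) k.
  exists (q1, q2, k) => //; rewrite /F; case: asboolP => //= -[] [u v] [/= q1u q2v].
  have tri x y (c : R) : `|c - x| < k.+1%:R^-1 -> `|c - y| < k.+1%:R^-1 -> `|x - y| < e.
    move=> h1 h2; apply: le_lt_trans k_e.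
    have -> : x - y = (c - y) - (c - x) by ring.
    apply: le_trans (ler_normB _ _) _; rewrite mulr2n mulrDl !mul1r.
    by apply: lerD; exact: ltW.
  apply: eB; split; split => // i j; rewrite (ord1 j) /ball/= /ball_/=.
    exact: tri (q1P i) (q1u i).
  exact: tri (q2P i) (q2v i).
apply: countable_bigcupT_measurable => [|c]; first exact: countableP.
rewrite /F; case: ifP => // _.
by apply: measurableI; exact: rball_meas.
Qed.

Lemma coord_meas_borel n (X : T -> 'cV[R]_n) : coord_meas X -> borel_meas X.
Proof.
move=> mX; have -> : X = fst \o (fun t => (X t, X t)) by [].
apply: borel_meas_comp; first exact: coord_meas_pair.
by apply: continuous_borel_fun => z; exact: cvg_fst.
Qed.

Lemma coord_meas_map2 n m k (f : 'cV[R]_n -> 'cV[R]_m -> 'cV[R]_k) X Y :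
  borel_fun (fun z => f z.1 z.2) -> coord_meas X -> coord_meas Y ->
  coord_meas (fun t => f (X t) (Y t)).
Proof.
by move=> bf mX mY; apply/borel_meas_coord/(borel_meas_comp (coord_meas_pair mX mY) bf).
Qed.

(** The topology on column vectors is that of the sup norm, and [enorm] is at most n times the sup
    norm, whence the radius. The shifts in [|L| + 1] and [n.+1] keep the denominators positive. *)
Lemma lipschitz_continuous n k (L : R) (f : 'cV[R]_n -> 'cV[R]_k) :
  (forall u v, enorm (f u - f v) <= L * enorm (u - v)) -> continuous f.
Proof.
move=> Lf u; have FF : Filter (nbhs u) by exact: nbhs_filter.
apply/cvg_ballP => e e0.
have e0' : 0 < e / (`|L| + 1) / n.+1%:R.
  by rewrite !divr_gt0// ltr_wpDl.
apply: filterS (nbhsx_ballx u _ e0') => v [_ uv].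
split => // i j; rewrite (ord1 j) /ball/= /ball_/=.
have := coord_le_enorm (f u - f v) i; rewrite !mxE => /le_lt_trans; apply.
apply: le_lt_trans (Lf _ _) _.
have uvn : enorm (u - v) <= e / (`|L| + 1) / n.+1%:R * n%:R.
  apply: le_trans (enorm_le_sum _) _.
  apply: le_trans (_ : \sum_(i < n) (e / (`|L| + 1) / n.+1%:R) <= _); last first.
    by rewrite sumr_const card_ord mulr_natr.
  by apply: ler_sum => l _; have /ltW := uv l 0; rewrite !mxE.
apply: le_lt_trans (ler_wpM2r (enorm_ge0 _) (ler_norm L)) _.
apply: le_lt_trans (ler_wpM2l (normr_ge0 _) uvn) _.
have -> : `|L| * (e / (`|L| + 1) / n.+1%:R * n%:R) =
   e * (`|L| / (`|L| + 1)) * (n%:R / n.+1%:R) by ring.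
have h1 : `|L| / (`|L| + 1) < 1.
  by rewrite ltr_pdivrMr ?mul1r ?ltrDl// ltr_wpDl.
have h2 : n%:R / n.+1%:R <= 1 :> R by rewrite ler_pdivrMr ?mul1r ?ler_nat.
have h3 : 0 <= `|L| / (`|L| + 1) by rewrite divr_ge0// addr_ge0.
have h4 : 0 <= n%:R / n.+1%:R :> R by rewrite divr_ge0.
apply: le_lt_trans (_ : e * (`|L| / (`|L| + 1)) < e); last by rewrite gtr_pMr.
by rewrite ler_piMr// mulr_ge0// ltW.
Qed.

Lemma coord_meas_D n (X Y : T -> 'cV[R]_n) : coord_meas X -> coord_meas Y ->
  coord_meas (fun t => X t + Y t).
Proof.
move=> mX mY i; rewrite (_ : (fun t => _) = (fun t => X t i 0 + Y t i 0)).
  exact: measurable_funD.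
by apply/funext => t; rewrite mxE.
Qed.

Lemma coord_meas_Z n (a : R) (X : T -> 'cV[R]_n) : coord_meas X ->
  coord_meas (fun t => a *: X t).
Proof.
move=> mX i; rewrite (_ : (fun t => _) = (fun t => a * X t i 0)).
  exact: measurable_funM.
by apply/funext => t; rewrite mxE.
Qed.

Lemma coord_meas_B n (X Y : T -> 'cV[R]_n) : coord_meas X -> coord_meas Y ->
  coord_meas (fun t => X t - Y t).
Proof.
move=> mX mY; rewrite (_ : (fun t => _) = (fun t => X t + (-1) *: Y t)).
  by apply: coord_meas_D => //; exact: coord_meas_Z.
by apply/funext => t; rewrite scaleN1r.
Qed.

Lemma coord_meas_cst n (v : 'cV[R]_n) : coord_meas (fun=> v).
Proof. by move=> i; exact: measurable_cst. Qed.

Lemma coord_meas_dot n (X Y : T -> 'cV[R]_n) : coord_meas X -> coord_meas Y ->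
  measurable_fun setT (fun t => dotv (X t) (Y t)).
Proof.
by move=> mX mY; apply: measurable_sum => i; exact: measurable_funM.
Qed.

Lemma coord_meas_enorm n (X : T -> 'cV[R]_n) : coord_meas X ->
  measurable_fun setT (fun t => enorm (X t)).
Proof.
move=> mX; apply: measurableT_comp; last exact: coord_meas_dot.
by apply: continuous_measurable_fun; exact: sqrt_continuous.
Qed.

End BorelMaps.

(** * Bounds and measurability of the Jacobian of H *)

Section Jacobian.
Context {R : realType}.
Variables (m n : nat) (H : 'cV[R]_n -> 'cV[R]_m) (L S delta : R).
Hypothesis delta_gt0 : 0 < delta.
Hypothesis H_lip : forall y1 y2, enorm (H y1 - H y2) <= L * enorm (y1 - y2).
Hypothesis H_smooth : forall y1 y2 : 'cV[R]_n,
  enorm (H y1 - H y2 - 'd H y2 (y1 - y2)) <= S * enorm (y1 - y2) `^ (1 + delta).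

(** The smoothness condition at step s v, divided by s: difference quotients converge to the
    derivative at rate s^delta. The Lipschitz bound and the measurability of the Jacobian both pass
    to this limit. *)
Let quot_bound (y v : 'cV[R]_n) (s : R) i : 0 < s -> s <= 1 ->
  `|s^-1 * (H (y + s *: v) - H y) i 0 - 'd H y v i 0|
    <= S * enorm v `^ (1 + delta) * s `^ delta.
Proof.
move=> s0 s1; have := H_smooth (y + s *: v) y.
rewrite (addrC y) addrK linearZ/= enormZ (gtr0_norm s0).
have sE : s `^ (1 + delta) = s * s `^ delta.
  by rewrite powRD ?powRr1 ?(ltW s0)// (gt_eqF s0) implybT.
rewrite powRM ?(ltW s0)// sE.
set D := H _ - H y - _ => Dle.
have -> : s^-1 * (H (s *: v + y) - H y) i 0 - 'd H y v i 0 = s^-1 * D i 0.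
  by rewrite /D !mxE; field; exact: lt0r_neq0.
rewrite normrM gtr0_norm ?invr_gt0// ler_pdivrMl//.
apply: le_trans (coord_le_enorm _ _) _; apply: le_trans Dle _.
by rewrite le_eqVlt; apply/orP; left; apply/eqP; ring.
Qed.

Lemma jacobian_bound (y v : 'cV[R]_n) i : `|'d H y v i 0| <= L * enorm v.
Proof.
apply: (@le_of_small_scale _ _ _ (S * enorm v `^ (1 + delta)) delta) => // s s0 s1.
have h1 := quot_bound y v i s0 s1.
have h2 : `|s^-1 * (H (y + s *: v) - H y) i 0| <= L * enorm v.
  rewrite normrM gtr0_norm ?invr_gt0// ler_pdivrMl//.
  apply: le_trans (coord_le_enorm _ _) _; apply: le_trans (H_lip _ _) _.
  by rewrite (addrC y) addrK enormZ (gtr0_norm s0) mulrCA.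
set a := _ * _ in h1 h2; set b := 'd H y v i 0 in h1 *.
have -> : b = a - (a - b) by rewrite subKr.
by apply: le_trans (ler_normB _ _) _; rewrite lerD.
Qed.

(** The derivative in a fixed direction is the pointwise limit of difference quotients at scale
    1/(k+1), which are measurable because H is continuous. *)
Lemma jacobian_measurable {d : measure_display} {T : measurableType d}
    (Y : T -> 'cV[R]_n) (v : 'cV[R]_n) i : coord_meas Y ->
  measurable_fun setT (fun t => 'd H (Y t) v i 0).
Proof.
move=> mY; pose q k t := k.+1%:R * (H (Y t + k.+1%:R^-1 *: v) - H (Y t)) i 0.
have bH : borel_fun H.
  by apply: continuous_borel_fun; exact: lipschitz_continuous H_lip.
apply: (@measurable_fun_cvg _ _ _ _ q) => [k|t _].
  apply: measurable_funM => //.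
  apply: (coord_meas_B (borel_meas_coord (borel_meas_comp (coord_meas_borel _) bH))
     (borel_meas_coord (borel_meas_comp (coord_meas_borel _) bH))) => //.
  by apply: coord_meas_D => //; exact: coord_meas_cst.
apply/cvgrPdist_le => e e0.
pose C := `|S * enorm v `^ (1 + delta)| + 1.
have C0 : 0 < C by rewrite ltr_wpDl.
have m0 : 0 < (e / C) `^ delta^-1 by apply: powR_gt0; exact: divr_gt0.
have [K _ KP] := near_infty_natSinv_lt (PosNum m0).
exists K => //= k Kk; rewrite distrC.
have k1 : 0 < k.+1%:R^-1 :> R by rewrite invr_gt0.
have k2 : k.+1%:R^-1 <= 1 :> R by rewrite invf_le1 ?ler1n.
have := quot_bound (Y t) v i k1 k2; rewrite invrK => /le_trans; apply.
have h : k.+1%:R^-1 `^ delta <= e / C.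
  have -> : e / C = ((e / C) `^ delta^-1) `^ delta.
    by rewrite -powRrM mulVf ?gt_eqF// powRr1// divr_ge0// ltW.
  by rewrite ge0_ler_powR ?nnegrE ?(ltW delta_gt0) ?(ltW m0)// ltW// KP.
apply: le_trans (ler_wpM2r (powR_ge0 _ _) (ler_norm _)) _.
apply: le_trans (ler_wpM2l (normr_ge0 _) h) _.
rewrite mulrCA ler_piMr ?(ltW e0)// ler_pdivrMr// mul1r.
by rewrite /C lerDl.
Qed.

End Jacobian.

(** * Deterministic drift *)

Section Pointwise.
Context {R : realType}.

(** |z - a f|^2 <= (1 - 2 a mu + a^2 L^2) |z|^2 <= (1 - a mu) |z|^2 <= (1 - a mu / 2)^2 |z|^2. *)
Lemma strongly_monotone_contract n (z f : 'cV[R]_n) (mu L a : R) :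
  0 <= a -> 0 <= L -> a * L ^+ 2 <= mu -> a * mu <= 1 ->
  mu * enorm z ^+ 2 <= dotv z f -> enorm f <= L * enorm z ->
  enorm (z - a *: f) <= (1 - a * mu / 2) * enorm z.
Proof.
move=> a0 L0 aL amu mono lip.
have mu0 : 0 <= mu by apply: le_trans aL; rewrite mulr_ge0// sqr_ge0.
have amu0 : 0 <= a * mu by exact: mulr_ge0.
have p0 := enorm_ge0 z.
have rhs0 : 0 <= (1 - a * mu / 2) * enorm z by apply: mulr_ge0 => //; lra.
rewrite -(@ler_pXn2r _ 2)// ?nnegrE//.
rewrite enormD_sqr enormN enormZ dotvNr dotvZr ger0_norm//.
have f2 : enorm f ^+ 2 <= L ^+ 2 * enorm z ^+ 2.
  by rewrite -exprMn; apply: lerXn2r; rewrite ?nnegrE ?mulr_ge0.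
have h1 : a * (mu * enorm z ^+ 2) <= a * dotv z f by rewrite ler_wpM2l.
have h2 : a ^+ 2 * enorm f ^+ 2 <= a ^+ 2 * (L ^+ 2 * enorm z ^+ 2).
  by rewrite ler_wpM2l// sqr_ge0.
have h3 : a * (a * L ^+ 2) * enorm z ^+ 2 <= a * mu * enorm z ^+ 2.
  by rewrite ler_wpM2r ?sqr_ge0// ler_wpM2l.
have h4 : 0 <= (a * mu) ^+ 2 * enorm z ^+ 2 by rewrite mulr_ge0// sqr_ge0.
rewrite !exprMn; lra.
Qed.

(** If s^2 <= al, the power itself is at most al^(r/2). Otherwise s^2 / al >= 1, and raising its
    exponent from r/2 to 2 leads to s^4 / al^2 <= Q. *)
Lemma powR_le_moment (s al Q r : R) : 0 <= s -> 0 < al -> 1 <= Q ->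
  s ^+ 4 <= al ^+ 2 * Q -> 0 <= r <= 4 -> s `^ r <= al `^ (r / 2) * Q.
Proof.
move=> s0 al0 Q1 sQ /andP[r0 r4].
have -> : s `^ r = (s ^+ 2) `^ (r / 2).
  by rewrite -powR_mulrn// -powRrM; congr (_ `^ _); field.
have [h|h] := lerP (s ^+ 2) al.
  apply: le_trans (_ : al `^ (r / 2) <= _).
    by rewrite ge0_ler_powR ?nnegrE ?sqr_ge0 ?(ltW al0)// divr_ge0.
  by rewrite ler_peMr// powR_ge0.
have z1 : 1 <= s ^+ 2 / al by rewrite ler_pdivlMr// mul1r ltW.
have -> : s ^+ 2 = al * (s ^+ 2 / al) by rewrite mulrC divfK ?gt_eqF.
rewrite powRM ?(ltW al0)//; last by apply: le_trans z1.
rewrite ler_pM2l ?powR_gt0//.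
apply: le_trans (_ : (s ^+ 2 / al) `^ 2%:R <= _); first by rewrite ler_powR//; lra.
rewrite powR_mulrn; last by apply: le_trans z1.
rewrite exprMn -exprM exprVn ler_pdivrMr ?exprn_gt0//; lra.
Qed.

(** Both products are at most max(p, q)^(2 + r), to which [powR_le_moment] applies with exponent 2 +
    r <= 4. *)
Lemma mixed_powR_le_moment (p q al Q r : R) : 0 <= p -> 0 <= q -> 0 < al ->
  1 <= Q -> p ^+ 4 + q ^+ 4 <= al ^+ 2 * Q -> 0 <= r <= 2 ->
  q * p `^ (1 + r) <= al `^ (1 + r / 2) * Q /\
  q * q `^ (1 + r) <= al `^ (1 + r / 2) * Q.
Proof.
move=> p0 q0 al0 Q1 pq /andP[r0 r2].
pose m := Num.max p q.
have m0 : 0 <= m by rewrite le_max p0.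
have mQ : m ^+ 4 <= al ^+ 2 * Q.
  apply: le_trans pq; rewrite /m; case: (lerP p q) => _.
    by rewrite lerDr exprn_ge0.
  by rewrite lerDl exprn_ge0.
have mE : m * m `^ (1 + r) <= al `^ (1 + r / 2) * Q.
  have -> : 1 + r / 2 = (2 + r) / 2 by field.
  have -> : m * m `^ (1 + r) = m `^ (2 + r).
    have -> : 2 + r = 1 + (1 + r) by ring.
    rewrite [RHS]powRD ?powRr1//; apply/implyP; rewrite gt_eqF//; lra.
  by apply: powR_le_moment => //; apply/andP; split; lra.
have r1 : 0 <= 1 + r by lra.
split; apply: le_trans mE; apply: ler_pM; rewrite ?powR_ge0 ?le_max ?lexx ?orbT//;
  by rewrite ge0_ler_powR ?nnegrE// le_max lexx ?orbT.
Qed.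

Lemma sqr_le_moment (s al Q : R) : 0 <= s -> 0 < al -> 1 <= Q ->
  s ^+ 4 <= al ^+ 2 * Q -> s ^+ 2 <= al * Q.
Proof.
move=> s0 al0 Q1 sQ; have h : 0 <= (2 : R) <= 4 by apply/andP; split; lra.
have := powR_le_moment s0 al0 Q1 sQ h.
by rewrite powR_mulrn// divff ?pnatr_eq0// powRr1// ltW.
Qed.

End Pointwise.

Section Drift.
Context {R : realType} {dx dy : nat}.
Variables (F : 'cV[R]_dx -> 'cV[R]_dy -> 'cV[R]_dx)
  (G : 'cV[R]_dx -> 'cV[R]_dy -> 'cV[R]_dy)
  (H : 'cV[R]_dy -> 'cV[R]_dx) (ystar : 'cV[R]_dy)
  (LH LF LGx LGy muF muG : R).
Hypotheses (LH0 : 0 < LH) (LF0 : 0 < LF) (LGx0 : 0 < LGx) (LGy0 : 0 < LGy)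
  (muF0 : 0 < muF) (muG0 : 0 < muG).
Hypothesis A1 : assumption_A1 LH LF F H.
Hypothesis A2 : assumption_A2 LGx LGy G H ystar.
Hypothesis A3 : assumption_A3 muF muG F G H ystar.
Variables alpha beta : R.
Hypotheses (alpha0 : 0 < alpha) (beta0 : 0 < beta).
Hypotheses (alphaLF : alpha * LF ^+ 2 <= muF) (alpha_muF : alpha * muF <= 1)
  (betaLGy : beta * LGy ^+ 2 <= muG) (beta_muG : beta * muG <= 1)
  (betaLH : beta * (LH * LGx) <= alpha * muF / 4).

Local Notation p x y := (enorm (x - H y)).
Local Notation q y := (enorm (y - ystar)).

Lemma fast_norm_le x y : enorm (F x y) <= LF * p x y.
Proof. by have [/(_ y)[Fy _] _ /(_ x y)] := A1; rewrite Fy subr0. Qed.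

Lemma slow_norm_le0 y : enorm (G (H y) y) <= LGy * q y.
Proof. by have [[Gy _] _ /(_ y)] := A2; rewrite Gy subr0. Qed.

Lemma slow_norm_le x y : enorm (G x y) <= LGx * p x y + LGy * q y.
Proof.
have [_ /(_ x y) h _] := A2; rewrite -(subrK (G (H y) y) (G x y)).
by apply: le_trans (enormD _ _) _; rewrite lerD ?slow_norm_le0.
Qed.

Lemma fast_contract x y :
  enorm (x - H y - alpha *: F x y) <= (1 - alpha * muF / 2) * p x y.
Proof.
apply: strongly_monotone_contract (fast_norm_le x y) => //; try exact: ltW.
by have [/(_ y)[Fy _] _ _] := A1; have [/(_ x y) + _] := A3; rewrite Fy subr0.
Qed.

Lemma slow_contract0 y :
  enorm (y - ystar - beta *: G (H y) y) <= (1 - beta * muG / 2) * q y.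
Proof.
apply: strongly_monotone_contract (slow_norm_le0 y) => //; try exact: ltW.
by have [[Gy _] _ _] := A2; have [_ /(_ y)] := A3; rewrite Gy subr0.
Qed.

(** The new fast error x - alpha F - H(y - beta G) without noise, written as a contraction step at
    frozen y plus the lag of H. *)
Definition fast_drift x y :=
  x - H y - alpha *: F x y + (H y - H (y - beta *: G x y)).

Definition slow_drift x y := y - ystar - beta *: G x y.

Lemma lag_le x y : enorm (H y - H (y - beta *: G x y))
  <= LH * beta * (LGx * p x y + LGy * q y).
Proof.
have [_ /(_ y (y - beta *: G x y)) h _] := A1; apply: le_trans h _.
rewrite subKr enormZ gtr0_norm// mulrA.
by rewrite ler_pM2l ?mulr_gt0// slow_norm_le.
Qed.

(** The part of the lag proportional to |x - H y| is paid for by half of the contraction, by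
    [betaLH]. *)
Lemma fast_drift_le x y : enorm (fast_drift x y) <=
  (1 - alpha * muF / 4) * p x y + beta * (LH * LGy) * q y.
Proof.
apply: le_trans (enormD _ _) _; have := fast_contract x y; have := lag_le x y.
have : beta * (LH * LGx) * p x y <= alpha * muF / 4 * p x y by rewrite ler_wpM2r.
lra.
Qed.

Lemma slow_drift_le x y : enorm (slow_drift x y) <=
  (1 - beta * muG / 2) * q y + beta * LGx * p x y.
Proof.
have -> : slow_drift x y = (y - ystar - beta *: G (H y) y)
    - beta *: (G x y - G (H y) y).
  by rewrite /slow_drift scalerBr opprB addrA subrK.
apply: le_trans (enormB_le _ _) _; rewrite enormZ gtr0_norm//.
apply: lerD; first exact: slow_contract0.
by have [_ /(_ x y) h _] := A2; rewrite -mulrA ler_pM2l.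
Qed.

(** [pow4_contract] with s = alpha muF / 4, hence 64 = 4^3. The coupling beta^4 / alpha^3 is small
    compared with the rate alpha when beta / alpha is small. *)
Lemma fast_drift_pow4 x y : enorm (fast_drift x y) ^+ 4 <=
  (1 - alpha * muF / 4) * p x y ^+ 4
  + 64 * (LH * LGy) ^+ 4 / muF ^+ 3 * (beta ^+ 4 / alpha ^+ 3) * q y ^+ 4.
Proof.
have s0 : 0 < alpha * muF / 4 by rewrite divr_gt0// mulr_gt0.
have -> : 64 * (LH * LGy) ^+ 4 / muF ^+ 3 * (beta ^+ 4 / alpha ^+ 3) =
  (beta * (LH * LGy)) ^+ 4 / (alpha * muF / 4) ^+ 3.
  by field; rewrite !gt_eqF.
apply: pow4_contract (fast_drift_le x y) => //.
  by apply/andP; split => //; move: alpha_muF; lra.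
by rewrite ltW// !mulr_gt0.
Qed.

Lemma slow_drift_pow4 x y : enorm (slow_drift x y) ^+ 4 <=
  (1 - beta * muG / 2) * q y ^+ 4
  + 8 * LGx ^+ 4 / muG ^+ 3 * beta * p x y ^+ 4.
Proof.
have s0 : 0 < beta * muG / 2 by rewrite divr_gt0// mulr_gt0.
have -> : 8 * LGx ^+ 4 / muG ^+ 3 * beta =
  (beta * LGx) ^+ 4 / (beta * muG / 2) ^+ 3.
  by field; rewrite !gt_eqF.
apply: pow4_contract (slow_drift_le x y) => //.
  by apply/andP; split => //; move: beta_muG; lra.
by rewrite ltW// mulr_gt0.
Qed.

(** Test the contraction at y = ystar and x = H ystar + s z, divide by s and let s tend to 0: the
    linearization error vanishes like s^delta, and its slow part is 0 since y = ystar. *)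
Lemma linear_fast_contract (B1 : 'M[R]_dx) (S delta : R) : 0 < delta ->
  (forall x y, enorm (F x y - B1 *m (x - H y))
    <= S * (p x y `^ (1 + delta) + q y `^ (1 + delta))) ->
  forall z, enorm (z - alpha *: (B1 *m z)) <= (1 - alpha * muF / 2) * enorm z.
Proof.
move=> delta0 lin z.
apply: (@le_of_small_scale _ _ _ (alpha * S * enorm z `^ (1 + delta)) delta) => //.
move=> s s0 s1; rewrite -(ler_pM2l s0).
have := fast_contract (H ystar + s *: z) ystar.
have := lin (H ystar + s *: z) ystar.
rewrite !(addrC (H ystar)) addrK subrr enorm0 enormZ (gtr0_norm s0).
rewrite (@powR0 _ (1 + delta)) ?gt_eqF ?addr_gt0// addr0.
have sE : s `^ (1 + delta) = s * s `^ delta.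
  by rewrite powRD ?powRr1 ?(ltW s0)// (gt_eqF s0) implybT.
rewrite powRM ?(ltW s0)// sE -scalemxAr; set Fs := F _ _ => linz con.
have -> : s * enorm (z - alpha *: (B1 *m z)) =
    enorm ((s *: z - alpha *: Fs) + alpha *: (Fs - s *: (B1 *m z))).
  rewrite -[s in LHS]gtr0_norm// -enormZ; congr enorm.
  by rewrite !scalerBr addrA subrK !scalerA mulrC.
apply: le_trans (enormD _ _) _.
rewrite enormZ (gtr0_norm alpha0).
have : alpha * enorm (Fs - s *: (B1 *m z)) <=
  alpha * (S * (s * s `^ delta * enorm z `^ (1 + delta))) by rewrite ler_pM2l.
lra.
Qed.

End Drift.

Section LinearizationError.
Context {R : realType} {dx dy : nat}.
Variables (G : 'cV[R]_dx -> 'cV[R]_dy -> 'cV[R]_dy)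
  (H : 'cV[R]_dy -> 'cV[R]_dx) (ystar : 'cV[R]_dy).

(* The error |G(x,y) - G(H(y),y) - B2 (x - H(y))| is bounded both by a multiple
   of |x - H(y)| and superlinearly; the first bound serves when |y - ystar| is
   much larger than |x - H(y)|, the second one otherwise. *)
Lemma slow_linearization_error (B2 : 'M[R]_(dy, dx)) (B3 : 'M[R]_dy)
    (L S delta eps : R) :
  0 < eps -> 0 <= L -> 0 <= S -> 0 < delta <= 1 ->
  (forall x y, enorm (G x y - G (H y) y) <= L * enorm (x - H y)) ->
  (forall x y, enorm (G x y - B2 *m (x - H y) - B3 *m (y - ystar))
    <= S * (enorm (x - H y) `^ (1 + delta) + enorm (y - ystar) `^ (1 + delta))) ->
  exists2 C, 0 <= C & forall x y,
    enorm (y - ystar) * enorm (G x y - G (H y) y - B2 *m (x - H y))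
    <= eps * enorm (y - ystar) ^+ 2
       + C * enorm (x - H y) `^ (2 + 2 * delta).
Proof.
move=> eps0 L0 S0 /andP[delta0 delta1] lip lin.
have [b b0 B2b] := enorm_mulmx_le B2.
(* Threshold between the two regimes: q > K p forces (L + b) p <= eps q, while K >= 1 gives K^(1 +
   delta) <= K^2 in the other one. *)
pose K := (L + b) / eps + 1.
have K1 : 1 <= K by rewrite lerDr divr_ge0 ?addr_ge0// ltW.
pose D := S * (1 + 2 * K ^+ 2).
have D0 : 0 <= D by rewrite mulr_ge0// addr_ge0// mulr_ge0// sqr_ge0.
exists (D ^+ 2 / eps); first by rewrite divr_ge0 ?sqr_ge0// ltW.
move=> x y; set p := enorm (x - H y); set q := enorm (y - ystar).
set e := _ - _ - _.
have p0 : 0 <= p by exact: enorm_ge0.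
have q0 : 0 <= q by exact: enorm_ge0.
have [qp|qp] := lerP q (K * p).
  have eD : enorm e <= D * p `^ (1 + delta).
    have qle : q `^ (1 + delta) <= K ^+ 2 * p `^ (1 + delta).
      apply: le_trans (_ : (K * p) `^ (1 + delta) <= _).
        by rewrite ge0_ler_powR ?nnegrE ?addr_ge0// ?(ltW delta0)// (le_trans q0).
      rewrite powRM ?(le_trans _ K1)// ler_wpM2r ?powR_ge0//.
      rewrite -powR_mulrn ?(le_trans _ K1)// ler_powR//; lra.
    (* Linearizing at (H y, y) as well cancels the [B3] term. The two errors contain q^(1 + delta)
       twice, whence the 2 in [D]. *)
    have := lin x y; have := lin (H y) y; rewrite subrr enorm0 mulmx0 subr0.
    rewrite (@powR0 _ (1 + delta)) ?gt_eqF ?addr_gt0// add0r.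
    set e1 := G (H y) y - _; set e2 := G x y - _ - _ => le1 le2.
    have -> : e = e2 - e1.
      by rewrite /e /e1 /e2 opprB addrA subrK addrAC.
    apply: le_trans (enormB_le _ _) _.
    have : S * q `^ (1 + delta) <= S * (K ^+ 2 * p `^ (1 + delta)).
      by rewrite ler_wpM2l.
    rewrite -/p -/q in le1 le2 *; rewrite /D; lra.
  apply: le_trans (ler_wpM2l q0 eD) _.
  apply: le_trans (young11 _ _ eps0) _; rewrite lerD2l exprMn.
  have -> : (p `^ (1 + delta)) ^+ 2 = p `^ (2 + 2 * delta).
    by rewrite -powR_mulrn ?powR_ge0// -powRrM; congr (_ `^ _); ring.
  by rewrite mulrAC.
apply: ler_wpDr.
  by rewrite mulr_ge0 ?powR_ge0// divr_ge0 ?sqr_ge0// ltW.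
have eL : enorm e <= (L + b) * p.
  rewrite mulrDl; apply: le_trans (enormB_le _ _) _.
  by apply: lerD; [exact: lip | exact: B2b].
rewrite expr2 mulrCA; apply: ler_wpM2l => //.
apply: le_trans eL _.
have : eps * (K * p) <= eps * q by rewrite ler_pM2l// ltW.
have -> : eps * (K * p) = (L + b) * p + eps * p by rewrite /K; field; rewrite gt_eqF.
have : 0 <= eps * p by rewrite mulr_ge0// ltW.
lra.
Qed.

End LinearizationError.

(** * Moments of a noisy step *)

Section Moments.
Context {R : realType} {d : measure_display} {Omega : measurableType d}.
Variable P : probability Omega R.
Implicit Types f g : Omega -> R.

Definition L1 f := P.-integrable setT (EFin \o f).

Lemma L1_measurable f : L1 f -> measurable_fun setT f.
Proof. by move=> /measurable_int/measurable_EFinP. Qed.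

Lemma L1_le f g : measurable_fun setT f -> L1 g ->
  (forall w, `|f w| <= g w) -> L1 f.
Proof.
move=> mf Lg fg; apply: le_integrable Lg => //; first exact/measurable_EFinP.
by move=> w _ /=; rewrite lee_fin (le_trans (fg w))// ler_norm.
Qed.

Lemma L1_cst (c : R) : L1 (fun=> c).
Proof. exact: finite_measure_integrable_cst. Qed.

Lemma L1_add f g : L1 f -> L1 g -> L1 (fun w => f w + g w).
Proof. by move=> Lf Lg; exact: (integrableD measurableT Lf Lg). Qed.

Lemma L1_scale (c : R) f : L1 f -> L1 (fun w => c * f w).
Proof. by move=> Lf; exact: (integrableZl measurableT c Lf). Qed.

Lemma L1_sum (I : Type) (s : seq I) (f : I -> Omega -> R) :
  (forall i, L1 (f i)) -> L1 (fun w => \sum_(i <- s) f i w).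
Proof.
move=> Lf; elim: s => [|i s IH].
  by rewrite (_ : (fun w => _) = fun=> 0); [exact: L1_cst|apply/funext => w; rewrite big_nil].
rewrite (_ : (fun w => _) = fun w => f i w + \sum_(j <- s) f j w).
  exact: L1_add.
by apply/funext => w; rewrite big_cons.
Qed.

Lemma Ex_le f g : L1 f -> L1 g -> (forall w, f w <= g w) ->
  \int[P]_w f w <= \int[P]_w g w.
Proof. by move=> Lf Lg fg; exact: le_Rintegral. Qed.

Lemma Ex_add f g : L1 f -> L1 g ->
  \int[P]_w (f w + g w) = \int[P]_w f w + \int[P]_w g w.
Proof. by move=> Lf Lg; rewrite RintegralD. Qed.

Lemma Ex_scale (c : R) f : L1 f -> \int[P]_w (c * f w) = c * \int[P]_w f w.
Proof. by move=> Lf; rewrite RintegralZl. Qed.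

Lemma Ex_cst (c : R) : \int[P]_w c = c.
Proof. by rewrite Rintegral_cst// [X in c * fine X](probability_setT P) mulr1. Qed.

Lemma Ex_sum (I : Type) (s : seq I) (f : I -> Omega -> R) :
  (forall i, L1 (f i)) ->
  \int[P]_w (\sum_(i <- s) f i w) = \sum_(i <- s) \int[P]_w f i w.
Proof.
move=> Lf; elim: s => [|i s IH].
  rewrite big_nil -[RHS]Ex_cst; apply: eq_Rintegral => w _; exact: big_nil.
rewrite big_cons -IH -Ex_add//; last exact: L1_sum.
by apply: eq_Rintegral => w _; rewrite big_cons.
Qed.

Lemma normr_Ex_le f g : L1 f -> L1 g -> (forall w, `|f w| <= g w) ->
  `|\int[P]_w f w| <= \int[P]_w g w.
Proof.
move=> Lf Lg fg; rewrite ler_norml -mulN1r -Ex_scale//; apply/andP; split.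
  apply: Ex_le => //; first exact: L1_scale.
  by move=> w; have := fg w; rewrite ler_norml mulN1r => /andP[].
by apply: Ex_le => // w; have := fg w; rewrite ler_norml => /andP[].
Qed.

Context {d' : measure_display} {T : measurableType d'}.
Variable phi : Omega -> T.

(* Statements on conditional expectations given phi, tested against the functions
   U of phi. *)
Definition moment_control (N : Omega -> R) (Gam : R) :=
  forall U : T -> R, measurable_fun setT U -> (forall t, 0 <= U t) ->
  L1 (fun w => U (phi w)) -> L1 (fun w => U (phi w) * N w) /\
  \int[P]_w (U (phi w) * N w) <= Gam * \int[P]_w U (phi w).

Definition mean_zero n (xi : Omega -> 'cV[R]_n) :=
  forall (U : T -> R) i, measurable_fun setT U ->
  L1 (fun w => U (phi w) * xi w i 0) -> \int[P]_w (U (phi w) * xi w i 0) = 0.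

Hypothesis mphi : measurable_fun setT phi.

(** [mean_zero] asks for integrability of each coordinate product; the majorant [B (phi w) * N w]
    supplies it. *)
Lemma dot_mean_zero n (xi : Omega -> 'cV[R]_n) (N : Omega -> R) Gam
    (g : T -> 'cV[R]_n) (B : T -> R) :
  mean_zero xi -> coord_meas xi -> moment_control N Gam ->
  (forall w, enorm (xi w) <= N w) ->
  coord_meas g -> measurable_fun setT B -> (forall t, enorm (g t) <= B t) ->
  L1 (fun w => B (phi w)) ->
  L1 (fun w => dotv (g (phi w)) (xi w)) /\
  \int[P]_w dotv (g (phi w)) (xi w) = 0.
Proof.
move=> xi0 mxi Nc xiN mg mB gB LB.
have B0 t : 0 <= B t by apply: le_trans (gB t).
have [LBN _] := Nc _ mB B0 LB.
have Li i : L1 (fun w => g (phi w) i 0 * xi w i 0).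
  apply: L1_le LBN _ => [|w].
    by apply: measurable_funM; [exact: (measurableT_comp (mg i))|exact: mxi].
  rewrite normrM ler_pM// (le_trans (coord_le_enorm _ _))//.
split; first exact: L1_sum.
rewrite Ex_sum//; apply: big1 => i _.
exact: xi0 _ _ (mg i) (Li i).
Qed.

(* eta is the weight in Young's inequality that makes the noise cross terms cost
   at most eps a |u|^4. *)
Definition moment_const (eps C Gam : R) : R :=
  let eta := eps / ((4 * C + 8 * C ^+ 2 + 1) * (Gam + 1)) in
  (4 * C / eta ^+ 3 + 8 * C ^+ 2 / eta + 3 * C ^+ 4) * Gam.

(** [u] is known, [m] is centred noise, [r] a remainder of order a^(3/2). In [enormD_pow4] the term
    with [m] integrates to 0. Young's inequality absorbs the rest: |u|^3 a^(3/2) = a |u|^3 sqrt a <=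
    a (eta |u|^4 + a^2 / eta^3), and similarly for |u|^2 a^2. The exponent 3/2 of the remainder is
    what yields an error of order a^3. *)
Lemma fourth_moment_step n (eps C Gam a : R) (N : Omega -> R)
    (u : T -> 'cV[R]_n) (m r : Omega -> 'cV[R]_n) :
  0 < eps -> 0 <= C -> 0 <= Gam -> 0 < a <= 1 ->
  (forall w, 1 <= N w) -> moment_control (fun w => N w ^+ 4) Gam ->
  coord_meas u -> coord_meas m -> coord_meas r ->
  (forall w, enorm (m w + r w) <= C * a * N w) ->
  (forall w, enorm (r w) <= C * (a * Num.sqrt a) * N w ^+ 2) ->
  L1 (fun w => enorm (u (phi w)) ^+ 4) ->
  L1 (fun w => enorm (u (phi w)) ^+ 2 * dotv (u (phi w)) (m w)) ->
  \int[P]_w (enorm (u (phi w)) ^+ 2 * dotv (u (phi w)) (m w)) = 0 ->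
  L1 (fun w => enorm (u (phi w) + (m w + r w)) ^+ 4) /\
  \int[P]_w (enorm (u (phi w) + (m w + r w)) ^+ 4) <=
    (1 + eps * a) * \int[P]_w (enorm (u (phi w)) ^+ 4)
    + moment_const eps C Gam * a ^+ 3.
Proof.
move=> eps0 C0 Gam0 /andP[a0 a1] N1 Nc mu mm mr mrN rN Lu Lum Eum.
pose eta := eps / ((4 * C + 8 * C ^+ 2 + 1) * (Gam + 1)).
pose D := 4 * C + 8 * C ^+ 2.
pose K := 4 * C / eta ^+ 3 + 8 * C ^+ 2 / eta + 3 * C ^+ 4.
have D0 : 0 <= D by rewrite addr_ge0 ?mulr_ge0// sqr_ge0.
have eta0 : 0 < eta by rewrite divr_gt0// mulr_gt0 ?ltr_wpDl.
have K0 : 0 <= K.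
  by rewrite !addr_ge0// ?mulr_ge0 ?invr_ge0 ?exprn_ge0// ?(ltW eta0).
have pt w : enorm (u (phi w) + (m w + r w)) ^+ 4 <=
    enorm (u (phi w)) ^+ 4
    + (4 * (enorm (u (phi w)) ^+ 2 * dotv (u (phi w)) (m w))
    + ((a * eta * D) * (enorm (u (phi w)) ^+ 4 * N w ^+ 4)
    + (a ^+ 3 * K) * N w ^+ 4)).
  apply: le_trans (enormD_pow4 _ _) _; rewrite dotvDr mulrDr.
  have := normr_dotv_le (u (phi w)) (r w); rewrite ler_norml => /andP[_].
  have := rN w; have := mrN w; have := enorm_ge0 (u (phi w)); have := N1 w.
  have := enorm_ge0 (m w + r w); have := enorm_ge0 (r w).
  set p := enorm (u _); set n_ := N w; set s := dotv _ (r w).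
  set z := enorm (m w + r w); set rr := enorm (r w) => rr0 z0 n1 p0 zle rle sle.
  have n24 : n_ ^+ 2 <= n_ ^+ 4 by apply: ler_weXn2l.
  have n0 : 0 <= n_ by lra.
  have h1 : p ^+ 2 * s <= C * a * (eta * p ^+ 4 + a ^+ 2 / eta ^+ 3) * n_ ^+ 4.
    apply: le_trans (_ : p ^+ 2 * (p * (C * (a * Num.sqrt a) * n_ ^+ 2)) <= _).
      by rewrite ler_wpM2l ?sqr_ge0// (le_trans sle)// ler_wpM2l.
    have -> : p ^+ 2 * (p * (C * (a * Num.sqrt a) * n_ ^+ 2)) =
      C * a * (p ^+ 3 * Num.sqrt a) * n_ ^+ 2 by ring.
    have y := young31 eta0 p0 (sqrtr_ge0 a).
    have sq4 : Num.sqrt a ^+ 4 = a ^+ 2.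
      by rewrite -[4%N]/(2 * 2)%N exprM sqr_sqrtr// ltW.
    rewrite sq4 in y; apply: ler_pM => //.
    - by rewrite !mulr_ge0 ?sqrtr_ge0 ?exprn_ge0// ltW.
    - by rewrite sqr_ge0.
    - by rewrite ler_wpM2l// mulr_ge0// ltW.
  have h2 : p ^+ 2 * z ^+ 2 <= C ^+ 2 * a * (eta * p ^+ 4 + a ^+ 2 / eta) * n_ ^+ 4.
    apply: le_trans (_ : p ^+ 2 * (C * a * n_) ^+ 2 <= _).
      by rewrite ler_wpM2l ?sqr_ge0//; apply: lerXn2r; rewrite ?nnegrE ?(le_trans z0).
    have -> : p ^+ 2 * (C * a * n_) ^+ 2 = C ^+ 2 * a * (p ^+ 2 * a) * n_ ^+ 2 by ring.
    apply: ler_pM => //.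
    - by rewrite !mulr_ge0 ?exprn_ge0// ltW.
    - by rewrite sqr_ge0.
    - by rewrite ler_wpM2l ?young22// mulr_ge0 ?sqr_ge0// ltW.
  have h3 : z ^+ 4 <= C ^+ 4 * a ^+ 3 * n_ ^+ 4.
    apply: le_trans (_ : (C * a * n_) ^+ 4 <= _).
      by apply: lerXn2r; rewrite ?nnegrE ?(le_trans z0).
    rewrite !exprMn ler_wpM2r ?exprn_ge0// ler_wpM2l ?exprn_ge0//.
    by apply: ler_wiXn2l => //; rewrite ltW.
  rewrite /D /K; lra.
have mU4 : measurable_fun setT (fun t => enorm (u t) ^+ 4).
  by apply: measurable_funX; exact: coord_meas_enorm.
have [LuN EuN] := Nc _ mU4 (fun t => exprn_ge0 4 (enorm_ge0 (u t))) Lu.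
have [LN EN] := Nc (fun=> 1) (@measurable_cst _ _ _ _ _ _) (fun=> ler01) (L1_cst 1).
have NE : (fun w => 1 * N w ^+ 4) = (fun w => N w ^+ 4).
  by apply/funext => w; rewrite mul1r.
rewrite NE Ex_cst mulr1 in LN EN.
have L3 : L1 (fun w => (a * eta * D) * (enorm (u (phi w)) ^+ 4 * N w ^+ 4)
    + (a ^+ 3 * K) * N w ^+ 4).
  by apply: L1_add; exact: L1_scale.
have L2 : L1 (fun w => 4 * (enorm (u (phi w)) ^+ 2 * dotv (u (phi w)) (m w))
   + ((a * eta * D) * (enorm (u (phi w)) ^+ 4 * N w ^+ 4)
    + (a ^+ 3 * K) * N w ^+ 4)).
  by apply: L1_add => //; exact: L1_scale.
have L := L1_add Lu L2.
have mu' : coord_meas (u \o phi) by move=> i; exact: (measurableT_comp (mu i)).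
have Lres : L1 (fun w => enorm (u (phi w) + (m w + r w)) ^+ 4).
  apply: L1_le L _ => [|w]; last by rewrite ger0_norm ?exprn_ge0.
  apply: measurable_funX; apply: coord_meas_enorm.
  by do 2?[apply: coord_meas_D => //].
split => //; apply: le_trans (Ex_le Lres L pt) _.
rewrite Ex_add// Ex_add//; last exact: L1_scale.
rewrite Ex_scale// Eum mulr0 add0r Ex_add ?Ex_scale//; try exact: L1_scale.
have -> : moment_const eps C Gam = K * Gam by [].
have X0 : 0 <= \int[P]_w (enorm (u (phi w)) ^+ 4).
  by apply: Rintegral_ge0 => w _; rewrite exprn_ge0.
move: EuN EN X0.
set X := \int[P]_w (enorm (u (phi w)) ^+ 4).
set X' := \int[P]_w _; set M := \int[P]_w _ => EuN EN X0.
rewrite [X in _ <= X + _]mulrDl mul1r -addrA lerD2l; apply: lerD; last first.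
  by rewrite [leRHS]mulrC -mulrA ler_wpM2l ?exprn_ge0 ?(ltW a0)// ler_wpM2l.
apply: le_trans (ler_wpM2l _ EuN) _.
  by apply: mulr_ge0 => //; apply: mulr_ge0; exact: ltW.
rewrite mulrA ler_wpM2r//.
have -> : a * eta * D * Gam = (eta * D * Gam) * a by ring.
rewrite ler_wpM2r ?(ltW a0)//.
have den : 0 < (D + 1) * (Gam + 1) by rewrite mulr_gt0 ?ltr_wpDl.
have -> : eta * D * Gam = eps * (D * Gam) / ((D + 1) * (Gam + 1)).
  by rewrite /eta -/D; field; rewrite !gt_eqF ?ltr_wpDl.
rewrite ler_pdivrMr// ler_wpM2l ?(ltW eps0)//.
by apply: ler_pM => //; rewrite lerDl.
Qed.

End Moments.

(** * One step of the iteration *)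

Section JacobianTranspose.
Context {R : realType} {m n : nat}.
Variables (H : 'cV[R]_n -> 'cV[R]_m) (L S delta : R).
Hypothesis delta_gt0 : 0 < delta.
Hypothesis H_lip : forall y1 y2, enorm (H y1 - H y2) <= L * enorm (y1 - y2).
Hypothesis H_smooth : forall y1 y2 : 'cV[R]_n,
  enorm (H y1 - H y2 - 'd H y2 (y1 - y2)) <= S * enorm (y1 - y2) `^ (1 + delta).

(** The transposed Jacobian at y applied to a. It moves the Jacobian onto the known vector, so that
    [psi] stands alone in a scalar product and [mean_zero] applies. *)
Definition jacobian_tr (y : 'cV[R]_n) (a : 'cV[R]_m) : 'cV[R]_n :=
  \col_j \sum_i a i 0 * 'd H y (delta_mx j 0) i 0.

Lemma jacobian_sum (y v : 'cV[R]_n) i :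
  'd H y v i 0 = \sum_j v j 0 * 'd H y (delta_mx j 0) i 0.
Proof.
rewrite {1}(matrix_sum_delta v) linear_sum summxE; apply: eq_bigr => j _.
by rewrite big_ord1 linearZ mxE.
Qed.

Lemma dotv_jacobian (y v : 'cV[R]_n) (a : 'cV[R]_m) :
  dotv a ('d H y v) = dotv (jacobian_tr y a) v.
Proof.
rewrite /dotv.
under eq_bigr do rewrite jacobian_sum mulr_sumr.
rewrite exchange_big; apply: eq_bigr => j _; rewrite mxE mulr_suml.
by apply: eq_bigr => i _; rewrite mulrA mulrAC.
Qed.

Lemma jacobian_tr_le y a : enorm (jacobian_tr y a) <= L * (n * m)%:R * enorm a.
Proof.
apply: le_trans (enorm_le_sum _) _.
have -> : L * (n * m)%:R * enorm a = \sum_(j < n) \sum_(i < m) (L * enorm a).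
  by rewrite !sumr_const !card_ord -mulrnA mulnC mulrAC mulr_natr.
apply: ler_sum => j _; rewrite mxE; apply: le_trans (ler_norm_sum _ _ _) _.
apply: ler_sum => i _; rewrite normrM mulrC ler_pM ?coord_le_enorm//.
apply: le_trans (jacobian_bound delta_gt0 H_lip H_smooth _ _ _) _.
have -> : enorm (delta_mx j 0 : 'cV[R]_n) = 1; last by rewrite mulr1.
rewrite /enorm.
have -> : dotv (delta_mx j 0 : 'cV[R]_n) (delta_mx j 0) = 1; last exact: sqrtr1.
rewrite /dotv (bigD1 j)//= big1 => [|k kj].
  by rewrite !mxE !eqxx mulr1 addr0.
by rewrite !mxE (negbTE kj) mul0r.
Qed.

Context {d : measure_display} {T : measurableType d}.

Lemma jacobian_tr_measurable (Y : T -> 'cV[R]_n) (a : T -> 'cV[R]_m) :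
  coord_meas Y -> coord_meas a -> coord_meas (fun t => jacobian_tr (Y t) (a t)).
Proof.
move=> mY ma j; rewrite (_ : (fun t => _) =
    (fun t => \sum_i a t i 0 * 'd H (Y t) (delta_mx j 0) i 0)); last first.
  by apply/funext => t; rewrite mxE.
apply: measurable_sum => i; apply: measurable_funM; first exact: ma.
exact: (jacobian_measurable delta_gt0 H_lip H_smooth).
Qed.

Lemma jacobian_apply_measurable (Y V : T -> 'cV[R]_n) :
  coord_meas Y -> coord_meas V -> coord_meas (fun t => 'd H (Y t) (V t)).
Proof.
move=> mY mV i; rewrite (_ : (fun t => _) =
    (fun t => \sum_j V t j 0 * 'd H (Y t) (delta_mx j 0) i 0)); last first.
  by apply/funext => t; rewrite jacobian_sum.
apply: measurable_sum => j; apply: measurable_funM; first exact: mV.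
exact: (jacobian_measurable delta_gt0 H_lip H_smooth).
Qed.

End JacobianTranspose.

Section Step.
Context {R : realType} {d d' : measure_display}.
Context {Omega : measurableType d} {T : measurableType d'}.
Variable P : probability Omega R.
Variable phi : Omega -> T.
Hypothesis mphi : measurable_fun setT phi.
Context {dx dy : nat}.
Variables (F : 'cV[R]_dx -> 'cV[R]_dy -> 'cV[R]_dx)
  (G : 'cV[R]_dx -> 'cV[R]_dy -> 'cV[R]_dy)
  (H : 'cV[R]_dy -> 'cV[R]_dx) (ystar : 'cV[R]_dy)
  (LH LF LGx LGy muF muG SH deltaH : R).
Hypotheses (LH0 : 0 < LH) (LF0 : 0 < LF) (LGx0 : 0 < LGx) (LGy0 : 0 < LGy)
  (muF0 : 0 < muF) (muG0 : 0 < muG) (SH0 : 0 <= SH)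
  (deltaH_itv : 1 / 2 <= deltaH <= 1).
Hypothesis bF : borel_fun (fun z : 'cV[R]_dx * 'cV[R]_dy => F z.1 z.2).
Hypothesis bG : borel_fun (fun z : 'cV[R]_dx * 'cV[R]_dy => G z.1 z.2).
Hypothesis A1 : assumption_A1 LH LF F H.
Hypothesis A2 : assumption_A2 LGx LGy G H ystar.
Hypothesis A3 : assumption_A3 muF muG F G H ystar.
Hypothesis A4 : assumption_A4 SH deltaH H.
Variables alpha beta : R.
Hypotheses (alpha0 : 0 < alpha) (beta0 : 0 < beta) (alpha1 : alpha <= 1)
  (beta_alpha : beta <= alpha).
Hypotheses (alphaLF : alpha * LF ^+ 2 <= muF) (alpha_muF : alpha * muF <= 1)
  (betaLGy : beta * LGy ^+ 2 <= muG) (beta_muG : beta * muG <= 1)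
  (betaLH : beta * (LH * LGx) <= alpha * muF / 4).
Variables (x : T -> 'cV[R]_dx) (y : T -> 'cV[R]_dy)
  (xi : Omega -> 'cV[R]_dx) (psi : Omega -> 'cV[R]_dy).
Hypotheses (mx : coord_meas x) (my : coord_meas y)
  (mxi : coord_meas xi) (mpsi : coord_meas psi).

(** The summand 1 makes all powers of [N] up to the fourth at most [N w ^+ 4], whose conditional
    mean is controlled by [Gam]. *)
Let N w := 1 + enorm (xi w) + enorm (psi w).
Variable Gam : R.
Hypothesis Gam0 : 0 <= Gam.
Hypothesis Nc : moment_control P phi (fun w => N w ^+ 4) Gam.
Hypotheses (xi0 : mean_zero P phi xi) (psi0 : mean_zero P phi psi).

Local Notation L1 := (L1 P).

Let deltaH0 : 0 < deltaH. Proof. by move: deltaH_itv => /andP[]; lra. Qed.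
Let beta1 : beta <= 1. Proof. exact: le_trans beta_alpha alpha1. Qed.

Let N1 w : 1 <= N w. Proof. by rewrite /N -addrA lerDl addr_ge0. Qed.
Let xiN w : enorm (xi w) <= N w.
Proof. by have := enorm_ge0 (psi w); rewrite /N; lra. Qed.
Let psiN w : enorm (psi w) <= N w.
Proof. by have := enorm_ge0 (xi w); rewrite /N; lra. Qed.
Let N0 w : 0 <= N w. Proof. by rewrite (le_trans _ (N1 w)). Qed.
Let NX k w : (1 <= k <= 4)%N -> N w <= N w ^+ k <= N w ^+ 4.
Proof.
by move=> /andP[k1 k4]; rewrite (ler_weXn2l _ k4)// andbT -{1}[N w]expr1 ler_weXn2l.
Qed.

Let xh t := x t - H (y t).
Let yh t := y t - ystar.
Let p t := enorm (xh t).
Let q t := enorm (yh t).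
Let y' t := y t - beta *: G (x t) (y t).
Let u t := fast_drift F G H alpha beta (x t) (y t).
Let v t := slow_drift G ystar beta (x t) (y t).

Definition next_x w := x (phi w) - alpha *: (F (x (phi w)) (y (phi w)) + xi w).
Definition next_y w := y (phi w) - beta *: (G (x (phi w)) (y (phi w)) + psi w).
Definition next_xh w := next_x w - H (next_y w).
Definition next_yh w := next_y w - ystar.

(** The noise enters the new fast error through - alpha xi and H(y') - H(y' - beta psi). [m] is its
    part linear in the noise, with the Jacobian at the known point y'; [r] is the Taylor remainder
    of H. *)
Let m w := (- alpha) *: xi w + beta *: 'd H (y' (phi w)) (psi w).
Let r w := H (y' (phi w)) - H (y' (phi w) - beta *: psi w)
           - beta *: 'd H (y' (phi w)) (psi w).

Let next_yE w : next_y w = y' (phi w) - beta *: psi w.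
Proof. by rewrite /next_y /y' scalerDr opprD addrA. Qed.

Let next_xhE w : next_xh w = u (phi w) + (m w + r w).
Proof.
rewrite /next_xh next_yE /u /fast_drift /m /r -/(y' (phi w)) /next_x.
apply/matrixP => i j; rewrite !mxE; ring.
Qed.

Let next_yhE w : next_yh w = v (phi w) + ((- beta) *: psi w + 0).
Proof.
rewrite /next_yh next_yE /v /slow_drift /y'.
apply/matrixP => i j; rewrite !mxE; ring.
Qed.

Let H_lip y1 y2 : enorm (H y1 - H y2) <= LH * enorm (y1 - y2).
Proof. by have [_ h _] := A1. Qed.
Let H_smooth := proj2 A4.

Let mH d0 (T0 : measurableType d0) (Y : T0 -> 'cV[R]_dy) :
  coord_meas Y -> coord_meas (fun t => H (Y t)).
Proof.
move=> mY; apply/borel_meas_coord/(borel_meas_comp (coord_meas_borel mY)).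
by apply: continuous_borel_fun; exact: lipschitz_continuous H_lip.
Qed.

Let mF : coord_meas (fun t => F (x t) (y t)). Proof. exact: coord_meas_map2. Qed.
Let mG : coord_meas (fun t => G (x t) (y t)). Proof. exact: coord_meas_map2. Qed.

Let my' : coord_meas y'.
Proof. by apply: coord_meas_B => //; exact: coord_meas_Z. Qed.

Let mxh : coord_meas xh. Proof. by apply: coord_meas_B => //; exact: mH. Qed.
Let myh : coord_meas yh.
Proof. by apply: coord_meas_B => //; exact: coord_meas_cst. Qed.

Let mu_ : coord_meas u.
Proof.
apply: coord_meas_D; first by apply: coord_meas_B => //; exact: coord_meas_Z.
by apply: coord_meas_B; exact: mH.
Qed.

Let mv : coord_meas v.
Proof. by apply: coord_meas_B => //; exact: coord_meas_Z. Qed.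

Let mcomp n (X : T -> 'cV[R]_n) : coord_meas X -> coord_meas (fun w => X (phi w)).
Proof. by move=> mX i; exact: (measurableT_comp (mX i)). Qed.

Let mm : coord_meas m.
Proof.
apply: coord_meas_D; apply: coord_meas_Z => //.
by apply: (jacobian_apply_measurable deltaH0 H_lip H_smooth _ mpsi); exact: mcomp.
Qed.

Let mr : coord_meas r.
Proof.
apply: coord_meas_B; last first.
  apply: coord_meas_Z.
  by apply: (jacobian_apply_measurable deltaH0 H_lip H_smooth _ mpsi); exact: mcomp.
apply: coord_meas_B; apply: mH; first exact: mcomp.
by apply: coord_meas_B; [exact: mcomp|exact: coord_meas_Z].
Qed.

Lemma next_meas : coord_meas next_xh /\ coord_meas next_yh.
Proof.
split.
  rewrite (_ : next_xh = fun w => u (phi w) + (m w + r w)).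
    by apply: coord_meas_D; [exact: mcomp|exact: coord_meas_D].
  by apply/funext.
rewrite (_ : next_yh = fun w => v (phi w) + ((- beta) *: psi w + 0)).
  apply: coord_meas_D; first exact: mcomp.
  by apply: coord_meas_D; [exact: coord_meas_Z|exact: coord_meas_cst].
exact/funext/next_yhE.
Qed.

Let mr_le w : enorm (m w + r w) <= (1 + LH) * alpha * N w.
Proof.
have -> : m w + r w = (- alpha) *: xi w
    + (H (y' (phi w)) - H (y' (phi w) - beta *: psi w)).
  by rewrite /m /r -addrA; congr (_ + _); rewrite addrC subrK.
apply: le_trans (enormD _ _) _; rewrite enormZ normrN gtr0_norm//.
have : enorm (H (y' (phi w)) - H (y' (phi w) - beta *: psi w))
    <= LH * (alpha * N w).
  apply: le_trans (H_lip _ _) _; rewrite subKr enormZ gtr0_norm//.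
  by rewrite ler_pM2l// ler_pM// ltW.
have : alpha * enorm (xi w) <= alpha * N w by rewrite ler_pM2l.
lra.
Qed.

(* As beta <= 1, the Hoelder exponent deltaH of the Jacobian may be lowered to
   1/2; the remainder then contributes the admissible order alpha^3 to the fourth
   moment. *)
Let r_le w : enorm (r w) <= SH * (beta * Num.sqrt beta) * N w ^+ 2.
Proof.
have -> : r w = - (H (y' (phi w) - beta *: psi w) - H (y' (phi w))
    - 'd H (y' (phi w)) ((y' (phi w) - beta *: psi w) - y' (phi w))).
  rewrite /r; have -> : y' (phi w) - beta *: psi w - y' (phi w) = (- beta) *: psi w.
    by rewrite addrAC subrr add0r scaleNr.
  rewrite [X in - (_ - X)]linearZ/=; set D := 'd H _ _.
  by apply/matrixP => i j; rewrite !mxE; ring.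
rewrite enormN; apply: le_trans (H_smooth _ _) _; rewrite -mulrA ler_wpM2l//.
rewrite addrAC subrr add0r enormN enormZ gtr0_norm//.
rewrite powRM ?(ltW beta0)//; apply: ler_pM; rewrite ?powR_ge0//.
  have -> : beta * Num.sqrt beta = beta `^ (1 + 2^-1).
    rewrite powRD ?(gt_eqF beta0) ?implybT// powRr1 ?(ltW beta0)//.
    by rewrite powR12_sqrt// ltW.
  apply: ger_powR; first by rewrite beta0.
  by move: deltaH_itv => /andP[]; lra.
have d2 : 0 <= 1 + deltaH by rewrite addr_ge0// ltW.
apply: le_trans (_ : N w `^ (1 + deltaH) <= _).
  by rewrite ge0_ler_powR ?nnegrE.
rewrite -powR_mulrn// ler_powR//.
by move: deltaH_itv => /andP[]; lra.
Qed.

Let r_le' w : enorm (r w) <= SH * (alpha * Num.sqrt alpha) * N w ^+ 2.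
Proof.
apply: le_trans (r_le w) _; rewrite ler_wpM2r ?sqr_ge0// ler_wpM2l//.
by apply: ler_pM; rewrite ?sqrtr_ge0 ?(ltW beta0)// ler_wsqrtr.
Qed.

Let noise_mean0 (g1 : T -> 'cV[R]_dx) (g2 : T -> 'cV[R]_dy) (B : T -> R) :
  coord_meas g1 -> coord_meas g2 -> measurable_fun setT B ->
  (forall t, enorm (g1 t) <= B t) -> (forall t, enorm (g2 t) <= B t) ->
  L1 (fun w => B (phi w)) ->
  L1 (fun w => dotv (g1 (phi w)) (xi w) + dotv (g2 (phi w)) (psi w)) /\
  \int[P]_w (dotv (g1 (phi w)) (xi w) + dotv (g2 (phi w)) (psi w)) = 0.
Proof.
move=> mg1 mg2 mB g1B g2B LB.
have N4 w : N w <= N w ^+ 4 by have /andP[] := @NX 4 w isT.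
have [La Ea] := dot_mean_zero mphi xi0 mxi Nc (fun w => le_trans (xiN w) (N4 w))
   mg1 mB g1B LB.
have [Lb Eb] := dot_mean_zero mphi psi0 mpsi Nc (fun w => le_trans (psiN w) (N4 w))
   mg2 mB g2B LB.
by split; [exact: L1_add|rewrite Ex_add// Ea Eb addr0].
Qed.

Let mtr (g : T -> 'cV[R]_dx) : coord_meas g ->
  coord_meas (fun t => jacobian_tr H (y' t) (g t)).
Proof. by move=> mg; exact: (jacobian_tr_measurable deltaH0 H_lip H_smooth). Qed.

Let dot_m w (g : 'cV[R]_dx) : dotv g (m w) =
  dotv ((- alpha) *: g) (xi w) + dotv (beta *: jacobian_tr H (y' (phi w)) g) (psi w).
Proof. by rewrite /m dotvDr !dotvZr dotv_jacobian !dotvZl. Qed.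

Let CJ := 1 + LH * (dy * dx)%:R.
Let CJ1 : 1 <= CJ. Proof. by rewrite lerDl mulr_ge0// ltW. Qed.

Let jac_le t g : enorm (beta *: jacobian_tr H (y' t) g) <= CJ * enorm g.
Proof.
rewrite enormZ gtr0_norm//.
apply: le_trans (_ : 1 * (LH * (dy * dx)%:R * enorm g) <= _).
  by apply: ler_pM => //; rewrite ?(ltW beta0)//; exact: (jacobian_tr_le deltaH0 H_lip H_smooth).
by rewrite mul1r ler_wpM2r// lerDr.
Qed.

Let xi_le (g : 'cV[R]_dx) : enorm ((- alpha) *: g) <= CJ * enorm g.
Proof.
by rewrite enormZ normrN gtr0_norm// ler_wpM2r// (le_trans alpha1).
Qed.

Let m_mean0 (g : T -> 'cV[R]_dx) (B : T -> R) : coord_meas g ->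
  measurable_fun setT B -> (forall t, enorm (g t) <= B t) ->
  L1 (fun w => B (phi w)) ->
  L1 (fun w => dotv (g (phi w)) (m w)) /\ \int[P]_w dotv (g (phi w)) (m w) = 0.
Proof.
move=> mg mB gB LB.
have E : (fun w => dotv (g (phi w)) (m w)) = (fun w =>
   dotv ((fun t => (- alpha) *: g t) (phi w)) (xi w)
   + dotv ((fun t => beta *: jacobian_tr H (y' t) (g t)) (phi w)) (psi w)).
  by apply/funext => w; rewrite dot_m.
rewrite E; apply: (@noise_mean0 (fun t => (- alpha) *: g t)
  (fun t => beta *: jacobian_tr H (y' t) (g t)) (fun t => CJ * B t)).
- exact: coord_meas_Z.
- by apply: coord_meas_Z; exact: mtr.
- exact: measurable_funM.
- by move=> t; apply: le_trans (xi_le _) _; rewrite ler_wpM2l// (le_trans _ CJ1).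
- by move=> t; apply: le_trans (jac_le _ _) _; rewrite ler_wpM2l// (le_trans _ CJ1).
- exact: L1_scale.
Qed.

Let pow3_le (s : R) : 0 <= s -> s ^+ 2 * s <= 1 + s ^+ 4.
Proof.
move=> s0; have [s1|s1] := lerP s 1.
  rewrite -exprSr (le_trans (exprn_ile1 _ s0 s1))// lerDl exprn_ge0//.
by rewrite -exprSr; apply: ler_wpDl => //; apply: ler_weXn2l => //; exact: ltW.
Qed.

Let bound_meas n (X : T -> 'cV[R]_n) k : coord_meas X ->
  measurable_fun setT (fun t => enorm (X t) ^+ k).
Proof. by move=> mX; apply: measurable_funX; exact: coord_meas_enorm. Qed.

Let mq k : measurable_fun setT (fun t => q t ^+ k). Proof. exact: bound_meas. Qed.

Let u4 t := fast_drift_pow4 LH0 LF0 LGy0 muF0 A1 A2 A3 alpha0 beta0 alphaLF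
  alpha_muF betaLH (x t) (y t).
Let v4 t := slow_drift_pow4 LGx0 LGy0 muG0 A2 A3 beta0 betaLGy beta_muG
  (x t) (y t).

(** * One-step inequalities for the fourth moments *)

Section FourthMoments.
Hypotheses (Lp : L1 (fun w => p (phi w) ^+ 4)) (Lq : L1 (fun w => q (phi w) ^+ 4)).

Let Lu : L1 (fun w => enorm (u (phi w)) ^+ 4).
Proof.
apply: (@L1_le _ _ _ _ _ (fun w => (1 - alpha * muF / 4) * p (phi w) ^+ 4
  + 64 * (LH * LGy) ^+ 4 / muF ^+ 3 * (beta ^+ 4 / alpha ^+ 3) * q (phi w) ^+ 4)).
- exact: (measurableT_comp (bound_meas 4 mu_) mphi).
- by apply: L1_add; exact: L1_scale.
- move=> w; rewrite ger0_norm ?exprn_ge0//.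
  exact: u4.
Qed.

Let Lv : L1 (fun w => enorm (v (phi w)) ^+ 4).
Proof.
apply: (@L1_le _ _ _ _ _ (fun w => (1 - beta * muG / 2) * q (phi w) ^+ 4
  + 8 * LGx ^+ 4 / muG ^+ 3 * beta * p (phi w) ^+ 4)).
- exact: (measurableT_comp (bound_meas 4 mv) mphi).
- by apply: L1_add; exact: L1_scale.
- move=> w; rewrite ger0_norm ?exprn_ge0//.
  exact: v4.
Qed.

(** Young's inequality is weighted to cost muF / 8, half of the drift contraction: with s = alpha
    muF / 8, (1 + s)(1 - 2 s) <= 1 - s. The coupling picks up a factor 1 + s <= 2, so 128 = 2 *
    64. *)
Lemma fast_fourth_step :
  L1 (fun w => enorm (next_xh w) ^+ 4) /\
  \int[P]_w (enorm (next_xh w) ^+ 4) <=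
    (1 - alpha * muF / 8) * \int[P]_w (p (phi w) ^+ 4)
    + 128 * (LH * LGy) ^+ 4 / muF ^+ 3 * (beta ^+ 4 / alpha ^+ 3)
      * \int[P]_w (q (phi w) ^+ 4)
    + moment_const (muF / 8) (1 + LH + SH) Gam * alpha ^+ 3.
Proof.
have E : (fun w => dotv ((fun t => enorm (u t) ^+ 2 *: u t) (phi w)) (m w)) =
    (fun w => enorm (u (phi w)) ^+ 2 * dotv (u (phi w)) (m w)).
  by apply/funext => w; rewrite dotvZl.
have mu2 : coord_meas (fun t => enorm (u t) ^+ 2 *: u t).
  move=> i; rewrite (_ : (fun t => _) = (fun t => enorm (u t) ^+ 2 * u t i 0)).
    by apply: measurable_funM; [exact: bound_meas|exact: mu_].
  by apply/funext => t; rewrite mxE.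
have mB : measurable_fun setT (fun t => 1 + enorm (u t) ^+ 4).
  by apply: measurable_funD => //; exact: bound_meas.
have uB t : enorm (enorm (u t) ^+ 2 *: u t) <= 1 + enorm (u t) ^+ 4.
  by rewrite enormZ ger0_norm ?sqr_ge0//; exact: pow3_le.
have := m_mean0 mu2 mB uB (L1_add (L1_cst P 1) Lu); rewrite E => -[Lum Eum].
have C0 : 0 <= 1 + LH + SH by rewrite !addr_ge0// ltW.
have mr1 w : enorm (m w + r w) <= (1 + LH + SH) * alpha * N w.
  apply: le_trans (mr_le w) _; rewrite !ler_wpM2r// ?(ltW alpha0)//.
  by rewrite lerDl.
have r1 w : enorm (r w) <= (1 + LH + SH) * (alpha * Num.sqrt alpha) * N w ^+ 2.
  apply: le_trans (r_le' w) _; rewrite ler_wpM2r ?sqr_ge0// ler_wpM2r//.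
    by rewrite mulr_ge0 ?sqrtr_ge0// ltW.
  by rewrite lerDr addr_ge0// ltW.
have e0 : 0 < muF / 8 by rewrite divr_gt0.
have a01 : 0 < alpha <= 1 by rewrite alpha0.
have [L Eb] := fourth_moment_step mphi e0 C0 Gam0 a01 N1 Nc mu_ mm mr mr1 r1 Lu Lum Eum.
have -> : next_xh = (fun w => u (phi w) + (m w + r w)) by apply/funext.
split => //; apply: le_trans Eb _; rewrite lerD2r.
have Lb := L1_add (L1_scale (1 - alpha * muF / 4) Lp)
   (L1_scale (64 * (LH * LGy) ^+ 4 / muF ^+ 3 * (beta ^+ 4 / alpha ^+ 3)) Lq).
have := Ex_le Lu Lb (fun w => u4 (phi w)).
rewrite Ex_add; try exact: L1_scale.
rewrite !Ex_scale//.
have := @Rintegral_ge0 _ _ _ P setT (fun w => p (phi w) ^+ 4)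
  (fun w _ => exprn_ge0 4 (enorm_ge0 _)).
have := @Rintegral_ge0 _ _ _ P setT (fun w => q (phi w) ^+ 4)
  (fun w _ => exprn_ge0 4 (enorm_ge0 _)).
set X := \int[P]_w p (phi w) ^+ 4; set Y := \int[P]_w q (phi w) ^+ 4.
set U := \int[P]_w _; set K := _ / alpha ^+ 3; set K1 := (LH * LGy) ^+ 4 => Y0 X0 UXY.
have K0 : 0 <= 64 * K1 / muF ^+ 3 * K * Y.
  by rewrite !mulr_ge0 ?exprn_ge0 ?invr_ge0 ?exprn_ge0 ?mulr_ge0// ltW.
have am0 : 0 < alpha * muF by rewrite mulr_gt0.
apply: le_trans (ler_wpM2l _ UXY) _; first by rewrite addr_ge0// mulr_ge0// ltW.
have -> : 128 * K1 / muF ^+ 3 * K * Y = 2 * (64 * K1 / muF ^+ 3 * K * Y) by ring.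
move: K0; set Z := 64 * _ / _ * _ * Y => Z0.
have h1 : 0 <= (1 - alpha * muF / 8) * Z.
  by apply: mulr_ge0 => //; move: alpha_muF; lra.
have h2 : 0 <= (alpha * muF) ^+ 2 * X by rewrite mulr_ge0 ?sqr_ge0.
lra.
Qed.

(** The noise - beta psi is linear, so the remainder is 0 and C = 1. Young's inequality costs muG /
    4, half of the drift contraction, and 16 = 2 * 8. *)
Lemma slow_fourth_step :
  L1 (fun w => enorm (next_yh w) ^+ 4) /\
  \int[P]_w (enorm (next_yh w) ^+ 4) <=
    (1 - beta * muG / 4) * \int[P]_w (q (phi w) ^+ 4)
    + 16 * LGx ^+ 4 / muG ^+ 3 * beta * \int[P]_w (p (phi w) ^+ 4)
    + moment_const (muG / 4) 1 Gam * beta ^+ 3.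
Proof.
have E : (fun w => dotv ((fun=> 0 : 'cV[R]_dx) (phi w)) (xi w)
     + dotv ((fun t => (- beta) *: (enorm (v t) ^+ 2 *: v t)) (phi w)) (psi w)) =
    (fun w => enorm (v (phi w)) ^+ 2 * dotv (v (phi w)) ((- beta) *: psi w)).
  by apply/funext => w; rewrite dotv0l add0r !dotvZl dotvZr mulrCA.
have mu2 : coord_meas (fun t => (- beta) *: (enorm (v t) ^+ 2 *: v t)).
  apply: coord_meas_Z => i.
  rewrite (_ : (fun t => _) = (fun t => enorm (v t) ^+ 2 * v t i 0)).
    by apply: measurable_funM; [exact: bound_meas|exact: mv].
  by apply/funext => t; rewrite mxE.
have mB : measurable_fun setT (fun t => 1 + enorm (v t) ^+ 4).
  by apply: measurable_funD => //; exact: bound_meas.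
have vB t : enorm ((- beta) *: (enorm (v t) ^+ 2 *: v t)) <= 1 + enorm (v t) ^+ 4.
  rewrite enormZ normrN gtr0_norm// -[leRHS]mul1r; apply: ler_pM => //.
    exact: ltW.
  by rewrite enormZ ger0_norm ?sqr_ge0//; exact: pow3_le.
have zB (t : T) : enorm (0 : 'cV[R]_dx) <= 1 + enorm (v t) ^+ 4.
  by rewrite enorm0 addr_ge0// exprn_ge0.
have := noise_mean0 (coord_meas_cst (0 : 'cV[R]_dx)) mu2 mB zB vB
  (L1_add (L1_cst P 1) Lv); rewrite E => -[Lvm Evm].
have mr1 w : enorm ((- beta) *: psi w + 0) <= 1 * beta * N w.
  by rewrite addr0 enormZ normrN gtr0_norm// mul1r ler_pM2l.
have r1 w : enorm (0 : 'cV[R]_dy) <= 1 * (beta * Num.sqrt beta) * N w ^+ 2.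
  by rewrite enorm0 mulr_ge0 ?sqr_ge0// mul1r mulr_ge0 ?sqrtr_ge0// ltW.
have e0 : 0 < muG / 4 by rewrite divr_gt0.
have b01 : 0 < beta <= 1 by rewrite beta0.
have [L Eb] := fourth_moment_step mphi e0 ler01 Gam0 b01 N1 Nc mv
  (coord_meas_Z (- beta) mpsi) (coord_meas_cst 0) mr1 r1 Lv Lvm Evm.
have -> : next_yh = (fun w => v (phi w) + ((- beta) *: psi w + 0)).
  exact/funext/next_yhE.
split => //; apply: le_trans Eb _; rewrite lerD2r.
have Lb := L1_add (L1_scale (1 - beta * muG / 2) Lq)
   (L1_scale (8 * LGx ^+ 4 / muG ^+ 3 * beta) Lp).
have := Ex_le Lv Lb (fun w => v4 (phi w)).
rewrite Ex_add; try exact: L1_scale.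
rewrite !Ex_scale//.
have := @Rintegral_ge0 _ _ _ P setT (fun w => p (phi w) ^+ 4)
  (fun w _ => exprn_ge0 4 (enorm_ge0 _)).
have := @Rintegral_ge0 _ _ _ P setT (fun w => q (phi w) ^+ 4)
  (fun w _ => exprn_ge0 4 (enorm_ge0 _)).
set X := \int[P]_w p (phi w) ^+ 4; set Y := \int[P]_w q (phi w) ^+ 4.
set U := \int[P]_w _ => Y0 X0 UXY.
have K0 : 0 <= 8 * LGx ^+ 4 / muG ^+ 3 * beta * X.
  by rewrite !mulr_ge0 ?exprn_ge0 ?invr_ge0 ?exprn_ge0// ltW.
have am0 : 0 < beta * muG by rewrite mulr_gt0.
apply: le_trans (ler_wpM2l _ UXY) _; first by rewrite addr_ge0// mulr_ge0// ltW.
have -> : 16 * LGx ^+ 4 / muG ^+ 3 * beta * X =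
  2 * (8 * LGx ^+ 4 / muG ^+ 3 * beta * X) by ring.
move: K0; set Z := 8 * _ / _ * _ * X => Z0.
have h1 : 0 <= (1 - beta * muG / 4) * Z.
  by apply: mulr_ge0 => //; move: beta_muG; lra.
have h2 : 0 <= (beta * muG) ^+ 2 * Y by rewrite mulr_ge0 ?sqr_ge0.
lra.
Qed.

End FourthMoments.

(** * One-step inequalities for second-order quantities, given the majorant Q of the fourth
    powers *)

Section SecondMoments.
Variables (Q : T -> R) (M : R).
Hypotheses (mQ : measurable_fun setT Q) (Q1 : forall t, 1 <= Q t)
  (LQ : L1 (fun w => Q (phi w))) (QM : \int[P]_w Q (phi w) <= M)
  (pqQ : forall t, p t ^+ 4 + q t ^+ 4 <= alpha ^+ 2 * Q t).

Let p2 t : p t ^+ 2 <= alpha * Q t.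
Proof.
apply: sqr_le_moment => //; first exact: enorm_ge0.
by apply: le_trans (pqQ t); rewrite lerDl exprn_ge0// enorm_ge0.
Qed.

Let q2 t : q t ^+ 2 <= alpha * Q t.
Proof.
apply: sqr_le_moment => //; first exact: enorm_ge0.
by apply: le_trans (pqQ t); rewrite lerDr exprn_ge0// enorm_ge0.
Qed.

Let p0 t : 0 <= p t. Proof. exact: enorm_ge0. Qed.
Let q0 t : 0 <= q t. Proof. exact: enorm_ge0. Qed.
Let Q0 t : 0 <= Q t. Proof. exact: le_trans (Q1 t). Qed.

Let le_of_sqr (s Qt : R) : 0 <= s -> 1 <= Qt -> s ^+ 2 <= alpha * Qt -> s <= Qt.
Proof.
move=> s0 Qt1 sQ; have [s1|s1] := lerP s 1; first exact: le_trans Qt1.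
apply: le_trans (_ : s ^+ 2 <= _); first by rewrite expr2 ler_peMl// ltW.
by apply: le_trans sQ _; rewrite ler_piMl// (le_trans _ Qt1).
Qed.

Let pQ t : p t <= Q t. Proof. exact: le_of_sqr. Qed.
Let qQ t : q t <= Q t. Proof. exact: le_of_sqr. Qed.
Let pq t : p t * q t <= alpha * Q t.
Proof.
have := sqr_ge0 (p t - q t); have := p2 t; have := q2 t.
rewrite sqrrB; lra.
Qed.

Let sqrt_le t (s : R) : 0 <= s -> s ^+ 2 <= alpha * Q t ->
  Num.sqrt alpha * s <= alpha * Q t.
Proof.
move=> s0 sQ; have := sqr_ge0 (Num.sqrt alpha - s).
rewrite sqrrB sqr_sqrtr ?(ltW alpha0)//.
have : alpha <= alpha * Q t by rewrite ler_peMr// ltW.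
lra.
Qed.

Let LQN : L1 (fun w => Q (phi w) * N w ^+ 4).
Proof. by have [] := Nc mQ Q0 LQ. Qed.

Let EQN : \int[P]_w (Q (phi w) * N w ^+ 4) <= Gam * M.
Proof.
have [_ h] := Nc mQ Q0 LQ; apply: le_trans h _; exact: ler_wpM2l.
Qed.

Let u_le t : enorm (u t) <= p t + LH * LGy * q t.
Proof.
have := fast_drift_le LH0 LF0 A1 A2 A3 alpha0 beta0 alphaLF alpha_muF betaLH (x t) (y t).
move/le_trans; apply; apply: lerD.
  by rewrite ler_piMl// gerBl divr_ge0// mulr_ge0// ltW.
by rewrite ler_wpM2r// ler_piMl// mulr_ge0// ltW.
Qed.

Let v_le t : enorm (v t) <= q t + LGx * p t.
Proof.
have := slow_drift_le LGy0 A2 A3 beta0 betaLGy beta_muG (x t) (y t).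
move/le_trans; apply; apply: lerD.
  by rewrite ler_piMl// gerBl divr_ge0// mulr_ge0// ltW.
by rewrite ler_wpM2r// ler_piMl// ltW.
Qed.

Let uQ t : enorm (u t) <= (1 + LH * LGy) * Q t.
Proof.
apply: le_trans (u_le t) _; rewrite mulrDl mul1r; apply: lerD => //.
by rewrite ler_wpM2l// mulr_ge0// ltW.
Qed.

Let vQ t : enorm (v t) <= (1 + LGx) * Q t.
Proof.
apply: le_trans (v_le t) _; rewrite mulrDl mul1r; apply: lerD => //.
by rewrite ler_wpM2l// ltW.
Qed.

Let Lprod i j : L1 (fun w => xh (phi w) i 0 * yh (phi w) j 0).
Proof.
apply: (@L1_le _ _ _ _ _ (fun w => alpha * Q (phi w))).
- by apply: measurable_funM; [exact: mcomp mxh i|exact: mcomp myh j].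
- exact: L1_scale.
- move=> w; rewrite normrM; apply: le_trans (pq _).
  by apply: ler_pM; rewrite ?normr_ge0 ?coord_le_enorm.
Qed.

(** * The cross moment of the two errors *)

Section Cross.
Variables (B1 : 'M[R]_dx) (Ce : R).
Hypothesis Ce0 : 0 <= Ce.
Hypothesis eF : forall t,
  q t * enorm (F (x t) (y t) - B1 *m xh t) <= Ce * beta * Q t.
Hypothesis B1con : forall z, enorm (z - alpha *: (B1 *m z))
  <= (1 - alpha * muF / 2) * enorm z.

Let e t := F (x t) (y t) - B1 *m xh t.
Let l t := H (y t) - H (y' t).

Let me : coord_meas e.
Proof.
apply: coord_meas_B => // i; rewrite (_ : (fun t => _) =
   (fun t => \sum_j B1 i j * xh t j 0)); last by apply/funext => t; rewrite mxE.
by apply: measurable_sum => j; apply: measurable_funM => //; exact: mxh.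
Qed.

Let ml : coord_meas l.
Proof. by apply: coord_meas_B; exact: mH. Qed.

(** What is left of the product of the new errors without (I - alpha B1) x' y'^T and the two centred
    products: linearization error, lag, slow drift, Taylor remainder of H, product of noises. Each
    is of order alpha beta. *)
Let Rm i j w :=
  (- alpha) * (e (phi w) i 0 * yh (phi w) j 0)
  + (l (phi w) i 0 * yh (phi w) j 0
  + ((- beta) * (u (phi w) i 0 * G (x (phi w)) (y (phi w)) j 0)
  + (r w i 0 * v (phi w) j 0 + (- beta) * ((m w + r w) i 0 * psi w j 0)))).

(** The five summands bound the five terms of [Rm], in the same order. *)
Definition cross_const : R := Ce + 2 * LH * (LGx + LGy)
  + 4 * (1 + LH * LGy) * (LGx + LGy) + SH * (1 + LGx) + (1 + LH).

Let mRm i j : measurable_fun setT (Rm i j).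
Proof.
apply: measurable_funD.
  by do 2?[apply: measurable_funM => //]; [exact: mcomp me i|exact: mcomp myh j].
apply: measurable_funD.
  by apply: measurable_funM; [exact: mcomp ml i|exact: mcomp myh j].
apply: measurable_funD.
  by do 2?[apply: measurable_funM => //]; [exact: mcomp mu_ i|exact: mcomp mG j].
apply: measurable_funD.
  by apply: measurable_funM; [exact: mr|exact: mcomp mv j].
do 2?[apply: measurable_funM => //].
exact: (coord_meas_D mm mr i).
Qed.

Let Rm_le i j w : `|Rm i j w| <=
  cross_const * (alpha * beta) * (Q (phi w) * N w ^+ 4).
Proof.
have ab0 : 0 <= alpha * beta by rewrite mulr_ge0// ltW.
set t := phi w.
have N41 : 1 <= N w ^+ 4 by rewrite exprn_ege1.
have QN : Q t <= Q t * N w ^+ 4 by rewrite ler_peMr.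
have QN2 : Q t * N w ^+ 2 <= Q t * N w ^+ 4.
  by rewrite ler_wpM2l//; have /andP[] := @NX 2 w isT.
have N2Q : N w ^+ 2 <= Q t * N w ^+ 4.
  apply: le_trans QN2; by rewrite ler_peMl ?sqr_ge0.
have cw n (a : 'cV[R]_n) k : `|a k 0| <= enorm a by exact: coord_le_enorm.
have h1 : `|(- alpha) * (e t i 0 * yh t j 0)| <=
    Ce * (alpha * beta) * (Q t * N w ^+ 4).
  rewrite normrM normrN (gtr0_norm alpha0).
  apply: le_trans (_ : alpha * (Ce * beta * Q t) <= _).
    rewrite ler_pM2l//; apply: le_trans (eF t); rewrite normrM mulrC.
    by apply: ler_pM => //; exact: cw.
  have -> : alpha * (Ce * beta * Q t) = Ce * (alpha * beta) * Q t by ring.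
  by rewrite ler_wpM2l// mulr_ge0.
have h2 : `|l t i 0 * yh t j 0| <=
    2 * LH * (LGx + LGy) * (alpha * beta) * (Q t * N w ^+ 4).
  rewrite normrM; apply: le_trans (_ : LH * beta * (LGx * p t + LGy * q t) * q t <= _).
    apply: ler_pM => //.
    by apply: le_trans (cw _ _ _) _; exact: (lag_le LH0 A1 A2).
  apply: le_trans (_ : LH * (LGx + LGy) * (alpha * beta) * Q t <= _).
    have -> : LH * beta * (LGx * p t + LGy * q t) * q t =
      LH * beta * (LGx * (p t * q t) + LGy * q t ^+ 2) by ring.
    have -> : LH * (LGx + LGy) * (alpha * beta) * Q t =
      LH * beta * (LGx * (alpha * Q t) + LGy * (alpha * Q t)) by ring.
    rewrite ler_wpM2l ?mulr_ge0 ?(ltW LH0) ?(ltW beta0)//.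
    by rewrite lerD// ler_pM2l.
  apply: ler_pM => //.
    by rewrite !mulr_ge0 ?addr_ge0// ltW.
  rewrite ler_wpM2r// -[leLHS]mul1r -!mulrA ler_wpM2r ?mulr_ge0 ?addr_ge0 ?(ltW LH0)//.
  - exact: ltW.
  - exact: ltW.
  - lra.
have h3 : `|(- beta) * (u t i 0 * G (x t) (y t) j 0)| <=
    4 * (1 + LH * LGy) * (LGx + LGy) * (alpha * beta) * (Q t * N w ^+ 4).
  have LL : 0 < LH * LGy by rewrite mulr_gt0.
  rewrite normrM normrN (gtr0_norm beta0) normrM.
  apply: le_trans (_ : beta * ((1 + LH * LGy) * (p t + q t)
      * ((LGx + LGy) * (p t + q t))) <= _).
    rewrite ler_pM2l//; apply: ler_pM => //.
      apply: le_trans (cw _ _ _) _; apply: le_trans (u_le t) _.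
      have := mulr_ge0 (ltW LL) (p0 t); have := q0 t; lra.
    apply: le_trans (cw _ _ _) _; apply: le_trans (slow_norm_le A2 _ _) _.
    have := mulr_ge0 (ltW LGx0) (q0 t); have := mulr_ge0 (ltW LGy0) (p0 t).
    rewrite /p /q /xh /yh; lra.
  have -> : beta * ((1 + LH * LGy) * (p t + q t) * ((LGx + LGy) * (p t + q t))) =
    (1 + LH * LGy) * (LGx + LGy) * beta * (p t ^+ 2 + 2 * (p t * q t) + q t ^+ 2).
    by ring.
  have -> : 4 * (1 + LH * LGy) * (LGx + LGy) * (alpha * beta) * (Q t * N w ^+ 4) =
    (1 + LH * LGy) * (LGx + LGy) * beta * (4 * (alpha * (Q t * N w ^+ 4))) by ring.
  rewrite ler_wpM2l//; first by rewrite !mulr_ge0 ?addr_ge0// ltW.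
  have := p2 t; have := q2 t; have := pq t.
  have : alpha * Q t <= alpha * (Q t * N w ^+ 4) by rewrite ler_pM2l.
  lra.
have h4 : `|r w i 0 * v t j 0| <=
    SH * (1 + LGx) * (alpha * beta) * (Q t * N w ^+ 4).
  rewrite normrM; apply: le_trans (_ : SH * (beta * Num.sqrt beta) * N w ^+ 2
      * (q t + LGx * p t) <= _).
    apply: ler_pM => //; first exact: le_trans (cw _ _ _) (r_le w).
    exact: le_trans (cw _ _ _) (v_le t).
  (* The spare factor sqrt beta <= sqrt alpha of the remainder is paired with |v|, itself of order
     sqrt alpha, to gain the missing order alpha. *)
  apply: le_trans (_ : SH * beta * N w ^+ 2 * ((1 + LGx) * (alpha * Q t)) <= _).
    have -> : SH * (beta * Num.sqrt beta) * N w ^+ 2 * (q t + LGx * p t) =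
       SH * beta * N w ^+ 2 * (Num.sqrt beta * q t + LGx * (Num.sqrt beta * p t)).
      by ring.
    rewrite ler_wpM2l ?mulr_ge0 ?sqr_ge0 ?(ltW beta0)//.
    have sb : Num.sqrt beta <= Num.sqrt alpha by rewrite ler_wsqrtr.
    rewrite mulrDl mul1r; apply: lerD; last rewrite ler_pM2l//.
      by apply: le_trans (sqrt_le (q0 t) (q2 t)); rewrite ler_wpM2r.
    by apply: le_trans (sqrt_le (p0 t) (p2 t)); rewrite ler_wpM2r.
  have -> : SH * beta * N w ^+ 2 * ((1 + LGx) * (alpha * Q t)) =
    SH * (1 + LGx) * (alpha * beta) * (Q t * N w ^+ 2) by ring.
  by rewrite ler_wpM2l// !mulr_ge0 ?addr_ge0// ltW.
have h5 : `|(- beta) * ((m w + r w) i 0 * psi w j 0)| <=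
    (1 + LH) * (alpha * beta) * (Q t * N w ^+ 4).
  rewrite normrM normrN (gtr0_norm beta0) normrM.
  apply: le_trans (_ : beta * ((1 + LH) * alpha * N w * N w) <= _).
    rewrite ler_pM2l//; apply: ler_pM => //; first exact: le_trans (cw _ _ _) (mr_le w).
    exact: le_trans (cw _ _ _) (psiN w).
  have -> : beta * ((1 + LH) * alpha * N w * N w) =
    (1 + LH) * (alpha * beta) * N w ^+ 2 by ring.
  by rewrite ler_wpM2l// mulr_ge0// addr_ge0// ltW.
move: h1 h2 h3 h4 h5; rewrite /Rm -/t; set ab := alpha * beta.
set X := Q t * _; set a1 := _ * (e _ _ _ * _); set a2 := l _ _ _ * _.
set a3 := _ * (u _ _ _ * _); set a4 := r _ _ _ * _; set a5 := _ * (_ * psi _ _ _).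
move=> h1 h2 h3 h4 h5.
have -> : cross_const * ab * X = Ce * ab * X + (2 * LH * (LGx + LGy) * ab * X
  + (4 * (1 + LH * LGy) * (LGx + LGy) * ab * X + (SH * (1 + LGx) * ab * X
  + (1 + LH) * ab * X))) by rewrite /cross_const; ring.
by do 4![apply: le_trans (ler_normD _ _) _; apply: lerD => //].
Qed.

Let coordE n (a : 'cV[R]_n) (g : R) k : dotv (g *: delta_mx k 0) a = g * a k 0.
Proof.
rewrite dotvZl; congr (_ * _); rewrite /dotv (bigD1 k)//= big1 => [|l' l'k].
  by rewrite mxE !eqxx mul1r addr0.
by rewrite mxE (negbTE l'k) mul0r.
Qed.

Let enorm_coord n (g : R) (k : 'I_n) :
  enorm (g *: delta_mx k 0 : 'cV[R]_n) = `|g|.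
Proof. by rewrite /enorm coordE mxE mxE !eqxx mulr1 -expr2 sqrtr_sqr. Qed.

Let mcoordE n (X : T -> R) (k : 'I_n) : measurable_fun setT X ->
  coord_meas (fun t => X t *: (delta_mx k 0 : 'cV[R]_n)).
Proof.
move=> mX i; rewrite (_ : (fun t => _) =
  (fun t => X t * (delta_mx k 0 : 'cV[R]_n) i 0)); first exact: measurable_funM.
by apply/funext => t; rewrite mxE.
Qed.

Let cross_coord i j :
  `|\int[P]_w (next_xh w i 0 * next_yh w j 0)
    - (\int[P]_w (xh (phi w) i 0 * yh (phi w) j 0)
      - alpha * \sum_k B1 i k * \int[P]_w (xh (phi w) k 0 * yh (phi w) j 0))|
  <= cross_const * (alpha * beta) * (Gam * M).
Proof.
have [Lm Em] : L1 (fun w => v (phi w) j 0 * m w i 0) /\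
    \int[P]_w (v (phi w) j 0 * m w i 0) = 0.
  have mB : measurable_fun setT (fun t => (1 + LGx) * Q t).
    exact: measurable_funM.
  have vB t : enorm (v t j 0 *: delta_mx i 0 : 'cV[R]_dx) <= (1 + LGx) * Q t.
    by rewrite enorm_coord; apply: le_trans (coord_le_enorm _ _) (vQ t).
  have := m_mean0 (mcoordE i (mv j)) mB vB (L1_scale _ LQ).
  have -> // : (fun w => dotv (v (phi w) j 0 *: delta_mx i 0) (m w)) =
    (fun w => v (phi w) j 0 * m w i 0) by apply/funext => w; rewrite coordE.
have [Lp Ep] : L1 (fun w => u (phi w) i 0 * psi w j 0) /\
    \int[P]_w (u (phi w) i 0 * psi w j 0) = 0.
  have mB : measurable_fun setT (fun t => (1 + LH * LGy) * Q t).
    exact: measurable_funM.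
  have uB t : enorm (u t i 0 *: delta_mx j 0 : 'cV[R]_dy) <= (1 + LH * LGy) * Q t.
    by rewrite enorm_coord; apply: le_trans (coord_le_enorm _ _) (uQ t).
  have zB t : enorm (0 : 'cV[R]_dx) <= (1 + LH * LGy) * Q t.
    by rewrite enorm0 mulr_ge0// addr_ge0// mulr_ge0// ltW.
  have := noise_mean0 (coord_meas_cst (0 : 'cV[R]_dx)) (mcoordE j (mu_ i)) mB zB uB
    (L1_scale _ LQ).
  have -> // : (fun w => dotv 0 (xi w) + dotv (u (phi w) i 0 *: delta_mx j 0) (psi w))
    = (fun w => u (phi w) i 0 * psi w j 0).
  by apply/funext => w; rewrite coordE dotv0l add0r.
have LRb := L1_scale (cross_const * (alpha * beta)) LQN.
have LR := L1_le (mRm i j) LRb (Rm_le i j).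
have LS : L1 (fun w => \sum_k B1 i k * (xh (phi w) k 0 * yh (phi w) j 0)).
  by apply: L1_sum => k; exact: L1_scale.
(* Expansion of (u + m + r)(v - beta psi), with u = x' - alpha B1 x' - alpha e + l and v = y' - beta
   G, where y' denotes the slow error; the products v m and u psi have mean zero. *)
have E : (fun w => next_xh w i 0 * next_yh w j 0) = (fun w =>
   xh (phi w) i 0 * yh (phi w) j 0
   + ((- alpha) * (\sum_k B1 i k * (xh (phi w) k 0 * yh (phi w) j 0))
   + (v (phi w) j 0 * m w i 0 + ((- beta) * (u (phi w) i 0 * psi w j 0)
   + Rm i j w)))).
  apply/funext => w; set t := phi w.
  have -> : \sum_k B1 i k * (xh t k 0 * yh t j 0) = (B1 *m xh t) i 0 * yh t j 0.
    by rewrite [(_ *m _) i 0]mxE mulr_suml; apply: eq_bigr => k _; rewrite mulrA.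
  rewrite next_xhE next_yhE /Rm -/t.
  have ui : u t i 0 = xh t i 0 - alpha * (B1 *m xh t) i 0 - alpha * e t i 0 + l t i 0.
    rewrite /u /fast_drift /e /l -/(xh t) -/(y' t); set Bx := B1 *m _.
    rewrite !mxE; ring.
  have vj : v t j 0 = yh t j 0 - beta * G (x t) (y t) j 0 by rewrite !mxE.
  have aE n (a b : 'cV[R]_n) k : (a + b) k 0 = a k 0 + b k 0 by rewrite mxE.
  have bE : ((- beta) *: psi w + 0) j 0 = - beta * psi w j 0.
    by rewrite addr0 mxE.
  rewrite (aE _ (u t) (m w + r w)) (aE _ (v t)) bE (aE _ (m w) (r w)).
  rewrite vj ui; ring.
rewrite E Ex_add//; last first.
  by do 3?[apply: L1_add => //]; exact: L1_scale.
rewrite Ex_add//; last 2 first.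
- exact: L1_scale.
- by do 2?[apply: L1_add => //]; exact: L1_scale.
rewrite Ex_add//; last by apply: L1_add => //; exact: L1_scale.
rewrite Ex_add//; last exact: L1_scale.
rewrite !Ex_scale// Em Ep mulr0 !add0r Ex_sum; last by move=> k; exact: L1_scale.
under eq_bigr do rewrite Ex_scale//.
have -> (a b c k : R) : a + (- b * c + k) - (a - b * c) = k by ring.
apply: le_trans (normr_Ex_le LR LRb (Rm_le i j)) _.
rewrite Ex_scale//; apply: ler_wpM2l => //.
rewrite mulr_ge0 ?mulr_ge0 ?(ltW alpha0) ?(ltW beta0)// /cross_const.
have := mulr_gt0 LH0 LGx0; have := mulr_gt0 LH0 LGy0 => h1 h2.
have h3 : 0 < LH * LGy * (LGx + LGy) by rewrite mulr_gt0// addr_gt0.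
have h4 : 0 <= SH * LGx by rewrite mulr_ge0// ltW.
move: LH0 LGx0 LGy0 SH0 Ce0; lra.
Qed.

(** For fixed j, the column E x' y'_j is mapped by I - alpha B1 up to the error bounded in
    [cross_coord]. The factor dx comes from summing that error over the coordinates. *)
Lemma cross_step j :
  enorm (\col_i \int[P]_w (next_xh w i 0 * next_yh w j 0)) <=
  (1 - alpha * muF / 2) * enorm (\col_i \int[P]_w (xh (phi w) i 0 * yh (phi w) j 0))
  + dx%:R * (cross_const * (alpha * beta) * (Gam * M)).
Proof.
set zn := \col_i _; set z := \col_i _.
have -> : zn = (z - alpha *: (B1 *m z)) + (zn - (z - alpha *: (B1 *m z))).
  by rewrite addrC subrK.
apply: le_trans (enormD _ _) _; apply: lerD; first exact: B1con.
apply: le_trans (enorm_le_sum _) _.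
have -> : dx%:R * (cross_const * (alpha * beta) * (Gam * M)) =
  \sum_(i < dx) cross_const * (alpha * beta) * (Gam * M).
  by rewrite sumr_const card_ord mulr_natl.
apply: ler_sum => i _; have := cross_coord i j; rewrite !mxE.
by under [in X in _ -> X]eq_bigr do rewrite mxE.
Qed.

End Cross.

(** The expectation of the term linear in x' is taken before its absolute value, so it costs only
    the entries of the cross moment; |x'| |y'| in its place would be controlled only to order
    alpha. *)
Lemma slow_second_step (B2 : 'M[R]_(dy, dx)) (Ce z : R) : 0 <= Ce ->
  (forall t, q t * enorm (G (x t) (y t) - G (H (y t)) (y t) - B2 *m xh t)
    <= muG / 8 * q t ^+ 2 + Ce * beta * Q t) ->
  (forall i j, `|\int[P]_w (xh (phi w) i 0 * yh (phi w) j 0)| <= z) ->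
  \int[P]_w (enorm (next_yh w) ^+ 2) <=
    (1 - beta * muG / 2) * \int[P]_w (q (phi w) ^+ 2)
    + 2 * beta * ((\sum_i \sum_j `|B2 i j|) * z)
    + (2 * Ce + 2 * LGx * LGy + LGx ^+ 2 + 1) * (Gam * M) * beta ^+ 2.
Proof.
move=> Ce0 eG zle.
pose K := 2 * Ce + 2 * LGx * LGy + LGx ^+ 2.
have K0 : 0 <= K by rewrite !addr_ge0 ?sqr_ge0 ?mulr_ge0// ltW.
have vsq t : enorm (v t) ^+ 2 <= (1 - beta * muG / 2) * q t ^+ 2
    + (- (2 * beta)) * dotv (yh t) (B2 *m xh t) + beta ^+ 2 * K * Q t.
  pose g := G (H (y t)) (y t); pose D := G (x t) (y t) - g.
  pose e := D - B2 *m xh t.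
  have -> : v t = (yh t - beta *: g) + (- beta) *: D.
    by rewrite /v /slow_drift /D scaleNr scalerBr opprB addrA subrK.
  rewrite enormD_sqr enormZ normrN (gtr0_norm beta0) dotvZr dotvDl dotvNl dotvZl.
  have -> : dotv (yh t) D = dotv (yh t) (B2 *m xh t) + dotv (yh t) e.
    by rewrite -dotvDr /e addrC subrK.
  have DL : enorm D <= LGx * p t by have [_ h _] := A2; exact: h.
  have gL : enorm g <= LGy * q t by exact: (slow_norm_le0 A2).
  (* Squaring the contraction leaves 1 - 3/4 beta muG; the linearization error uses up 2 beta * muG
     / 8, which gives the final rate 1 - beta muG / 2. *)
  have c0 : enorm (yh t - beta *: g) ^+ 2 <= (1 - 3 / 4 * (beta * muG)) * q t ^+ 2.
    have con : enorm (yh t - beta *: g) <= (1 - beta * muG / 2) * q t.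
      exact: (slow_contract0 LGy0 A2 A3 beta0 betaLGy beta_muG).
    apply: le_trans (_ : ((1 - beta * muG / 2) * q t) ^+ 2 <= _).
      by apply: lerXn2r; rewrite ?nnegrE// (le_trans _ con).
    rewrite exprMn ler_wpM2r ?sqr_ge0//.
    have b0 : 0 <= beta * muG by rewrite mulr_ge0// ltW.
    have := mulr_ge0 b0 (_ : 0 <= 1 - beta * muG); rewrite subr_ge0 => /(_ beta_muG).
    lra.
  have h1 : `|dotv (yh t) e| <= muG / 8 * q t ^+ 2 + Ce * beta * Q t.
    by apply: le_trans (normr_dotv_le _ _) _; exact: eG.
  have h2 : `|dotv g D| <= LGx * LGy * Q t.
    apply: le_trans (normr_dotv_le _ _) _.
    apply: le_trans (_ : (LGy * q t) * (LGx * p t) <= _); first exact: ler_pM.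
    have -> : LGy * q t * (LGx * p t) = LGx * LGy * (p t * q t) by ring.
    rewrite ler_wpM2l ?mulr_ge0 ?(ltW LGx0) ?(ltW LGy0)//.
    by apply: le_trans (pq t) _; rewrite ler_piMl.
  have h3 : enorm D ^+ 2 <= LGx ^+ 2 * Q t.
    apply: le_trans (_ : (LGx * p t) ^+ 2 <= _).
      by apply: lerXn2r; rewrite ?nnegrE// (le_trans _ DL).
    rewrite exprMn ler_wpM2l ?sqr_ge0//.
    by apply: le_trans (p2 t) _; rewrite ler_piMl.
  have b2 : 0 <= beta ^+ 2 by rewrite sqr_ge0.
  move: h1 h2; rewrite !ler_norml => /andP[h1 _] /andP[_ h2].
  have k1 := ler_wpM2l (ltW beta0) h1.
  have k2 := ler_wpM2l b2 h2; have k3 := ler_wpM2l b2 h3.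
  rewrite /K exprMn; lra.
have pt w : enorm (next_yh w) ^+ 2 <= (1 - beta * muG / 2) * q (phi w) ^+ 2
    + ((- (2 * beta)) * dotv (yh (phi w)) (B2 *m xh (phi w))
    + ((- (2 * beta)) * dotv (v (phi w)) (psi w)
    + beta ^+ 2 * (K + 1) * (Q (phi w) * N w ^+ 4))).
  rewrite next_yhE addr0 enormD_sqr enormZ normrN (gtr0_norm beta0) dotvZr.
  have := vsq (phi w); set t := phi w.
  have N41 : 1 <= N w ^+ 4 by rewrite exprn_ege1.
  have QN : Q t <= Q t * N w ^+ 4 by rewrite ler_peMr.
  have psi2 : enorm (psi w) ^+ 2 <= Q t * N w ^+ 4.
    apply: le_trans (_ : N w ^+ 4 <= _); last by rewrite ler_peMl// (le_trans _ N41).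
    have /andP[_] := @NX 2 w isT; apply: le_trans.
    by apply: lerXn2r; rewrite ?nnegrE.
  have b2 : 0 <= beta ^+ 2 by rewrite sqr_ge0.
  have k1 := ler_wpM2l b2 psi2; have k2 := ler_wpM2l (mulr_ge0 b2 K0) QN.
  rewrite exprMn; lra.
have Lq2 : L1 (fun w => q (phi w) ^+ 2).
  apply: (@L1_le _ _ _ _ _ (fun w => alpha * Q (phi w))).
  - exact: (measurableT_comp (mq 2) mphi).
  - exact: L1_scale.
  - by move=> w; rewrite ger0_norm ?sqr_ge0.
have dotE : (fun w => dotv (yh (phi w)) (B2 *m xh (phi w))) = (fun w =>
    \sum_i \sum_j B2 i j * (xh (phi w) j 0 * yh (phi w) i 0)).
  apply/funext => w; apply: eq_bigr => i _; rewrite [(_ *m _) i 0]mxE mulr_sumr.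
  by apply: eq_bigr => j _; ring.
have Ls i : L1 (fun w => \sum_j B2 i j * (xh (phi w) j 0 * yh (phi w) i 0)).
  by apply: L1_sum => j; exact: L1_scale.
have Ld : L1 (fun w => dotv (yh (phi w)) (B2 *m xh (phi w))).
  by rewrite dotE; exact: L1_sum.
have Ed : `|\int[P]_w dotv (yh (phi w)) (B2 *m xh (phi w))|
    <= (\sum_i \sum_j `|B2 i j|) * z.
  rewrite dotE Ex_sum// mulr_suml; apply: le_trans (ler_norm_sum _ _ _) _.
  apply: ler_sum => i _; rewrite Ex_sum; last by move=> j; exact: L1_scale.
  rewrite mulr_suml; apply: le_trans (ler_norm_sum _ _ _) _.
  by apply: ler_sum => j _; rewrite Ex_scale// normrM ler_wpM2l.
have [Lv1 Ev1] : L1 (fun w => dotv (v (phi w)) (psi w)) /\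
    \int[P]_w dotv (v (phi w)) (psi w) = 0.
  have mB : measurable_fun setT (fun t => (1 + LGx) * Q t).
    exact: measurable_funM.
  have zB t : enorm (0 : 'cV[R]_dx) <= (1 + LGx) * Q t.
    by rewrite enorm0 mulr_ge0// addr_ge0// ltW.
  have := noise_mean0 (coord_meas_cst (0 : 'cV[R]_dx)) mv mB zB vQ (L1_scale _ LQ).
  have -> // : (fun w => dotv 0 (xi w) + dotv (v (phi w)) (psi w))
    = (fun w => dotv (v (phi w)) (psi w)).
  by apply/funext => w; rewrite dotv0l add0r.
have Lr := L1_add (L1_scale (- (2 * beta)) Lv1) (L1_scale (beta ^+ 2 * (K + 1)) LQN).
have Lr2 := L1_add (L1_scale (- (2 * beta)) Ld) Lr.
have Lr3 := L1_add (L1_scale (1 - beta * muG / 2) Lq2) Lr2.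
have Ln : L1 (fun w => enorm (next_yh w) ^+ 2).
  apply: L1_le Lr3 _; last by move=> w; rewrite ger0_norm ?sqr_ge0.
  apply: measurable_funX; apply: coord_meas_enorm; exact: next_meas.2.
apply: le_trans (Ex_le Ln Lr3 pt) _.
rewrite Ex_add//; last exact: L1_scale.
rewrite Ex_add//; last exact: L1_scale.
rewrite Ex_add//; try exact: L1_scale.
rewrite !Ex_scale// Ev1 mulr0 add0r -/K.
move: Ed; rewrite ler_norml => /andP[Ed _].
have b2 : 0 <= beta ^+ 2 * (K + 1) by rewrite mulr_ge0 ?sqr_ge0// addr_ge0.
have k1 := ler_wpM2l b2 EQN; have k2 := ler_wpM2l (ltW beta0) Ed.
lra.
Qed.

End SecondMoments.
End Step.

(** * Recursive inequalities *)

Section Recursions.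
Context {R : realType}.
Variables (eps : R) (alpha beta : nat -> R).
Hypotheses (eps0 : 0 < eps) (eps1 : eps <= 1) (S : slow_steps eps alpha beta).

Let a0 t : 0 < alpha t. Proof. exact: alpha_gt0 S t. Qed.
Let b0 t : 0 < beta t. Proof. exact: beta_gt0 S t. Qed.
Let ba t : beta t <= alpha t.
Proof. by apply: le_trans (beta_le S t) _; rewrite ler_piMl// ltW. Qed.
Let a1 t : alpha t <= 1. Proof. exact: le_trans (alpha_le S t) eps1. Qed.
Let b1 t : beta t <= 1. Proof. exact: le_trans (ba t) (a1 t). Qed.

(** Slow variation read forwards in time: beta and g being nonincreasing, the relative loss eps
    beta_(t+1) may be replaced by eps beta_t. *)
Let shrink (g : nat -> R) t : 0 < g t.+1 ->
  g t <= g t.+1 * (1 + eps * beta t.+1) -> g t.+1 <= g t ->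
  g t * (1 - eps * beta t) <= g t.+1.
Proof.
move=> g0 gs gn.
have eb : eps * beta t.+1 <= eps * beta t by rewrite ler_pM2l// (beta_noninc S).
have eb0 : 0 < eps * beta t.+1 by rewrite mulr_gt0.
have gt0 : 0 < g t by apply: lt_le_trans gn.
have h1 : g t.+1 * (eps * beta t.+1) <= g t * (eps * beta t).
  by apply: ler_pM => //; exact: ltW.
lra.
Qed.

(** Half of the contraction pays for the source K, since K <= c/2 A; the other half pays for the
    decrease of beta. The second term of [A] covers t = 0. It serves with gam = alpha for the cross
    moment and gam = beta for the slow error. *)
Lemma linear_recursion (gam u : nat -> R) (c K : R) : 0 < c -> 0 <= K ->
  eps <= c / 2 -> (forall t, 0 <= u t) ->
  (forall t, beta t <= gam t) -> (forall t, c * gam t <= 1) ->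
  (forall t, u t.+1 <= (1 - c * gam t) * u t + K * (gam t * beta t)) ->
  exists2 A, 0 <= A & forall t, u t <= A * beta t.
Proof.
move=> c0 K0 ec u0 bg cg rec.
pose A := 2 * K / c + u 0%N / beta 0%N.
have A0 : 0 <= A by rewrite addr_ge0 ?divr_ge0 ?mulr_ge0// ltW.
have AK : K <= c / 2 * A.
  rewrite /A mulrDr; have -> : c / 2 * (2 * K / c) = K by field; rewrite gt_eqF.
  by rewrite lerDl mulr_ge0 ?divr_ge0// ltW.
exists A => //; elim=> [|t IH].
  rewrite /A mulrDl divfK ?gt_eqF// lerDr mulr_ge0 ?divr_ge0 ?mulr_ge0// ltW//.
apply: le_trans (rec t) _.
have g0 : 0 < gam t by apply: lt_le_trans (bg t).
have h1 : (1 - c * gam t) * u t <= (1 - c * gam t) * (A * beta t).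
  by rewrite ler_wpM2l// subr_ge0.
have h2 : K * (gam t * beta t) <= c / 2 * A * (gam t * beta t).
  by rewrite ler_wpM2r// mulr_ge0// ltW.
have h3 : A * (beta t * (1 - eps * beta t)) <= A * beta t.+1.
  by rewrite ler_wpM2l// shrink ?(beta_slow S) ?(beta_noninc S).
have h4 : (eps * beta t) * (A * beta t) <= (c / 2 * gam t) * (A * beta t).
  rewrite ler_wpM2r ?mulr_ge0 ?(ltW (b0 t))//.
  by apply: ler_pM => //; exact: ltW.
lra.
Qed.

(* Smallness of beta / alpha makes the loop gain of the coupled recursion smaller
   than one. *)
Lemma coupled_recursion (X Y : nat -> R) (c c' K1 K2 K3 K4 : R) :
  0 < c -> 0 < c' -> 0 <= K1 -> 0 <= K2 -> 0 <= K3 -> 0 <= K4 ->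
  eps <= c / 8 -> eps <= c' / 8 ->
  eps <= c / (4 * (K1 * (2 * K2 / c' + 2) + 1)) ->
  (forall t, alpha t * c <= 1) -> (forall t, beta t * c' <= 1) ->
  (forall t, 0 <= X t) -> (forall t, 0 <= Y t) ->
  (forall t, X t.+1 <= (1 - alpha t * c) * X t
     + K1 * (beta t ^+ 4 / alpha t ^+ 3) * Y t + K3 * alpha t ^+ 3) ->
  (forall t, Y t.+1 <= (1 - beta t * c') * Y t
     + K2 * beta t * X t + K4 * beta t ^+ 3) ->
  exists2 A, 0 <= A & forall t, X t <= A * alpha t ^+ 2 /\ Y t <= A * alpha t ^+ 2.
Proof.
move=> c0 c'0 K10 K20 K30 K40 ec ec' eK c1 c'1 X0 Y0 recX recY.
(* [B] makes K2 A + K4 at most c'/2 B, so it depends on [A]; the circle closes because the feedback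
   of Y into X carries beta^4 / alpha^3 <= eps alpha, and the threshold on eps makes the coefficient
   of [A] in K1 eps B at most c/4. The quotient by alpha_0^2 covers t = 0. *)
pose A := 2 / c * (K3 + 2 * K1 * K4 / c') + (X 0%N + Y 0%N) / alpha 0%N ^+ 2.
pose B := 2 / c' * (K2 * A + K4) + 2 * A.
have a2 : 0 < alpha 0%N ^+ 2 by rewrite exprn_gt0.
have KK : 0 <= 2 * K1 * K4 / c' by nonneg.
have A0 : 0 <= A.
  by nonneg.
have B1 : 0 <= 2 / c' * (K2 * A + K4).
  by nonneg.
have B0 : 0 <= B by rewrite addr_ge0// mulr_ge0.
have AB : A <= B by rewrite /B; lra.
have A1 : X 0%N + Y 0%N <= A * alpha 0%N ^+ 2.
  rewrite /A mulrDl divfK ?gt_eqF// lerDr mulr_ge0 ?(ltW a2)//.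
  by rewrite mulr_ge0 ?divr_ge0 ?addr_ge0// ltW.
have A2 : K3 + 2 * K1 * K4 / c' <= c / 2 * A.
  have -> : c / 2 * A = K3 + 2 * K1 * K4 / c'
      + c / 2 * ((X 0%N + Y 0%N) / alpha 0%N ^+ 2).
    by rewrite /A; field; rewrite !gt_eqF.
  by rewrite lerDl; nonneg.
have eB : K1 * eps * B <= c / 4 * A + 2 * K1 * K4 / c'.
  pose D := K1 * (2 * K2 / c' + 2).
  have D0 : 0 <= D by nonneg.
  have D1 : eps * D <= c / 4.
    have : eps * (4 * (D + 1)) <= c by rewrite -ler_pdivlMr// mulr_gt0 ?ltr_wpDl.
    have := eps0; lra.
  have -> : K1 * eps * B = (eps * D) * A + eps * (2 * K1 * K4 / c').
    by rewrite /B /D; field; rewrite gt_eqF.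
  by apply: lerD; [rewrite ler_wpM2r|rewrite ler_piMl].
suff H t : X t <= A * alpha t ^+ 2 /\ Y t <= B * alpha t ^+ 2.
  exists B => // t; have [h1 h2] := H t; split => //; apply: le_trans h1 _.
  by rewrite ler_wpM2r// sqr_ge0.
elim: t => [|t [IHX IHY]].
  split; first by have := Y0 0%N; lra.
  apply: le_trans (_ : A * alpha 0%N ^+ 2 <= _); first by have := X0 0%N; lra.
  by rewrite ler_wpM2r// ltW.
have at0 := a0 t; have bt0 := b0 t.
have sh : alpha t ^+ 2 * (1 - 2 * (eps * beta t)) <= alpha t.+1 ^+ 2.
  have h : alpha t * (1 - eps * beta t) <= alpha t.+1.
    by rewrite shrink ?(alpha_slow S) ?(alpha_noninc S).
  have eb1 : eps * beta t <= 1 by rewrite mulr_ile1// ltW.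
  apply: le_trans (_ : (alpha t * (1 - eps * beta t)) ^+ 2 <= _).
    rewrite exprMn ler_wpM2l ?sqr_ge0//.
    by have := sqr_ge0 (eps * beta t); lra.
  by apply: lerXn2r; rewrite ?nnegrE ?mulr_ge0 ?subr_ge0// ltW.
have al2 : 0 <= alpha t ^+ 2 by rewrite sqr_ge0.
split.
  apply: le_trans (recX t) _.
  apply: le_trans (_ : A * (alpha t ^+ 2 * (1 - 2 * (eps * beta t))) <= _); last first.
    by rewrite ler_wpM2l.
  have h1 : (1 - alpha t * c) * X t <= (1 - alpha t * c) * (A * alpha t ^+ 2).
    by rewrite ler_wpM2l// subr_ge0.
  have h2 : K1 * (beta t ^+ 4 / alpha t ^+ 3) * Y t <= K1 * eps * B * alpha t ^+ 3.
    apply: le_trans (_ : K1 * (eps * alpha t) * (B * alpha t ^+ 2) <= _); last first.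
      by rewrite le_eqVlt; apply/orP; left; apply/eqP; ring.
    apply: ler_pM => //.
      by rewrite mulr_ge0// divr_ge0 ?exprn_ge0// ltW.
    rewrite ler_wpM2l// ler_pdivrMr ?exprn_gt0//.
    have -> : eps * alpha t * alpha t ^+ 3 = (eps * alpha t) * alpha t ^+ 3 by [].
    rewrite exprS; apply: ler_pM; rewrite ?exprn_ge0 ?(ltW bt0)//; first exact: beta_le S t.
    by apply: lerXn2r; rewrite ?nnegrE ?(ltW bt0) ?(ltW at0).
  (* Budget of the contraction c: 1/4 for the feedback of Y, 1/2 for the sources, and 1/4 for the
     decrease of alpha^2, which costs 2 eps beta. *)
  have h3 : eps * beta t <= c / 8 * alpha t.
    by apply: ler_pM => //; exact: ltW.
  have h4 := ler_wpM2l (mulr_ge0 A0 al2) h3.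
  have h5 := ler_wpM2r (exprn_ge0 3 (ltW at0)) eB.
  have h6 := ler_wpM2r (exprn_ge0 3 (ltW at0)) A2.
  lra.
apply: le_trans (recY t) _.
apply: le_trans (_ : B * (alpha t ^+ 2 * (1 - 2 * (eps * beta t))) <= _); last first.
  by rewrite ler_wpM2l.
have h1 : (1 - beta t * c') * Y t <= (1 - beta t * c') * (B * alpha t ^+ 2).
  by rewrite ler_wpM2l// subr_ge0.
have h2 : K2 * beta t * X t <= K2 * beta t * (A * alpha t ^+ 2).
  by rewrite ler_wpM2l// mulr_ge0// ltW.
have h3 : K4 * beta t ^+ 3 <= K4 * (beta t * alpha t ^+ 2).
  rewrite ler_wpM2l// exprS ler_pM2l//.
  by apply: lerXn2r; rewrite ?nnegrE ?(ltW bt0) ?(ltW at0).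
have h4 : eps * beta t <= c' / 8 * beta t by rewrite ler_pM2r.
have h5 := ler_wpM2l (mulr_ge0 B0 al2) h4.
have h6 : K2 * A + K4 <= c' / 2 * B.
  have -> : c' / 2 * B = K2 * A + K4 + c' / 2 * (2 * A).
    by rewrite /B; field; rewrite gt_eqF.
  by rewrite lerDl; nonneg.
have h7 := ler_wpM2r (mulr_ge0 (ltW bt0) al2) h6.
have h8 : 0 <= B * (beta t * alpha t ^+ 2) * c'.
  by rewrite !mulr_ge0// ltW.
lra.
Qed.

End Recursions.

(** * The filtration of the iterates *)

Section Bridge.
Context {R : realType} {d : measure_display} {Omega : measurableType d}.
Variable P : probability Omega R.
Variable G : set (set Omega).
Hypothesis Gm : G `<=` measurable.

(** The past is the set [Omega] itself with the smaller sigma-algebra generated by [G], and [phi] is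
    the identity: measurable functions on [T] are those known to the past. *)
Let T := g_sigma_algebraType G.
Let phi : Omega -> T := id.

Lemma sub_sigma_measurable : <<s G >> `<=` measurable.
Proof. by apply: smallest_sub => //; exact: sigma_algebra_measurable. Qed.

Lemma id_measurable : measurable_fun setT phi.
Proof. by move=> _ A mA; rewrite setTI; exact: sub_sigma_measurable. Qed.

Lemma condexp_mean_zero n (xi : Omega -> 'cV[R]_n) :
  is_condexp_mx P <<s G >> xi (fun=> 0) -> mean_zero P phi xi.
Proof.
move=> ce U i mU LU; have [iZ _ _ intA] := ce i 0.
apply: (@cond_mean0 _ _ _ _ _ P phi id_measurable _ U iZ) => // A mA.
rewrite -[phi @^-1` A]/A -intA//; apply: integral0_eq => w _.
by rewrite mxE.
Qed.

(** The bound on [m] holds only almost everywhere, so [m] is replaced by its minimum with [c], which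
    has the same integrals and is bounded everywhere. *)
Lemma condexp_set_le (Z m : Omega -> R) (c : R) (A : set Omega) :
  is_condexp P <<s G >> Z m -> {ae P, forall w, m w <= c} -> <<s G >> A ->
  (\int[P]_(w in A) (Z w)%:E <= c%:E * P A)%E.
Proof.
move=> [_ im _ intA] mc SA; rewrite -intA//.
have mA : measurable A by exact: sub_sigma_measurable.
have mm : measurable_fun A (EFin \o m).
  exact: measurable_funS (measurable_int _ im).
have mmin : measurable_fun setT (fun w => Num.min (m w) c).
  by apply: measurable_minr => //; exact: L1_measurable im.
have Lmin : L1 P (fun w => Num.min (m w) c).
  have La : L1 P (fun w => `|m w|) by exact: (integrable_abse im).
  apply: L1_le mmin (L1_add La (L1_cst P `|c|)) _ => w.
  by rewrite minEle; case: ifP => _; rewrite ?lerDl ?lerDr.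
have mm' : measurable_fun A (EFin \o (fun w => Num.min (m w) c)).
  by apply/measurable_EFinP; exact: measurable_funTS.
rewrite (@ae_eq_integral _ _ _ P A (EFin \o (fun w => Num.min (m w) c)) (EFin \o m))//.
  rewrite -integral_cst//; apply: le_integral => //.
  - by apply: integrableS Lmin.
  - exact: finite_measure_integrable_cst.
  - by move=> w _; rewrite lee_fin ge_min lexx orbT.
by apply: filterS mc => w mwc _ /=; rewrite (min_idPl mwc).
Qed.

Lemma condexp_moment_control n k (xi : Omega -> 'cV[R]_n) (psi : Omega -> 'cV[R]_k)
    (m1 m2 : Omega -> R) (c1 c2 : R) :
  coord_meas xi -> coord_meas psi -> 0 <= c1 -> 0 <= c2 ->
  is_condexp P <<s G >> (fun w => enorm (xi w) ^+ 4) m1 ->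
  {ae P, forall w, m1 w <= c1} ->
  is_condexp P <<s G >> (fun w => enorm (psi w) ^+ 4) m2 ->
  {ae P, forall w, m2 w <= c2} ->
  moment_control P phi (fun w => (1 + enorm (xi w) + enorm (psi w)) ^+ 4)
    (27 * (1 + c1 + c2)).
Proof.
move=> mxi mpsi c10 c20 ce1 b1 ce2 b2 U mU U0 LU.
have mx4 : measurable_fun setT (fun w => enorm (xi w) ^+ 4).
  by apply: measurable_funX; exact: coord_meas_enorm.
have mp4 : measurable_fun setT (fun w => enorm (psi w) ^+ 4).
  by apply: measurable_funX; exact: coord_meas_enorm.
apply: (@cond_bound _ _ _ _ _ P phi id_measurable) => //.
- by rewrite mulr_ge0// !addr_ge0.
- apply: measurable_funX; apply: measurable_funD; last exact: coord_meas_enorm.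
  by apply: measurable_funD => //; exact: coord_meas_enorm.
- by move=> w; rewrite exprn_ge0// !addr_ge0.
move=> A' SA'; pose A : set Omega := A'; have SA : <<s G >> A by exact: SA'.
rewrite -[phi @^-1` A']/A.
have mA : measurable A by exact: sub_sigma_measurable.
have le4 w : (1 + enorm (xi w) + enorm (psi w)) ^+ 4 <=
    27 * (1 + (enorm (xi w) ^+ 4 + enorm (psi w) ^+ 4)).
  have := enorm_ge0 (xi w); have := enorm_ge0 (psi w).
  set s := enorm (psi w); set z := enorm (xi w) => s0 z0.
  (* Two applications of (a + b + c)^2 <= 3 (a^2 + b^2 + c^2) give the constant 27 = 3^2 * 3. *)
  pose Z := (1 + z ^+ 2 + s ^+ 2).
  have e1 : (1 + z + s) ^+ 2 <= 3 * Z.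
    have := sqr_ge0 (1 - z); have := sqr_ge0 (1 - s); have := sqr_ge0 (z - s).
    rewrite /Z; lra.
  have e2 : Z ^+ 2 <= 3 * (1 + (z ^+ 4 + s ^+ 4)).
    have := sqr_ge0 (1 - z ^+ 2); have := sqr_ge0 (1 - s ^+ 2).
    have := sqr_ge0 (z ^+ 2 - s ^+ 2); rewrite /Z; lra.
  have -> : (1 + z + s) ^+ 4 = ((1 + z + s) ^+ 2) ^+ 2 by rewrite -exprM.
  apply: le_trans (_ : (3 * Z) ^+ 2 <= _); last by rewrite exprMn; lra.
  by apply: lerXn2r => //; rewrite nnegrE ?sqr_ge0// (le_trans _ e1)// sqr_ge0.
apply: le_trans (_ : \int[P]_(w in A) (27%:E *
    (1%:E + ((enorm (xi w) ^+ 4)%:E + (enorm (psi w) ^+ 4)%:E))) <= _)%E.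
  apply: ge0_le_integral => //.
  - by move=> w _; rewrite lee_fin exprn_ge0// !addr_ge0.
  - apply/measurable_EFinP; apply: measurable_funTS.
    apply: measurable_funX; apply: measurable_funD; last exact: coord_meas_enorm.
    by apply: measurable_funD => //; exact: coord_meas_enorm.
  - apply/measurable_EFinP; apply: measurable_funTS; apply: measurable_funM => //.
    by apply: measurable_funD => //; exact: measurable_funD.
  - by move=> w _; rewrite -!EFinD -EFinM lee_fin.
have mx4E : measurable_fun A (fun w => (enorm (xi w) ^+ 4)%:E).
  by apply/measurable_EFinP; exact: measurable_funTS.
have mp4E : measurable_fun A (fun w => (enorm (psi w) ^+ 4)%:E).
  by apply/measurable_EFinP; exact: measurable_funTS.
have mD4 : measurable_fun A
    (fun w => (enorm (xi w) ^+ 4)%:E + (enorm (psi w) ^+ 4)%:E)%E.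
  exact: emeasurable_funD.
rewrite ge0_integralZl//; last 2 first.
- exact: emeasurable_funD.
- by move=> w _; rewrite -!EFinD lee_fin !addr_ge0// exprn_ge0.
rewrite ge0_integralD//; last first.
  by move=> w _; rewrite -EFinD lee_fin !addr_ge0// exprn_ge0.
rewrite ge0_integralD//; try by move=> w _; rewrite lee_fin exprn_ge0.
have -> : ((27 * (1 + c1 + c2))%:E * P A = 27%:E * (P A + (c1%:E * P A + c2%:E * P A)))%E.
  rewrite -(fineK (fin_num_measure P A mA)) -!(EFinM, EFinD).
  by congr EFin; ring.
rewrite lee_pmul2l//; apply: leeD; first by rewrite integral_cst// mul1e.
by apply: leeD; [exact: condexp_set_le ce1 b1 SA|exact: condexp_set_le ce2 b2 SA].
Qed.

End Bridge.

Section Adapted.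
Context {R : realType} {d : measure_display} {Omega : measurableType d}.

Definition adapted (G : set (set Omega)) n (X : Omega -> 'cV[R]_n) :=
  coord_meas (X : g_sigma_algebraType G -> 'cV[R]_n).

Lemma adapted_sub (G G' : set (set Omega)) n (X : Omega -> 'cV[R]_n) :
  G `<=` G' -> adapted G X -> adapted G' X.
Proof.
move=> GG' aX i _ B mB.
exact: (sub_smallest2r (smallest_sigma_algebra _ _) GG') (aX i measurableT B mB).
Qed.

Lemma sigma_of_adapted (G : set (set Omega)) n (X : Omega -> 'cV[R]_n) :
  sigma_of X `<=` G -> adapted G X.
Proof.
move=> XG; apply: borel_meas_coord => B bB; apply: sub_gen_smallest; apply: XG.
by exists B => //; rewrite setTI.
Qed.

Lemma sigma_of_measurable n (X : Omega -> 'cV[R]_n) :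
  random_element X -> sigma_of X `<=` measurable.
Proof. by move=> rX _ [B bB <-]; rewrite setTI; exact: rX. Qed.

End Adapted.

(** * Convergence rates *)

Section Rates.
Context {R : realType} {dx dy : nat}.
Variables (LH LF LGx LGy muF muG SH deltaH SBF SBG deltaF deltaG : R)
  (Gamma11 Gamma22 Sigma11 Sigma22 Sigma12 : R).
Hypotheses (LH0 : 0 < LH) (LF0 : 0 < LF) (LGx0 : 0 < LGx) (LGy0 : 0 < LGy)
  (muF0 : 0 < muF) (muG0 : 0 < muG) (SH0 : 0 <= SH)
  (deltaH_itv : 1 / 2 <= deltaH <= 1) (SBF0 : 0 <= SBF) (SBG0 : 0 <= SBG)
  (deltaF_itv : 0 < deltaF <= 1) (deltaG_itv : 0 < deltaG <= 1).

Definition noise_const : R := 27 * (1 + Gamma11 ^+ 2 + Gamma22 ^+ 2).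

Let Gam := noise_const.
Let Gam0 : 0 <= Gam.
Proof. by rewrite mulr_ge0// !addr_ge0 ?sqr_ge0. Qed.

Definition gain_fast : R := 128 * (LH * LGy) ^+ 4 / muF ^+ 3.
Definition gain_slow : R := 16 * LGx ^+ 4 / muG ^+ 3.

(** The threshold of [coupled_recursion] for c = muF / 8, c' = muG / 4 and the coupling coefficients
    of the two fourth-moment inequalities. *)
Definition loop_threshold : R :=
  muF / 8 / (4 * (gain_fast * (2 * gain_slow / (muG / 4) + 2) + 1)).

Let gf0 : 0 <= gain_fast.
Proof. by rewrite /gain_fast; nonneg. Qed.
Let gs0 : 0 <= gain_slow.
Proof. by rewrite /gain_slow; nonneg. Qed.

Lemma loop_threshold_gt0 : 0 < loop_threshold.
Proof. by rewrite !divr_gt0// mulr_gt0// ltr_wpDl//; nonneg. Qed.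

Variables (eps : R) (alpha beta : nat -> R).
Hypotheses (eps0 : 0 < eps) (eps1 : eps <= 1) (S : slow_steps eps alpha beta).
Hypotheses (eps_iota1 : eps <= iota1 muF LF) (eps_iota2 : eps <= iota2 muG LGy)
  (eps_lag : eps <= muF / (4 * (LH * LGx))) (eps_muF : eps <= muF / 64)
  (eps_muG : eps <= muG / 32) (eps_loop : eps <= loop_threshold).
Variables (CF CG : R).
Hypotheses (CF0 : 0 <= CF) (CG0 : 0 <= CG)
  (alphaF : forall t, alpha t `^ (1 + deltaF / 2) <= CF * beta t)
  (alphaG : forall t, alpha t `^ (1 + deltaG) <= CG * beta t).

Context {d : measure_display} {Omega : measurableType d}.
Variables (P : probability Omega R)
  (F : 'cV[R]_dx -> 'cV[R]_dy -> 'cV[R]_dx)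
  (G : 'cV[R]_dx -> 'cV[R]_dy -> 'cV[R]_dy)
  (H : 'cV[R]_dy -> 'cV[R]_dx) (ystar : 'cV[R]_dy)
  (x0 : 'cV[R]_dx) (y0 : 'cV[R]_dy)
  (xi x : nat -> Omega -> 'cV[R]_dx) (psi y : nat -> Omega -> 'cV[R]_dy).
Hypothesis bF : borel_fun (fun z : 'cV[R]_dx * 'cV[R]_dy => F z.1 z.2).
Hypothesis bG : borel_fun (fun z : 'cV[R]_dx * 'cV[R]_dy => G z.1 z.2).
Hypothesis rxi : forall t, random_element (xi t).
Hypothesis rpsi : forall t, random_element (psi t).
Hypothesis A1 : assumption_A1 LH LF F H.
Hypothesis A2 : assumption_A2 LGx LGy G H ystar.
Hypothesis A3 : assumption_A3 muF muG F G H ystar.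
Hypothesis A4 : assumption_A4 SH deltaH H.
Hypothesis A5 : assumption_A5 SBF SBG deltaF deltaG F G H ystar.
Hypothesis iter : tts_iterates F G alpha beta x0 y0 xi psi x y.
Hypothesis A6 : assumption_A6 P Gamma11 Gamma22 Sigma11 Sigma22 Sigma12
  (history x y xi psi) xi psi.

Let a0 t : 0 < alpha t. Proof. exact: alpha_gt0 S t. Qed.
Let b0 t : 0 < beta t. Proof. exact: beta_gt0 S t. Qed.
Let ba t : beta t <= alpha t.
Proof. by apply: le_trans (beta_le S t) _; rewrite ler_piMl// ltW. Qed.
Let ae t : alpha t <= eps. Proof. exact: alpha_le S t. Qed.
Let be t : beta t <= eps. Proof. exact: le_trans (ba t) (ae t). Qed.
Let a1 t : alpha t <= 1. Proof. exact: le_trans (ae t) eps1. Qed.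

Let aLF t : alpha t * LF ^+ 2 <= muF.
Proof.
have : alpha t <= muF / (4 * LF ^+ 2).
  by apply: le_trans (ae t) (le_trans eps_iota1 _); rewrite ge_min lexx.
rewrite ler_pdivlMr ?mulr_gt0 ?exprn_gt0//.
have : 0 <= alpha t * LF ^+ 2 by nonneg.
lra.
Qed.

Let amuF t : alpha t * muF <= 1.
Proof.
have : alpha t <= 1 / (12 * muF).
  by apply: le_trans (ae t) (le_trans eps_iota1 _); rewrite ge_min lexx orbT.
rewrite ler_pdivlMr ?mulr_gt0//.
have : 0 <= alpha t * muF by nonneg.
lra.
Qed.

Let bLGy t : beta t * LGy ^+ 2 <= muG.
Proof.
have : beta t <= muG / LGy ^+ 2.
  by apply: le_trans (be t) (le_trans eps_iota2 _); rewrite ge_min lexx.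
by rewrite ler_pdivlMr ?exprn_gt0.
Qed.

Let bmuG t : beta t * muG <= 1.
Proof.
have : beta t <= 1 / (14 * muG).
  by apply: le_trans (be t) (le_trans eps_iota2 _); rewrite ge_min lexx orbT.
rewrite ler_pdivlMr ?mulr_gt0//.
have : 0 <= beta t * muG by nonneg.
lra.
Qed.

Let bLH t : beta t * (LH * LGx) <= alpha t * muF / 4.
Proof.
apply: le_trans (_ : eps * alpha t * (LH * LGx) <= _).
  by rewrite ler_wpM2r ?beta_le//; nonneg.
have : eps * (4 * (LH * LGx)) <= muF.
  by rewrite -ler_pdivlMr// !mulr_gt0.
move=> /(ler_wpM2l (ltW (a0 t))); lra.
Qed.

(** The family generating [history]; [g_sigma_algebraType] is built from generators. *)
Let gen t := sigma_of (x 0%N) `|` sigma_of (y 0%N) `|`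
  \bigcup_(s in [set s | (s < t)%N]) (sigma_of (xi s) `|` sigma_of (psi s)).

Let cst_random n (v : 'cV[R]_n) (X : Omega -> 'cV[R]_n) :
  (forall w, X w = v) -> random_element X.
Proof.
move=> Xv; have -> : X = fun=> v by apply/funext.
exact: (coord_meas_borel (coord_meas_cst v)).
Qed.

Let gen_measurable t : gen t `<=` measurable.
Proof.
have [x0E y0E _ _] := iter.
rewrite /gen !subUset; split; first split.
- exact/sigma_of_measurable/(cst_random x0E).
- exact/sigma_of_measurable/(cst_random y0E).
- apply: bigcup_sub => s _; rewrite subUset.
  by split; exact: sigma_of_measurable.
Qed.

Let gen_incr t : gen t `<=` gen t.+1.
Proof.
apply: setUS; apply: bigcup_subset => s /= st.
exact: ltn_trans st (ltnSn t).
Qed.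

Let phi t : Omega -> g_sigma_algebraType (gen t) := id.
Let mphi t : measurable_fun setT (phi t).
Proof. exact: id_measurable (@gen_measurable t). Qed.

Let H_lip y1 y2 : enorm (H y1 - H y2) <= LH * enorm (y1 - y2).
Proof. by have [_ h _] := A1. Qed.

Let xy_adapted t : adapted (gen t) (x t) /\ adapted (gen t) (y t).
Proof.
have [x0E y0E xE yE] := iter.
elim: t => [|t [IHx IHy]].
  split; apply: sigma_of_adapted; rewrite /gen.
    by rewrite -setUA; exact: subsetUl.
  by move=> A sA; left; right.
have hx := adapted_sub (@gen_incr t) IHx.
have hy := adapted_sub (@gen_incr t) IHy.
have hxi : adapted (gen t.+1) (xi t).
  by apply: sigma_of_adapted => A sA; right; exists t => //=; left.
have hpsi : adapted (gen t.+1) (psi t).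
  by apply: sigma_of_adapted => A sA; right; exists t => //=; right.
have hF := coord_meas_map2 bF hx hy; have hG := coord_meas_map2 bG hx hy.
split.
  have -> : x t.+1 = fun w => x t w - alpha t *: (F (x t w) (y t w) + xi t w).
    exact/funext/xE.
  exact: (coord_meas_B hx (coord_meas_Z _ (coord_meas_D hF hxi))).
have -> : y t.+1 = fun w => y t w - beta t *: (G (x t w) (y t w) + psi t w).
  exact/funext/yE.
exact: (coord_meas_B hy (coord_meas_Z _ (coord_meas_D hG hpsi))).
Qed.

Let mx t : coord_meas (x t : g_sigma_algebraType (gen t) -> _).
Proof. exact: (xy_adapted t).1. Qed.
Let my t : coord_meas (y t : g_sigma_algebraType (gen t) -> _).
Proof. exact: (xy_adapted t).2. Qed.
Let mxi t : coord_meas (xi t). Proof. exact/borel_meas_coord/rxi. Qed.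
Let mpsi t : coord_meas (psi t). Proof. exact/borel_meas_coord/rpsi. Qed.

Let xi_mean t : mean_zero P (phi t) (xi t).
Proof. exact: condexp_mean_zero (@gen_measurable t) _ _ (A6_mean_xi A6 t). Qed.
Let psi_mean t : mean_zero P (phi t) (psi t).
Proof. exact: condexp_mean_zero (@gen_measurable t) _ _ (A6_mean_psi A6 t). Qed.

Let noise_control t : moment_control P (phi t)
  (fun w => (1 + enorm (xi t w) + enorm (psi t w)) ^+ 4) Gam.
Proof.
have [m1 ce1 le1] := A6_fourth_xi A6 t; have [m2 ce2 le2] := A6_fourth_psi A6 t.
exact: (condexp_moment_control (@gen_measurable t) (@mxi t) (@mpsi t)
  (sqr_ge0 _) (sqr_ge0 _) ce1 le1 ce2 le2).
Qed.

Let xh t w := x t w - H (y t w).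
Let yh t w := y t w - ystar.

Let next_xhE t : next_xh (phi t) F G H (alpha t) (beta t) (x t) (y t) (xi t) (psi t)
  = xh t.+1.
Proof.
have [_ _ xE yE] := iter; apply/funext => w.
by rewrite /xh xE yE.
Qed.

Let next_yhE t : next_yh (phi t) G ystar (beta t) (x t) (y t) (psi t) = yh t.+1.
Proof.
have [_ _ xE yE] := iter; apply/funext => w.
by rewrite /yh yE.
Qed.

Let X4 t := \int[P]_w (enorm (xh t w) ^+ 4).
Let Y4 t := \int[P]_w (enorm (yh t w) ^+ 4).

Let fourth t (Lx : L1 P (fun w => enorm (xh t w) ^+ 4))
    (Ly : L1 P (fun w => enorm (yh t w) ^+ 4)) :=
  (fast_fourth_step (@mphi t) LH0 LF0 LGy0 muF0 SH0 deltaH_itv bF bG A1 A2 A3 A4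
    (a0 t) (b0 t) (a1 t) (ba t) (aLF t) (amuF t) (bLH t) (@mx t) (@my t)
    (@mxi t) (@mpsi t) Gam0 (@noise_control t) (@xi_mean t) (@psi_mean t) Lx Ly,
   slow_fourth_step (@mphi t) LGx0 LGy0 muG0 bG A2 A3
    (b0 t) (a1 t) (ba t) (bLGy t) (bmuG t) (@mx t) (@my t)
    (@mxi t) (@mpsi t) Gam0 (@noise_control t) (@xi_mean t) (@psi_mean t) Lx Ly).

(** The step inequalities presuppose integrability at time t and return it at time t + 1; the
    induction starts from deterministic initial points. *)
Let fourth_integrable t : L1 P (fun w => enorm (xh t w) ^+ 4) /\
  L1 P (fun w => enorm (yh t w) ^+ 4).
Proof.
have [x0E y0E _ _] := iter.
elim: t => [|t [Lx Ly]].
  split.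
    have -> : (fun w => enorm (xh 0%N w) ^+ 4) = fun=> enorm (x0 - H y0) ^+ 4.
      by apply/funext => w; rewrite /xh x0E y0E.
    exact: L1_cst.
  have -> : (fun w => enorm (yh 0%N w) ^+ 4) = fun=> enorm (y0 - ystar) ^+ 4.
    by apply/funext => w; rewrite /yh y0E.
  exact: L1_cst.
have := fourth Lx Ly; rewrite next_xhE next_yhE => -[[L _] [L' _]].
by split.
Qed.

Let Lx4 t := (@fourth_integrable t).1.
Let Ly4 t := (@fourth_integrable t).2.

Let fourth_moments : exists2 A, 0 <= A & forall t,
  X4 t <= A * alpha t ^+ 2 /\ Y4 t <= A * alpha t ^+ 2.
Proof.
have mc0 (e C : R) : 0 < e -> 0 <= C -> 0 <= moment_const e C Gam.
  by move=> e0 C0; rewrite /moment_const /=; nonneg.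
apply: (@coupled_recursion _ eps _ _ eps0 eps1 S X4 Y4 (muF / 8) (muG / 4)
  gain_fast gain_slow (moment_const (muF / 8) (1 + LH + SH) Gam)
  (moment_const (muG / 4) 1 Gam)) => //.
- by rewrite divr_gt0.
- by rewrite divr_gt0.
- by apply: mc0; [rewrite divr_gt0|nonneg].
- by apply: mc0; rewrite ?divr_gt0.
- by move: eps_muF; lra.
- by move: eps_muG; lra.
- by move=> t; move: (amuF t); lra.
- by move=> t; move: (bmuG t); lra.
- by move=> t; apply: Rintegral_ge0 => w _; rewrite exprn_ge0.
- by move=> t; apply: Rintegral_ge0 => w _; rewrite exprn_ge0.
- move=> t; have [[_ h] _] := fourth (Lx4 t) (Ly4 t).
  by rewrite next_xhE -[X in 1 - X]mulrA in h; exact: h.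
- move=> t; have [_ [_ h]] := fourth (Lx4 t) (Ly4 t).
  by rewrite next_yhE -[X in 1 - X]mulrA in h; exact: h.
Qed.

Let mxhT t : coord_meas (xh t : g_sigma_algebraType (gen t) -> _).
Proof.
have bH : borel_fun H.
  by apply: continuous_borel_fun; exact: lipschitz_continuous H_lip.
exact: (coord_meas_B (@mx t)
  (borel_meas_coord (borel_meas_comp (coord_meas_borel (@my t)) bH))).
Qed.

Let myhT t : coord_meas (yh t : g_sigma_algebraType (gen t) -> _).
Proof. exact: (coord_meas_B (@my t) (coord_meas_cst ystar)). Qed.

(* Q rescales the fourth moments to order one, so that every product of total
   degree r <= 4 in the errors is at most alpha^(r/2) Q. *)
Let Q t (w : Omega) :=
  1 + (enorm (xh t w) ^+ 4 + enorm (yh t w) ^+ 4) / alpha t ^+ 2.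

Let al2 t : 0 < alpha t ^+ 2. Proof. by rewrite exprn_gt0. Qed.

Let mQ t : measurable_fun setT (Q t : g_sigma_algebraType (gen t) -> R).
Proof.
apply: measurable_funD => //; apply: measurable_funM => //.
apply: measurable_funD; apply: measurable_funX; apply: coord_meas_enorm.
  exact: mxhT.
exact: myhT.
Qed.

Let Q1 t w : 1 <= Q t w.
Proof. by rewrite /Q lerDl; nonneg. Qed.

Let pqQ t w : enorm (xh t w) ^+ 4 + enorm (yh t w) ^+ 4 <= alpha t ^+ 2 * Q t w.
Proof.
rewrite /Q mulrDr mulr1 [X in _ <= _ + X]mulrC divfK ?gt_eqF// lerDr ltW//.
Qed.

Let QE t : Q t = (fun w => 1 + (alpha t ^+ 2)^-1 *
  (enorm (xh t w) ^+ 4 + enorm (yh t w) ^+ 4)).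
Proof. by apply/funext => w; rewrite /Q mulrC. Qed.

Let LQ t : L1 P (Q t).
Proof.
rewrite QE; apply: L1_add; first exact: L1_cst.
by apply: L1_scale; apply: L1_add; [exact: Lx4|exact: Ly4].
Qed.

Let EQ A t : X4 t <= A * alpha t ^+ 2 /\ Y4 t <= A * alpha t ^+ 2 ->
  \int[P]_w Q t w <= 1 + 2 * A.
Proof.
move=> [hX hY].
have L4 := L1_add (Lx4 t) (Ly4 t).
rewrite QE Ex_add ?Ex_cst ?Ex_scale ?Ex_add//; try exact: L1_cst.
  rewrite lerD2l ler_pdivrMl//; rewrite /X4 /Y4 in hX hY; lra.
exact: L1_scale.
Qed.

Let cross_rate : exists2 C, 0 <= C & forall t i j,
  `|\int[P]_w (xh t w i 0 * yh t w j 0)| <= C * beta t.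
Proof.
have [A A0 HA] := fourth_moments.
have [B1 [B2 [B3 [linF _]]]] := A5.
have /andP[dF0 dF1] := deltaF_itv.
(* The 2 accounts for the powers of |x'| and of |y'| in the linearization error of F; [CF] converts
   alpha^(1 + deltaF/2) into beta. *)
pose Ce := 2 * SBF * CF.
have Ce0 : 0 <= Ce by rewrite /Ce; nonneg.
have eF t w : enorm (yh t w) * enorm (F (x t w) (y t w) - B1 *m xh t w)
    <= Ce * beta t * Q t w.
  have dF2 : 0 <= deltaF <= 2 by apply/andP; split; lra.
  have [h1 h2] := mixed_powR_le_moment (enorm_ge0 (xh t w)) (enorm_ge0 (yh t w))
    (a0 t) (Q1 t w) (pqQ t w) dF2.
  apply: le_trans (ler_wpM2l (enorm_ge0 _) (linF (x t w) (y t w))) _.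
  have h3 : alpha t `^ (1 + deltaF / 2) * Q t w <= CF * beta t * Q t w.
    by rewrite ler_wpM2r// (le_trans _ (Q1 t w)).
  have h4 : SBF * (enorm (yh t w) * enorm (xh t w) `^ (1 + deltaF)
      + enorm (yh t w) * enorm (yh t w) `^ (1 + deltaF))
      <= SBF * (2 * (CF * beta t * Q t w)).
    by rewrite ler_wpM2l//; lra.
  rewrite -/(xh t w) -/(yh t w) /Ce; lra.
have con t := linear_fast_contract LF0 A1 A3 (a0 t) (aLF t) (amuF t) dF0 linF.
have step t j := cross_step (@mphi t) LH0 LF0 LGx0 LGy0 muF0 muG0 SH0 deltaH_itv bF bG
  A1 A2 A3 A4 (a0 t) (b0 t) (a1 t) (ba t) (aLF t) (amuF t) (bLGy t) (bmuG t) (bLH t)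
  (@mx t) (@my t) (@mxi t) (@mpsi t) Gam0 (@noise_control t) (@xi_mean t)
  (@psi_mean t) (@mQ t) (Q1 t) (LQ t) (EQ (HA t)) (pqQ t) Ce0 (eF t) (con t) j.
(* Summing the column norms gives one scalar recursion that controls all entries. *)
pose z t := \sum_j enorm (\col_i \int[P]_w (xh t w i 0 * yh t w j 0)).
pose K := dy%:R * (dx%:R * (cross_const LH LGx LGy SH Ce * (Gam * (1 + 2 * A)))).
have K0 : 0 <= K by rewrite /K /cross_const; nonneg.
have [C C0 zC] : exists2 C, 0 <= C & forall t, z t <= C * beta t.
  apply: (@linear_recursion _ eps alpha beta eps0 S alpha z (muF / 2) K) => //.
  - by rewrite divr_gt0.
  - by move: eps_muF muF0; lra.
  - by move=> t; apply: sumr_ge0 => j _; exact: enorm_ge0.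
  - by move=> t; move: (amuF t); lra.
  move=> t; rewrite /z mulr_sumr.
  have -> : K * (alpha t * beta t) = \sum_(j < dy) dx%:R *
      (cross_const LH LGx LGy SH Ce * (alpha t * beta t) * (Gam * (1 + 2 * A))).
    rewrite sumr_const card_ord -mulr_natl /K; ring.
  rewrite -big_split; apply: ler_sum => j _ /=.
  have := step t j; rewrite next_xhE next_yhE.
  by have -> : muF / 2 * alpha t = alpha t * muF / 2 by ring.
exists C => // t i j; apply: le_trans (zC t).
rewrite /z (bigD1 j)//=; apply: ler_wpDr.
  by apply: sumr_ge0 => k _; exact: enorm_ge0.
apply: le_trans (coord_le_enorm _ i); by rewrite mxE.
Qed.

Let Lx2 t : L1 P (fun w => enorm (xh t w) ^+ 2) /\
  L1 P (fun w => enorm (yh t w) ^+ 2).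
Proof.
have mphi' n (X : Omega -> 'cV[R]_n) :
    coord_meas (X : g_sigma_algebraType (gen t) -> _) -> coord_meas X.
  by move=> mX i; exact: (measurableT_comp (mX i) (@mphi t)).
have sq (s : R) : `|s ^+ 2| <= 1 + s ^+ 4.
  rewrite ger0_norm ?sqr_ge0//; have := sqr_ge0 (1 - s ^+ 2).
  have := sqr_ge0 (s ^+ 2); lra.
split.
  apply: (L1_le _ (L1_add (L1_cst P 1) (Lx4 t))) => [|w]; last exact: sq.
  by apply: measurable_funX; exact: (coord_meas_enorm (mphi' _ _ (@mxhT t))).
apply: (L1_le _ (L1_add (L1_cst P 1) (Ly4 t))) => [|w]; last exact: sq.
by apply: measurable_funX; exact: (coord_meas_enorm (mphi' _ _ (@myhT t))).
Qed.

(** With the cross moment of order beta, its contribution to one step is of order beta^2, like that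
    of the noise; [linear_recursion] then applies with gam = beta. The weight muG / 8 fixes how much
    contraction the linearization error of G may consume. *)
Let slow_rate : exists C, forall t, \int[P]_w (enorm (yh t w) ^+ 2) <= C * beta t.
Proof.
have [A A0 HA] := fourth_moments.
have [Cz Cz0 zC] := cross_rate.
have [B1 [B2 [B3 [_ linG]]]] := A5.
have /andP[dG0 dG1] := deltaG_itv.
have mu8 : 0 < muG / 8 by rewrite divr_gt0.
have lipG x' y' : enorm (G x' y' - G (H y') y') <= LGx * enorm (x' - H y').
  by have [_ h _] := A2.
have [D D0 errG] := slow_linearization_error mu8 (ltW LGx0) SBG0 deltaG_itv lipG linG.
pose Ce := D * CG.
have Ce0 : 0 <= Ce by rewrite /Ce; nonneg.
have eG t w : enorm (yh t w) *
    enorm (G (x t w) (y t w) - G (H (y t w)) (y t w) - B2 *m xh t w)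
    <= muG / 8 * enorm (yh t w) ^+ 2 + Ce * beta t * Q t w.
  apply: le_trans (errG (x t w) (y t w)) _; rewrite lerD2l /Ce -!mulrA ler_wpM2l//.
  have r4 : 0 <= 2 + 2 * deltaG <= 4 by apply/andP; split; lra.
  have xQ : enorm (xh t w) ^+ 4 <= alpha t ^+ 2 * Q t w.
    by apply: le_trans (pqQ t w); rewrite lerDl exprn_ge0// enorm_ge0.
  apply: le_trans (powR_le_moment (enorm_ge0 _) (a0 t) (Q1 t w) xQ r4) _.
  have -> : (2 + 2 * deltaG) / 2 = 1 + deltaG by field.
  by rewrite mulrA ler_wpM2r// (le_trans _ (Q1 t w)).
have step t := slow_second_step (@mphi t) LGx0 LGy0 muG0 deltaH_itv bF bG
  A1 A2 A3 A4 (a0 t) (b0 t) (a1 t) (ba t) (bLGy t) (bmuG t)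
  (@mx t) (@my t) (@mxi t) (@mpsi t) Gam0 (@noise_control t) (@xi_mean t)
  (@psi_mean t) (@mQ t) (Q1 t) (LQ t) (EQ (HA t)) (pqQ t) Ce0 (eG t) (zC t).
pose K1 := 2 * Ce + 2 * LGx * LGy + LGx ^+ 2 + 1.
pose NB := \sum_i \sum_j `|B2 i j|.
have NB0 : 0 <= NB by rewrite /NB; do 2!apply: sumr_ge0 => ? _.
pose K := 2 * NB * Cz + K1 * (Gam * (1 + 2 * A)).
have K0 : 0 <= K by rewrite /K /K1; nonneg.
have [C _ yC] : exists2 C, 0 <= C &
    forall t, \int[P]_w (enorm (yh t w) ^+ 2) <= C * beta t.
  apply: (@linear_recursion _ eps alpha beta eps0 S beta _ (muG / 2) K) => //.
  - by rewrite divr_gt0.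
  - by move: eps_muG muG0; lra.
  - by move=> t; apply: Rintegral_ge0 => w _; rewrite sqr_ge0.
  - by move=> t; move: (bmuG t); lra.
  move=> t; have := step t; rewrite next_yhE -/NB -/K1 => /le_trans; apply.
  rewrite le_eqVlt; apply/orP; left; apply/eqP.
  rewrite -[\int[P]_w _]/(\int[P]_w enorm (yh t w) ^+ 2) /K; ring.
by exists C.
Qed.

Let bigO_of_integral (f : Omega -> R) (C : R) : L1 P f -> (forall w, 0 <= f w) ->
  \int[P]_w f w <= C -> (`|'E_P[f]| <= C%:E)%E.
Proof.
move=> Lf f0 fC; rewrite unlock gee0_abs; last first.
  by apply: integral_ge0 => w _; rewrite lee_fin.
by rewrite -(fineK (integrable_fin_num measurableT Lf)) lee_fin.
Qed.

Lemma tts_rates :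
  [/\ seq_bigO (fun t => 'E_P[(fun w => enorm (xh t w) ^+ 2)%R]%E) alpha,
      seq_bigO (fun t => (specnorm
        (expectation_mx P (fun w => xh t w *m (yh t w)^T)))%:E) beta &
      seq_bigO (fun t => 'E_P[(fun w => enorm (yh t w) ^+ 2)%R]%E) beta].
Proof.
split.
- have [A A0 HA] := fourth_moments; exists (1 + 2 * A) => t.
  apply: bigO_of_integral; [exact: (Lx2 t).1|by move=> w; exact: sqr_ge0|].
  (* The fast rate follows from the fourth moments alone: |x'|^2 <= alpha Q pointwise, and Q has
     bounded mean. *)
  apply: le_trans (_ : \int[P]_w (alpha t * Q t w) <= _).
    apply: Ex_le; [exact: (Lx2 t).1|exact/L1_scale/LQ|move=> w].
    apply: sqr_le_moment => //.
    by apply: le_trans (pqQ t w); rewrite lerDl exprn_ge0// enorm_ge0.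
  by rewrite Ex_scale// mulrC ler_wpM2r ?(ltW (a0 t))// EQ.
- have [C C0 zC] := cross_rate; exists (C * (dx * dy)%:R) => t.
  rewrite abse_EFin lee_fin mulrAC; apply: specnorm_le.
    by rewrite mulr_ge0// ltW.
  move=> i j; rewrite mxE unlock.
  under eq_integral do rewrite mxE big_ord1 [_^T _ _]mxE.
  exact: zC.
- have [C yC] := slow_rate; exists C => t.
  by apply: bigO_of_integral; [exact: (Lx2 t).2|move=> w; exact: sqr_ge0|].
Qed.

End Rates.

Lemma exists_small {R : realType} (s : seq R) : all (fun e => 0 < e) s ->
  exists2 eps, 0 < eps <= 1 & all (fun e => eps <= e) s.
Proof.
elim: s => [_|e s IH /= /andP[e0 /IH[eps /andP[eps0 eps1] epss]]].
  by exists 1; rewrite ?ltr01 ?lexx.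
exists (Num.min e eps); first by rewrite lt_min e0 eps0 ge_min eps1 orbT.
rewrite /= ge_min lexx/=; apply: sub_all epss => e' /= h.
by rewrite ge_min h orbT.
Qed.

Theorem corollary3p1 (R : realType) (dx dy : nat)
    (LH LF LGx LGy muF muG SH deltaH SBF SBG deltaF deltaG : R)
    (Gamma11 Gamma22 Sigma11 Sigma22 Sigma12 : R) (a b : R)
    (LH_gt0 : 0 < LH) (LF_gt0 : 0 < LF) (LGx_gt0 : 0 < LGx) (LGy_gt0 : 0 < LGy)
    (muF_gt0 : 0 < muF) (muG_gt0 : 0 < muG)
    (SH_ge0 : 0 <= SH) (deltaH_itv : 1 / 2 <= deltaH <= 1)
    (SBF_ge0 : 0 <= SBF) (SBG_ge0 : 0 <= SBG)
    (deltaF_itv : 0 < deltaF <= 1) (deltaG_itv : 0 < deltaG <= 1)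
    (a_itv : 0 < a <= 1) (b_itv : 0 < b <= 1)
    (ba_ratio : 1 <= b / a <= 1 + Num.min (deltaF / 2) deltaG) :
  exists alpha0 beta0 T0 : R,
    [/\ 0 < alpha0, 0 < beta0, 0 < T0 &
     let alpha := poly_step alpha0 T0 a in
     let beta := poly_step beta0 T0 b in
     assumption_A7 dx LH LF LGx LGy muF muG deltaF deltaG alpha beta /\
     forall (d : measure_display) (Omega : measurableType d)
       (P : probability Omega R)
       (F : 'cV[R]_dx -> 'cV[R]_dy -> 'cV[R]_dx)
       (G : 'cV[R]_dx -> 'cV[R]_dy -> 'cV[R]_dy)
       (H : 'cV[R]_dy -> 'cV[R]_dx) (ystar : 'cV[R]_dy)
       (x0 : 'cV[R]_dx) (y0 : 'cV[R]_dy)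
       (xi x : nat -> Omega -> 'cV[R]_dx) (psi y : nat -> Omega -> 'cV[R]_dy),
     borel_fun (fun z : 'cV[R]_dx * 'cV[R]_dy => F z.1 z.2) ->
     borel_fun (fun z : 'cV[R]_dx * 'cV[R]_dy => G z.1 z.2) ->
     (forall t, random_element (xi t)) ->
     (forall t, random_element (psi t)) ->
     assumption_A1 LH LF F H ->
     assumption_A2 LGx LGy G H ystar ->
     assumption_A3 muF muG F G H ystar ->
     assumption_A4 SH deltaH H ->
     assumption_A5 SBF SBG deltaF deltaG F G H ystar ->
     tts_iterates F G alpha beta x0 y0 xi psi x y ->
     assumption_A6 P Gamma11 Gamma22 Sigma11 Sigma22 Sigma12
       (history x y xi psi) xi psi ->
     let xhat t w : 'cV[R]_dx := x t w - H (y t w) in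
     let yhat t w : 'cV[R]_dy := y t w - ystar in
     [/\ seq_bigO (fun t => 'E_P[(fun w => enorm (xhat t w) ^+ 2)%R]%E) alpha,
         seq_bigO (fun t => (specnorm
           (expectation_mx P (fun w => xhat t w *m (yhat t w)^T)))%:E) beta &
         seq_bigO (fun t => 'E_P[(fun w => enorm (yhat t w) ^+ 2)%R]%E) beta]].
Proof.
have /andP[a0 a1] := a_itv; have /andP[b0 b1] := b_itv.
have /andP[ba1 ba2] := ba_ratio.
have /andP[dF0 dF1] := deltaF_itv; have /andP[dG0 dG1] := deltaG_itv.
have ab : a <= b by rewrite -[a]mul1r -ler_pdivlMr.
have bF : b <= a * (1 + deltaF / 2).
  rewrite mulrC -ler_pdivrMr//; apply: le_trans ba2 _.
  by rewrite lerD2l ge_min lexx.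
have bG : b <= a * (1 + deltaG).
  rewrite mulrC -ler_pdivrMr//; apply: le_trans ba2 _.
  by rewrite lerD2l ge_min lexx orbT.
(* Every threshold on eps: the first eight give (A7), and the last three are added for the rates.
   None of them refers to the probability space or to the maps. *)
pose s := [:: iota1 muF LF; iota2 muG LGy; kappa dx muF muG LH LGx LGy;
  rho dx muF LH LGx; deltaF * muF / 16; deltaF * muG / 16; deltaG * muG / 8;
  muG / 64; muF / (4 * (LH * LGx)); muF / 64;
  loop_threshold LH LGx LGy muF muG].
have s0 : all (fun e => 0 < e) s.
  (* [dx] may be 0, so the maxima in [kappa] and [rho] owe their positivity to their second
     arguments. *)
  have max_gt0 (p q : R) : 0 < q -> 0 < Num.max p q.
    by move=> q0; rewrite lt_max q0 orbT.
  rewrite /= /iota1 /iota2 /kappa /rho !lt_min.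
  repeat first [ done | exact: loop_threshold_gt0 | apply/andP; split
    | apply: max_gt0 | apply: exprn_gt0 | apply: divr_gt0 | apply: mulr_gt0 ].
have [eps eps01 /=] := exists_small s0.
have /andP[eps0 eps1] := eps01.
move=> /and5P[e1 e2 e3 e4 /and5P[e5 e6 e7 e8 /and4P[e9 e10 e11 _]]].
have [alpha0 [beta0 [T0 [al0 be0 T01 S]]]] := poly_slow_steps a_itv b_itv ab eps01.
have T00 : 0 < T0 by exact: lt_le_trans T01.
exists alpha0, beta0, T0; split => //=; split.
  exact: slow_steps_A7 S eps01 e1 e2 e3 e4 e5 e6 e7 e8.
have [CF CF0 HF] := poly_step_powR_le al0 be0 T01 bF.
have [CG CG0 HG] := poly_step_powR_le al0 be0 T01 bG.
move=> d Omega P F G H ystar x0 y0 xi x psi y mF mG rxi rpsi A1 A2 A3 A4 A5 it A6.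
have e8' : eps <= muG / 32 by apply: le_trans e8 _; move: muG_gt0; lra.
exact: (tts_rates LH_gt0 LF_gt0 LGx_gt0 LGy_gt0 muF_gt0 muG_gt0 SH_ge0 deltaH_itv
  SBF_ge0 SBG_ge0 deltaF_itv deltaG_itv eps0 eps1 S e1 e2 e9 e10 e8' e11 CF0 CG0 HF HG
  mF mG rxi rpsi A1 A2 A3 A4 A5 it A6).
Qed.
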